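(* Let $n\in\mathbb{N}$, fix $0<\alpha<n$, $1<p<n/\alpha$, and set $q:=np/(n-\alpha p)$. Let $E\subset\mathbb{R}^n$ be a median porous set with $0<\operatorname{diam}(E)<\infty$. Then, for any exponents $\gamma_1,\gamma_2,\delta_1,\delta_2\in\mathbb{R}$ verifying $$-\gamma_j\in I_\infty(E)\quad\text{and}\quad\delta_j\,p'/p\in I_\infty(E)\qquad\text{for } j=1,2,$$ $$\gamma_1\ge\frac{q}{p}\delta_1\qquad\text{and}\qquad\gamma_2\le\frac{q}{p}\delta_2,$$ we have $u_{\gamma_1,\gamma_2},\,u_{\delta_1,\delta_2}^{-p'/p}\in A_\infty(\mathbb{R}^n)$ and there exists $C>0$, depending only on $\gamma_1,\gamma_2,\delta_1,\delta_2,p,\alpha,n$, and $E$, such that $$\left(\int_{\mathbb{R}^n}|I_\alpha(f)(x)|^q\,u_{\gamma_1,\gamma_2}(x)\,dx\right)^{1/q}\le C\left(\int_{\mathbb{R}^n}|f(x)|^p\,u_{\delta_1,\delta_2}(x)\,dx\right)^{1/p}$$ for every measurable $f$.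
   Context: Here $p'=p/(p-1)$, $d(x,E)=\inf\{|x-y|:y\in E\}$ and $\operatorname{diam}(E)=\sup\{|x-y|:x,y\in E\}$. The fractional integral operator is $I_\alpha(f)(x)=\int_{\mathbb{R}^n}\frac{f(y)}{|x-y|^{n-\alpha}}\,dy$. The class $A_\infty(\mathbb{R}^n)$ consists of the weights $w$ (i.e. $w\in L^1_{\rm loc}(\mathbb{R}^n)$, $w\ge0$ a.e.) with $\sup_Q\left(\frac{1}{|Q|}\int_Q w\right)\exp\left(-\frac{1}{|Q|}\int_Q\ln w\right)<\infty$, the supremum over all cubes $Q\subset\mathbb{R}^n$. For nonempty $E\subset\mathbb{R}^n$ set $I_\infty(E):=\{\beta\in\mathbb{R}: d(\cdot,E)^{-\beta}\in A_\infty(\mathbb{R}^n)\}$; $E$ is called median porous if there exists $\beta>0$ with $d(\cdot,E)^{-\beta}\in A_\infty(\mathbb{R}^n)$. For $\gamma_1,\gamma_2\in\mathbb{R}$ the weight $u_{\gamma_1,\gamma_2}$ is defined for $x\in\mathbb{R}^n\setminus E$ (it is well defined a.e. when $E$ is median porous, since then $|\overline{E}|=0$) by $u_{\gamma_1,\gamma_2}(x)=\left(\frac{d(x,E)}{\operatorname{diam}(E)}\right)^{\gamma_1}$ if $d(x,E)<\operatorname{diam}(E)$ and $u_{\gamma_1,\gamma_2}(x)=\left(\frac{d(x,E)}{\operatorname{diam}(E)}\right)^{\gamma_2}$ if $d(x,E)\ge\operatorname{diam}(E)$. *)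

(* Defs.v *)
From HB Require Import structures.
From mathcomp Require Import all_boot all_order all_algebra.
From mathcomp Require Import all_classical all_reals all_analysis.
From mathcomp Require Import measurable_realfun.

Set Implicit Arguments.
Unset Strict Implicit.
Unset Printing Implicit Defensive.

Import Order.TTheory GRing.Theory Num.Theory.
Import numFieldNormedType.Exports.

Local Open Scope classical_set_scope.
Local Open Scope ring_scope.

(* The Borel sigma-algebra of R^n, generated by the n coordinate maps. *)
Section borel_rV.
Context {R : realType} {n : nat}.

Definition rV_coord (i : 'I_n) (x : 'rV[R]_n) : measurableTypeR R := x 0 i.

Let rV_set0 : g_sigma_preimage rV_coord set0.
Proof. exact: sigma_algebra0. Qed.

Let rV_setC A : g_sigma_preimage rV_coord A -> g_sigma_preimage rV_coord (~` A).
Proof. exact: sigma_algebraC. Qed.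

Let rV_bigcup (F : (set 'rV[R]_n)^nat) :
  (forall i, g_sigma_preimage rV_coord (F i)) ->
  g_sigma_preimage rV_coord (\bigcup_i (F i)).
Proof. exact: sigma_algebra_bigcup. Qed.

HB.instance Definition _ := @isMeasurable.Build default_measure_display
  'rV[R]_n (g_sigma_preimage rV_coord) rV_set0 rV_setC rV_bigcup.

Lemma measurable_rV_coord i : measurable_fun [set: 'rV[R]_n] (rV_coord i).
Proof.
move=> _ Y mY; rewrite setTI; apply: sub_sigma_algebra => /=.
rewrite -bigcup_seq/=; exists i => /=; first by rewrite mem_index_enum.
by exists Y => //; rewrite setTI.
Qed.

Lemma measurable_fun_rV d (T : measurableType d) (f : T -> 'rV[R]_n) :
  (forall i, measurable_fun [set: T] (rV_coord i \o f)) ->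
  measurable_fun [set: T] f.
Proof.
move=> mf.
suff prefS : g_sigma_preimage (fun i => rV_coord i \o f) `<=` measurable.
  move=> _ A mA; apply: prefS; rewrite g_sigma_preimage_comp.
  by exists A.
apply: smallest_sub; first exact: sigma_algebra_measurable.
move=> A; rewrite -bigcup_seq => -[i _ [B mB <-]].
exact: mf.
Qed.

End borel_rV.

(* Lebesgue measure on the Borel sets of R^n, as an n-fold product. *)
Section borel_lebesgue.
Context {R : realType}.

Definition rV_cons n (z : measurableTypeR R * 'rV[R]_n) : 'rV[R]_n.+1 :=
  row_mx (const_mx z.1 : 'rV[R]_1) z.2.

Definition rV_uncons n (v : 'rV[R]_n.+1) : measurableTypeR R * 'rV[R]_n :=
  (v 0 0, rsubmx (v : 'rV[R]_(1 + n))).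

Lemma rV_consK n : cancel (@rV_cons n) (@rV_uncons n).
Proof.
move=> [x v]; rewrite /rV_cons /rV_uncons/= row_mxKr; congr pair.
have -> : 0 = lshift n (0 : 'I_1) by apply: ord_inj.
by apply: (etrans (row_mxEl _ _ _ _)); rewrite mxE.
Qed.

Lemma rV_unconsK n : cancel (@rV_uncons n) (@rV_cons n).
Proof.
move=> v; apply: (etrans _ (@hsubmxK _ 1 1 n v)).
rewrite /rV_cons /rV_uncons/=; congr (row_mx _ _).
by apply/rowP => j; rewrite !mxE ord1; congr (v _ _); apply: ord_inj.
Qed.

Lemma measurable_rV_cons n : measurable_fun [set: _] (@rV_cons n).
Proof.
apply: measurable_fun_rV => i.
have [k ->|k ->] := @split_ordP 1 n i.
  rewrite (_ : _ \o _ = fst) //; apply/funext => z /=.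
  by apply: (etrans (row_mxEl _ _ _ _)); rewrite mxE.
rewrite (_ : _ \o _ = rV_coord k \o snd).
  by apply: measurableT_comp => //; exact: measurable_rV_coord.
by apply/funext => z /=; exact: row_mxEr.
Qed.

Lemma measurable_rV_uncons n : measurable_fun [set: _] (@rV_uncons n).
Proof.
apply: measurable_fun_pair; first exact: (measurable_rV_coord 0).
apply: measurable_fun_rV => i.
rewrite (_ : _ \o _ = rV_coord (rshift 1 i)); first exact: measurable_rV_coord.
by apply/funext => v /=; rewrite /rV_coord mxE.
Qed.

Definition lebesgue_rV_succ n
    (m : {sigma_finite_measure set 'rV[R]_n -> \bar R}) :
    set 'rV[R]_n.+1 -> \bar R :=
  pushforward ((@lebesgue_measure R) \x m)%E (@rV_cons n).

Section succ.
Variables (n : nat) (m : {sigma_finite_measure set 'rV[R]_n -> \bar R}).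

Let succ0 : lebesgue_rV_succ m set0 = 0%E.
Proof. by rewrite /lebesgue_rV_succ /pushforward preimage_set0 measure0. Qed.

Let succ_ge0 A : (0 <= lebesgue_rV_succ m A)%E.
Proof. by rewrite /lebesgue_rV_succ /pushforward measure_ge0. Qed.

Let succ_sigma_additive : semi_sigma_additive (lebesgue_rV_succ m).
Proof.
move=> F mF tF mUF; rewrite /lebesgue_rV_succ /pushforward preimage_bigcup.
have mcons A : measurable A -> measurable (@rV_cons n @^-1` A).
  by move=> mA; rewrite -[X in measurable X]setTI; exact: measurable_rV_cons.
apply: measure_semi_sigma_additive.
- by move=> k; exact: mcons.
- apply/trivIsetP => /= i j _ _ ij; rewrite -preimage_setI.
  by move/trivIsetP : tF => /(_ _ _ _ _ ij) ->//; rewrite preimage_set0.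
- by rewrite -preimage_bigcup; exact: mcons.
Qed.

HB.instance Definition _ := isMeasure.Build _ _ _ (lebesgue_rV_succ m)
  succ0 succ_ge0 succ_sigma_additive.

Let succ_sigma_finite : sigma_finite setT (lebesgue_rV_succ m).
Proof.
have /sigma_finiteP[F [TF ndF Foo]] := sigma_finiteT (@lebesgue_measure R).
have /sigma_finiteP[G [TG ndG Goo]] := sigma_finiteT m.
exists (fun k => @rV_uncons n @^-1` (F k `*` G k)).
  rewrite -preimage_bigcup -(preimage_setT (@rV_uncons n)); congr (_ @^-1` _).
  apply/esym; rewrite -subTset => -[x v] _.
  have [k _ Fkx] : (\bigcup_k F k) x by rewrite -TF.
  have [l _ Glv] : (\bigcup_k G k) v by rewrite -TG.
  exists (maxn k l) => //; split => /=.
  - by move: x Fkx; exact/subsetPset/ndF/leq_maxl.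
  - by move: v Glv; exact/subsetPset/ndG/leq_maxr.
move=> k; have [mF Fk] := Foo k; have [mG Gk] := Goo k; split.
  rewrite -[X in measurable X]setTI; apply: measurable_rV_uncons => //.
  exact: measurableX.
rewrite /lebesgue_rV_succ /pushforward -comp_preimage.
rewrite (_ : _ \o _ = id); last by apply/funext => z /=; rewrite rV_consK.
by rewrite preimage_id product_measure1E// lte_mul_pinfty// ge0_fin_numE.
Qed.

HB.instance Definition _ := Measure_isSigmaFinite.Build _ _ _
  (lebesgue_rV_succ m) succ_sigma_finite.

End succ.

Fixpoint borel_lebesgue_rV n : {sigma_finite_measure set 'rV[R]_n -> \bar R} :=
  match n with
  | 0 => dirac (0 : 'rV[R]_0)
  | k.+1 => lebesgue_rV_succ (borel_lebesgue_rV k)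
  end.

End borel_lebesgue.

(* R^n equipped with its Lebesgue measurable sets: the Caratheodory measurable
   sets of the outer measure induced by the Borel measure above.  The carrier
   is still ['rV[R]_n]. *)
Definition Rn (R : realType) (n : nat) :=
  caratheodory_type (@borel_lebesgue_rV R n)^*%mu.

HB.instance Definition _ (R : realType) (n : nat) := Measurable.on (Rn R n).

Definition lebesgue_rV (R : realType) (n : nat) : set (Rn R n) -> \bar R :=
  @completed_measure_extension _ _ _ (@borel_lebesgue_rV R n).

HB.instance Definition _ (R : realType) (n : nat) :=
  Measure.on (@lebesgue_rV R n).

Section weights.
Context {R : realType} {n : nat}.
Implicit Types (x y : 'rV[R]_n) (E K Q : set 'rV[R]_n).
Implicit Types (w f : 'rV[R]_n -> \bar R).

Local Notation mu := (@lebesgue_rV R n).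

(* The norm that the library puts on row vectors is the sup norm, hence this
   definition of the Euclidean one. *)
Definition enorm x : R := Num.sqrt (\sum_(i < n) x 0 i ^+ 2).

Definition dist_to x E : R := inf [set enorm (x - y) | y in E].

Definition ediam E : \bar R :=
  ereal_sup [set (enorm (z.1 - z.2))%:E | z in E `*` E].

(* Real powers of elements of [0, +oo].  The library conventions
   [0 `^ r = 0] and [+oo `^ r = +oo] for r < 0 are replaced by
   0^r = +oo and (+oo)^r = 0. *)
Definition epow (t : \bar R) (r : R) : \bar R :=
  if r < 0 then ((t `^ (- r))^-1)%E else (t `^ r)%E.

Definition cubes : set (set 'rV[R]_n) :=
  [set Q | exists a : 'rV[R]_n, exists2 l : R, 0 < l &
     Q = [set x : 'rV[R]_n | forall i, a 0 i <= x 0 i <= a 0 i + l]].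

Definition avg Q f : \bar R := ((mu Q)^-1 * \int[mu]_(x in Q) f x)%E.

Definition weight w :=
  [/\ measurable_fun [set: Rn R n] (w : Rn R n -> \bar R),
      (forall K, compact K -> (\int[mu]_(x in K) `|w x| < +oo)%E) &
      {ae mu, forall x, (0 <= w x)%E}].

(* [lne 0 = -oo] and [expeR +oo = +oo], so a cube on which w vanishes with
   positive measure contributes +oo, unless w = 0 almost everywhere on it. *)
Definition A_infty w :=
  weight w /\
  (ereal_sup [set avg Q w * expeR (- avg Q (fun x => lne (w x)))
             | Q in cubes] < +oo)%E.

Definition I_infty E : set R :=
  [set b | A_infty (fun x => epow (dist_to x E)%:E (- b))].

Definition median_porous E :=
  E !=set0 /\ exists2 b : R, 0 < b & I_infty E b.

(* To be used for 0 < ediam E < +oo. *)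
Definition two_power_weight E (g1 g2 : R) x : \bar R :=
  let t := (dist_to x E / fine (ediam E))%:E in
  if ((dist_to x E)%:E < ediam E)%E then epow t g1 else epow t g2.

(* As [0^-1 = +oo] in [\bar R], the kernel is +oo on the diagonal.  If neither
   the positive nor the negative part of the integrand is integrable at x then
   the value is -oo, so that its absolute value is +oo. *)
Definition fractional_integral (alpha : R) f x : \bar R :=
  (\int[mu]_y (f y / (enorm (x - y) `^ (n%:R - alpha))%:E))%E.

End weights.

(* Main.v *)
Require Import Defs.
From HB Require Import structures.
From mathcomp Require Import all_boot all_order all_algebra.
From mathcomp Require Import all_classical all_reals all_analysis.
From mathcomp Require Import measurable_realfun.
From mathcomp Require Import ring lra.

Set Implicit Arguments.
Unset Strict Implicit.
Unset Printing Implicit Defensive.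

Import Order.TTheory GRing.Theory Num.Theory.
Import numFieldNormedType.Exports.

Local Open Scope classical_set_scope.
Local Open Scope ring_scope.

(** The weights u with exponents gamma and s = (u with exponents delta) to the
    power -p'/p have, almost everywhere, the form e^phi and e^psi, where phi and
    psi are multiples of ln (d(x,E) / diam E), with one factor where d(x,E) is
    smaller than the diameter and another one elsewhere.

    Both are A_infty weights. Indeed e^phi is comparable with the first power of
    the distance on cubes that do not reach far from E and equals the second one
    on cubes that avoid a neighbourhood of E; every other cube is large, and the
    passage from the second power to e^phi changes it only on a fixed bounded
    set ([log_A_infty_glue]).

    The inequalities between the exponents say exactly that
    phi / q + psi / p' <= 0 everywhere. As the mean of an A_infty weight over a
    cube is at most a multiple of its geometric mean, they yield the two-weight
    condition u(Q)^(1/q) s(Q)^(1/p') <= K |Q|^(1 - alpha/n)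
    ([two_weight_condition]).

    Two A_infty weights with this property satisfy the strong type inequality
    because p < q. The Riesz kernel is bounded by a sum over the cubes of 2^n
    shifted triadic grids ([riesz_kernel_le]), so that it suffices to treat the
    sums of side(Q)^alpha A_Q over the cubes Q of one grid that contain x, where
    A_Q is the mean of f over Q. Selecting the cubes at which A_Q more than
    doubles leaves a family in which the selected cubes inside a selected cube
    fill at most half of it; the sum over this family dominates the whole sum,
    as the sides of the cubes containing a point form a geometric progression
    ([principal_selection], [sparse_domination]). By the A_infty condition the
    family is sparse also with respect to u and to s ([log_A_infty_halving]).

    For a sparse family the L^r norm of a sum of indicators is controlled by the
    r-th powers of its coefficients ([carleson_sum_le]). This is used twice:
    with u and r = q it reduces the estimate, through the two-weight condition,
    to the sum of (f(Q) / s(Q))^p s(Q), and with s and r = p' it shows by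
    duality that this sum is at most a multiple of the integral of f^p s^(1-p)
    ([carleson_embedding]). Monotone convergence passes from finite families to all
    cubes. *)

(** * Elementary inequalities *)

Section real_inequalities.
Context {R : realType}.
Implicit Types a b c r s t e : R.

Lemma le_powR2r r a b : 0 <= r -> 0 <= a -> a <= b -> a `^ r <= b `^ r.
Proof.
by move=> r0 a0 ab; apply: ge0_ler_powR => //; rewrite nnegrE// (le_trans a0).
Qed.

Lemma powR_mul_powRB1 r a : 1 < r -> 0 <= a -> a * a `^ (r - 1) = a `^ r.
Proof.
move=> r1 a0; rewrite -{1}(powRr1 a0) -powRD; first by congr powR; ring.
by rewrite addrC subrK gt_eqF// (lt_trans _ r1).
Qed.

Lemma bernoulli_nat (N : nat) t : 0 <= t <= 1 -> 1 - N%:R * t <= (1 - t) ^+ N.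
Proof.
move=> /andP[t0 t1]; elim: N => [|N IH]; first by rewrite mul0r subr0 expr0.
rewrite exprS; apply: (@le_trans _ _ ((1 - t) * (1 - N%:R * t))).
  have : 0 <= N%:R * t * t by rewrite !mulr_ge0// ler0n.
  by rewrite -natr1; nra.
by rewrite ler_wpM2l// subr_ge0.
Qed.

(** The mean value inequality for the r-th power, with a constant that is not
    optimal but comes from Bernoulli's inequality for an integer above r. *)
Lemma powR_increment r : 1 < r -> exists2 N : R, 0 < N &
  forall b c, 0 <= c <= b -> b `^ r - (b - c) `^ r <= N * (c * b `^ (r - 1)).
Proof.
move=> r1; have r0 : 0 <= r by lra.
have rN := archi_boundP r0; set N := Num.Def.archi_bound r in rN.
exists N%:R; first by apply: le_lt_trans rN.
move=> b c /andP[c0 cb]; have [b0|b0] := leP b 0.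
  have -> : b = 0 by lra.
  have -> : c = 0 by lra.
  by rewrite subr0 subrr !mul0r mulr0.
have E1 : b - c = b * (1 - c / b) by field; rewrite gt_eqF.
have t0 : 0 <= c / b by rewrite divr_ge0// ltW.
have t1 : c / b <= 1 by rewrite ler_pdivrMr// mul1r.
have t1' : 0 <= 1 - c / b by rewrite subr_ge0.
have b0' := ltW b0.
rewrite E1 powRM//.
have H : 1 - N%:R * (c / b) <= (1 - c / b) `^ r.
  apply: le_trans (bernoulli_nat N _) _; first by rewrite t0.
  rewrite -powR_mulrn ?subr_ge0//.
  have [->|c1] := eqVneq (c / b) 1.
    have rn0 : r != 0 by rewrite gt_eqF//; lra.
    have Nn0 : (N%:R : R) != 0 by rewrite gt_eqF//; lra.
    by rewrite subrr !powR0.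
  by apply: ger_powR; [apply/andP; split; lra|exact: ltW].
rewrite -(powR_mul_powRB1 r1 (ltW b0)).
set B := b `^ (r - 1).
have B0 : 0 <= B by exact: powR_ge0.
have -> : N%:R * (c * B) = b * B * (N%:R * (c / b)) by field; rewrite gt_eqF.
rewrite -[X in X - _]mulr1 -mulrBr ler_wpM2l//; last lra.
by rewrite mulr_ge0// ltW.
Qed.

(** Young's inequality with an arbitrarily small constant in front of one of
    the powers, in the only form in which absorption arguments use it. *)
Lemma young_absorb r e : 1 < r -> 0 < e -> exists2 C : R, 0 < C &
  forall c b, 0 <= c -> 0 <= b -> c * b `^ (r - 1) <= C * c `^ r + e * b `^ r.
Proof.
move=> r1 e0; exists (e^-1 `^ (r - 1)); first by rewrite powR_gt0 ?invr_gt0.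
move=> c b c0 b0; have [cb|cb] := leP c (e * b).
  apply: (@le_trans _ _ (e * b `^ r)).
    by rewrite -(powR_mul_powRB1 r1 b0) mulrA ler_wpM2r ?powR_ge0.
  by rewrite lerDr mulr_ge0 ?powR_ge0.
apply: (@le_trans _ _ (e^-1 `^ (r - 1) * c `^ r)).
  have ei0 : 0 <= e^-1 by rewrite invr_ge0 ltW.
  rewrite -(powR_mul_powRB1 r1 c0) mulrCA ler_wpM2l// -powRM//.
  apply: le_powR2r => //; first lra.
  by rewrite mulrC ler_pdivlMr// mulrC ltW.
by rewrite lerDl mulr_ge0 ?powR_ge0// ltW.
Qed.

End real_inequalities.

(** * Sums over sparse laminar families *)

Section laminar_families.
Context d (T : measurableType d) (R : realType) (mu : {measure set T -> \bar R}).

(** The sets of a laminar family are nested or disjoint; here they are moreover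
    listed in such a way that no set precedes one that contains it. *)
Definition laminar (m : nat) (Q : nat -> set T) := forall i j, (i < j < m)%N ->
  Q j `<=` Q i \/ Q i `&` Q j = set0.

Definition later (m : nat) (Q : nat -> set T) (i : nat) : set T :=
  \bigcup_(j in [set j | (i < j < m)%N]) Q j.

Lemma measurable_later m Q i : (forall j, measurable (Q j)) ->
  measurable (later m Q i).
Proof. by move=> mQ; apply: bigcup_measurable => j _. Qed.

Lemma measurable_sum_indic m (a : nat -> R) (A : nat -> set T) :
  (forall i, measurable (A i)) ->
  measurable_fun [set: T] (fun x => \sum_(i < m) a i * \1_(A i) x).
Proof.
move=> mA; apply: measurable_sum => i; exact: measurable_funM.
Qed.

Lemma sum_indic_ge0 m (a : nat -> R) (A : nat -> set T) x :
  (forall i, 0 <= a i) -> 0 <= \sum_(i < m) a i * \1_(A i) x.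
Proof. by move=> a0; apply: sumr_ge0 => i _; rewrite mulr_ge0// indicE ler0n. Qed.

Lemma integral_sum_indic m (a : nat -> R) (A : nat -> set T) (w : T -> \bar R) :
  (forall i, 0 <= a i) -> (forall i, measurable (A i)) ->
  measurable_fun [set: T] w -> (forall x, (0 <= w x)%E) ->
  (\int[mu]_x ((\sum_(i < m) a i * \1_(A i) x)%:E * w x) =
   \sum_(i < m) (a i)%:E * \int[mu]_(x in A i) w x)%E.
Proof.
move=> a0 mA mw w0.
transitivity (\int[mu]_x (\sum_(i < m) ((a i)%:E * (w \_ (A i)) x)))%E.
  apply: eq_integral => x _; rewrite -sumEFin ge0_sume_distrl; last first.
    by move=> i _; rewrite lee_fin mulr_ge0// indicE ler0n.
  apply: eq_bigr => i _; rewrite EFinM -muleA; congr *%E.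
  by rewrite patchE indicE; case: ifP => _; rewrite ?mul1e ?mul0e.
have mp i : measurable_fun [set: T] (w \_ (A i)).
  apply/(measurable_restrictT _ (mA i)).
  exact: measurable_funS mw.
have p0 i x : (0 <= (w \_ (A i)) x)%E by rewrite patchE; case: ifP.
rewrite ge0_integral_sum//.
- apply: eq_bigr => i _; rewrite ge0_integralZl_EFin//.
  by rewrite [in RHS]integral_mkcond.
- by move=> i; apply: measurable_funeM.
- by move=> i x _; rewrite mule_ge0// lee_fin.
Qed.

End laminar_families.

Section carleson.
Context d (T : measurableType d) (R : realType) (mu : {measure set T -> \bar R}).

Lemma sum_indic_disjoint_le m (a : nat -> R) (A : nat -> set T) (M : R) x :
  (forall i j, (i < j < m)%N -> A i x -> ~ A j x) ->
  0 <= M -> (forall i, (i < m)%N -> A i x -> a i <= M) ->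
  \sum_(i < m) a i * \1_(A i) x <= M.
Proof.
move=> dA M0 aM.
have [[i Aix]|nA] := pselect (exists i : 'I_m, A i x); last first.
  rewrite big1// => i _; rewrite indicE memNset ?mulr0// => Aix.
  by apply: nA; exists i.
rewrite (bigD1 i)//= big1 ?addr0; last first.
  move=> j ji; rewrite indicE memNset ?mulr0// => Ajx.
  have [ij|ij|/val_inj ij] := ltngtP i j.
  - by apply: (dA i j); rewrite // ij/=.
  - by apply: (dA j i); rewrite // ij/=.
  - by rewrite ij eqxx in ji.
by rewrite indicE mem_set// mulr1; exact: aM.
Qed.

(** The partial sums of a laminar family, taken in an order in which large sets
    come first, are constant on the last set that entered the sum. *)
Lemma laminar_partial_sum m (Q : nat -> set T) (c : nat -> R) i x :
  laminar m Q -> (i < m)%N -> Q i x ->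
  \sum_(j < i.+1) c j * \1_(Q j) x =
  \sum_(j < i.+1) c j * (`[< Q i `<=` Q j >])%:R.
Proof.
move=> lam im Qix; apply: eq_bigr => j _; congr (_ * _); rewrite indicE.
congr (_%:R); congr nat_of_bool.
have [ji|ij] := ltnP j i; last first.
  have <- : i = j by apply/eqP; rewrite eqn_leq ij -ltnS ltn_ord.
  by rewrite mem_set//; apply/esym/asboolP.
have [|sub|dis] := lam j i; first by rewrite ji.
  by rewrite mem_set; [apply/esym/asboolP|exact: sub].
rewrite memNset; last by move=> Qjx; rewrite -[False]/(set0 x) -dis.
apply/esym/asboolP => sub; rewrite -[False]/(set0 x) -dis; split => //.
exact: sub.
Qed.

(** For a sparse laminar family the r-th power of a sum of indicators has the
    same integral as the sum of the r-th powers.  Telescoping the power along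
    the family produces the terms c_i b_i^(r-1) w(Q_i), where b_i is the value
    on Q_i of the partial sum; Young's inequality turns them into c_i^r w(Q_i)
    and a small multiple of b_i^r w(Q_i), and by sparseness the latter are
    controlled by the integral over disjoint sets of the power itself. *)
Lemma carleson_sum_le (r eta : R) : 1 < r -> 0 < eta -> exists2 C : R, 0 < C &
  forall (m : nat) (Q : nat -> set T) (c : nat -> R) (w : T -> \bar R),
  (forall i, measurable (Q i)) -> laminar m Q -> (forall i, 0 <= c i) ->
  measurable_fun [set: T] w -> (forall x, 0 <= w x)%E ->
  (forall i, (i < m)%N -> (\int[mu]_(x in Q i) w x < +oo)%E) ->
  (forall i, (i < m)%N -> (eta%:E * \int[mu]_(x in Q i) w x <=
                           \int[mu]_(x in Q i `\` later m Q i) w x)%E) ->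
  (\int[mu]_x (((\sum_(i < m) c i * \1_(Q i) x) `^ r)%:E * w x) <=
   C%:E * \sum_(i < m) (c i `^ r)%:E * \int[mu]_(x in Q i) w x)%E.
Proof.
move=> r1 eta0; have [N N0 incr] := @powR_increment R r r1.
have eN0 : 0 < eta / (2 * N) by rewrite divr_gt0// mulr_gt0.
have [C0 C00 young] := @young_absorb R r (eta / (2 * N)) r1 eN0.
exists (2 * (N * C0)); first by rewrite !mulr_gt0.
move=> m Q c w mQ lam c0 mw w0 Woo sparse.
pose b i := \sum_(j < i.+1) c j * (`[< Q i `<=` Q j >])%:R.
pose B k x := \sum_(i < k) c i * \1_(Q i) x.
have b0 i : 0 <= b i by apply: sumr_ge0 => j _; rewrite mulr_ge0.
have B0 k x : 0 <= B k x by exact: sum_indic_ge0.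
pose E i := Q i `\` later m Q i.
have mE i : measurable (E i) by apply: measurableD => //; exact: measurable_later.
(* On Q_i the partial sum that ends with i is constant, equal to b_i, so the
   increments of its r-th power are controlled by c_i b_i^(r-1). *)
have tele k x : (k <= m)%N ->
    B k x `^ r <= \sum_(i < k) (N * (c i * b i `^ (r - 1))) * \1_(Q i) x.
  elim: k => [_|k IH km]; first by rewrite /B !big_ord0 powR0// gt_eqF//; lra.
  have step : B k.+1 x `^ r - B k x `^ r <= N * (c k * b k `^ (r - 1)) * \1_(Q k) x.
    have BE : B k.+1 x = B k x + c k * \1_(Q k) x by rewrite /B big_ord_recr.
    have [Qkx|nQkx] := pselect (Q k x); last first.
      by rewrite BE indicE memNset// !mulr0 addr0 subrr.
    have bE : B k.+1 x = b k by rewrite /B (laminar_partial_sum _ lam km).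
    have BkE : B k x = b k - c k by rewrite -bE BE indicE mem_set// mulr1 addrK.
    rewrite indicE mem_set// mulr1 bE BkE; apply: incr.
    by rewrite c0/= -subr_ge0 -BkE.
  by rewrite big_ord_recr/= -[B k.+1 x `^ r](subrK (B k x `^ r)) addrC lerD// IH// ltnW.
have H1 : (\int[mu]_x ((B m x `^ r)%:E * w x) <=
    \sum_(i < m) (N * (c i * b i `^ (r - 1)))%:E * \int[mu]_(x in Q i) w x)%E.
  have a0 i : 0 <= N * (c i * b i `^ (r - 1)).
    by rewrite !mulr_ge0// ?powR_ge0// ltW.
  rewrite -(integral_sum_indic mu m a0)//; apply: ge0_le_integral => //.
  - by move=> x _; rewrite mule_ge0// lee_fin powR_ge0.
  - apply: emeasurable_funM => //; apply/measurable_EFinP.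
    apply: (measurableT_comp (measurable_powR _)).
    exact: measurable_sum_indic.
  - apply: emeasurable_funM => //; apply/measurable_EFinP.
    exact: (@measurable_sum_indic _ _ _ m (fun i => N * (c i * b i `^ (r - 1)))).
  - by move=> x _; rewrite lee_wpmul2r// lee_fin; exact: tele.
(* The sets E_i are disjoint and the whole sum is at least b_i on E_i. *)
have H2 : (\sum_(i < m) (b i `^ r)%:E * \int[mu]_(x in E i) w x <=
    \int[mu]_x ((B m x `^ r)%:E * w x))%E.
  have a0 i : 0 <= b i `^ r by rewrite powR_ge0.
  rewrite -(integral_sum_indic mu m a0)//; apply: ge0_le_integral => //.
  - move=> x _; rewrite mule_ge0// lee_fin.
    exact: (@sum_indic_ge0 _ _ _ m (fun i => b i `^ r)).
  - apply: emeasurable_funM => //; apply/measurable_EFinP.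
    exact: (@measurable_sum_indic _ _ _ m (fun i => b i `^ r)).
  - apply: emeasurable_funM => //; apply/measurable_EFinP.
    apply: (measurableT_comp (measurable_powR _)).
    exact: measurable_sum_indic.
  - move=> x _; rewrite lee_wpmul2r// lee_fin.
    apply: (@sum_indic_disjoint_le m (fun i => b i `^ r)); rewrite ?powR_ge0//.
      by move=> i j ijm [_ +] [Qj _]; apply; exists j.
    move=> i im [Qix _]; apply: le_powR2r => //; first lra.
    rewrite /b -(laminar_partial_sum _ lam im Qix).
    rewrite /B -(subnKC im) big_split_ord/= lerDl.
    by apply: sumr_ge0 => j _; rewrite mulr_ge0.
pose W i := fine (\int[mu]_(x in Q i) w x).
have W0 i : (0 <= \int[mu]_(x in Q i) w x)%E by exact: integral_ge0.
have WE i : (i < m)%N -> (\int[mu]_(x in Q i) w x = (W i)%:E)%E.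
  by move=> im; rewrite fineK// ge0_fin_numE// Woo.
have W0' i : 0 <= W i by rewrite fine_ge0.
have sumW (a : nat -> R) : (\sum_(i < m) (a i)%:E * \int[mu]_(x in Q i) w x =
    (\sum_(i < m) a i * W i)%:E)%E.
  rewrite -sumEFin; apply: eq_bigr => i _.
  by rewrite WE.
rewrite (sumW (fun i => c i `^ r)).
rewrite (sumW (fun i => N * (c i * b i `^ (r - 1)))) in H1.
set I := (\int[mu]_x _)%E in H1 H2 *.
have I0 : (0 <= I)%E.
  by apply: integral_ge0 => x _; rewrite mule_ge0// lee_fin powR_ge0.
have Ifin : I \is a fin_num by rewrite ge0_fin_numE// (le_lt_trans H1)// ltry.
have H3 : ((\sum_(i < m) b i `^ r * (eta * W i))%:E <= I)%E.
  apply: le_trans H2; rewrite -sumEFin; apply: lee_sum => i _.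
  by rewrite EFinM lee_wpmul2l// ?lee_fin ?powR_ge0// EFinM -WE// sparse.
move: H1 H3; rewrite -(fineK Ifin) -EFinM !lee_fin => H1 H3.
set I' := fine I in H1 H3 *.
have H4 : \sum_(i < m) N * (c i * b i `^ (r - 1)) * W i <=
    N * C0 * (\sum_(i < m) c i `^ r * W i) +
    2^-1 * (\sum_(i < m) b i `^ r * (eta * W i)).
  rewrite !mulr_sumr -big_split/=; apply: ler_sum => i _.
  apply: (@le_trans _ _ (N * (C0 * c i `^ r + eta / (2 * N) * b i `^ r) * W i)).
    by rewrite ler_wpM2r// ler_wpM2l ?(ltW N0)// young.
  rewrite le_eqVlt; apply/orP; left; apply/eqP; field; rewrite gt_eqF//.
lra.
Qed.

End carleson.

Section stopping.
Context d (T : measurableType d) (R : realType) (mu : {measure set T -> \bar R}).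

(** Deciding from the large sets to the small ones, a set is selected when its
    number is more than twice the number of each selected set that contains it. A
    set that is not selected thus has a selected ancestor which dominates it. *)
Lemma principal_selection (m : nat) (Q : nat -> set T) (A : nat -> R) :
  exists b : nat -> bool,
  [/\ forall i, b i -> (i < m)%N,
      forall i j, (i < j)%N -> b i -> b j -> Q j `<=` Q i -> 2 * A i < A j &
      forall j, (j < m)%N -> 0 < A j ->
        exists i, [/\ (i <= j)%N, b i, Q j `<=` Q i & A j <= 2 * A i]].
Proof.
elim: m => [|m [b [bm bsp bdom]]]; first by exists xpred0; split.
have [[i [bi Qmi Ami]]|nA] :=
    pselect (exists i, [/\ b i, Q m `<=` Q i & A m <= 2 * A i]).
  exists b; split => //; first by move=> k /bm /ltnW.
  move=> j; rewrite ltnS leq_eqVlt => /orP[/eqP -> _|]; last exact: bdom.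
  by exists i; split => //; exact/ltnW/bm.
exists (fun j => (j == m) || b j); split.
- by move=> j /orP[/eqP -> //|/bm]; rewrite ltnS => /ltnW.
- move=> i j ij /orP[/eqP im|bi] /orP[/eqP jm|bj].
  + by rewrite im jm ltnn in ij.
  + by move/bm: bj; rewrite -im ltnNge (ltnW ij).
  + by rewrite jm => sub; rewrite ltNge; apply/negP => ?; apply: nA; exists i.
  + exact: bsp.
- move=> j; rewrite ltnS leq_eqVlt => /orP[/eqP -> Am0|jm Aj0].
    exists m; split => //; first by rewrite eqxx.
    by lra.
  have [i [ij bi QA Aji]] := bdom _ jm Aj0.
  by exists i; split => //; rewrite bi orbT.
Qed.

(** If all the averages over the sets nested in P exceed twice the average over
    P, then these sets fill at most half of P; laminarity makes the union of
    the nested sets a disjoint one after discarding repetitions. *)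
Lemma stopping_half (m : nat) (Q : nat -> set T) (f : T -> \bar R)
    (P : set T) (a : R) :
  (forall i, measurable (Q i)) -> laminar m Q ->
  (forall i, (i < m)%N -> Q i `<=` P) -> measurable P ->
  measurable_fun [set: T] f -> (forall x, 0 <= f x)%E ->
  (forall i, (i < m)%N -> (a%:E * mu (Q i) <= \int[mu]_(x in Q i) f x)%E) ->
  0 <= a -> (a%:E * mu (\big[setU/set0]_(i < m) Q i) <= \int[mu]_(x in P) f x)%E.
Proof.
move=> mQ lam QP mP mf f0 aQ a0.
have mU k : measurable (\big[setU/set0]_(i < k) Q i) by exact: bigsetU_measurable.
have fS A : measurable A -> measurable_fun A f by move=> mA; exact: measurable_funS mf.
suff H k : (k <= m)%N -> (a%:E * mu (\big[setU/set0]_(i < k) Q i) <=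
    \int[mu]_(x in \big[setU/set0]_(i < k) Q i) f x)%E.
  apply: le_trans (H m (leqnn m)) _.
  apply: ge0_subset_integral => //; first exact: fS.
  by rewrite -bigcup_mkord => x [i im]; exact: QP.
elim: k => [_|k IH km]; first by rewrite !big_ord0 measure0 mule0 integral_set0.
rewrite big_ord_recr/=.
have [[j jk Qkj]|nsub] := pselect (exists2 j, (j < k)%N & Q k `<=` Q j).
  rewrite setUidl; first by rewrite IH// ltnW.
  by move=> x /Qkj Qjx; rewrite -bigcup_mkord; exists j.
have dis : \big[setU/set0]_(i < k) Q i `&` Q k = set0.
  rewrite -bigcup_mkord setI_bigcupl bigcup0// => j /= jk.
  have [|sub|//] := lam j k; first by rewrite jk.
  by exfalso; apply: nsub; exists j.
rewrite (measureU _ (mU k) (mQ k) dis) (ge0_integral_setU _ (mU k) (mQ k))//.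
- rewrite ge0_muleDr// leeD//; last exact: aQ.
  by rewrite IH// ltnW.
- by apply: fS; exact: measurableU.
- by rewrite disj_set2E dis.
Qed.

End stopping.

Section powers_and_young.
Context {R : realType}.
Implicit Types a b c r s t e : R.

(** The place where p < q enters: an l^p sum controls the l^q sum. *)
Lemma sum_powR_le m (a : nat -> R) t : 1 < t -> (forall i, 0 <= a i) ->
  \sum_(i < m) a i `^ t <= (\sum_(i < m) a i) `^ t.
Proof.
move=> t1 a0; set S := \sum_(i < m) a i.
have S0 : 0 <= S by exact: sumr_ge0.
rewrite -(powR_mul_powRB1 t1 S0) mulr_suml; apply: ler_sum => i _.
rewrite -(powR_mul_powRB1 t1 (a0 i)) ler_wpM2l//; apply: le_powR2r => //.
  by lra.
by rewrite /S (bigD1 i)//= lerDl sumr_ge0.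
Qed.

(** Young's inequality for f s^(-1/p') and b s^(1/p'), where p' = p / (p - 1). *)
Lemma young_weighted p e : 1 < p -> 0 < e -> exists2 C : R, 0 < C &
  forall f b s, 0 <= f -> 0 <= b -> 0 < s ->
    f * b <= C * (f `^ p * s `^ (1 - p)) + e * (b `^ (p / (p - 1)) * s).
Proof.
move=> p1 e0; have [C C0 H] := young_absorb p1 e0; exists C => //.
move=> f b s f0 b0 s0; have pn0 : p != 0 by rewrite gt_eqF//; lra.
have p1n0 : p - 1 != 0 by rewrite gt_eqF//; lra.
have s0' := ltW s0.
have := H (f * s `^ (p^-1 - 1)) ((b * s `^ (1 - p^-1)) `^ (p - 1)^-1).
rewrite mulr_ge0 ?powR_ge0// => /(_ isT isT).
rewrite -!powRrM mulVf// powRr1; last by rewrite mulr_ge0// powR_ge0.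
rewrite !powRM ?powR_ge0// -!powRrM.
have -> : (p^-1 - 1) * p = 1 - p by field.
have -> : (p - 1)^-1 * p = p / (p - 1) by rewrite mulrC.
have -> : (1 - p^-1) * (p / (p - 1)) = 1 by field; rewrite pn0 p1n0.
rewrite powRr1// => {}H; apply: le_trans H.
rewrite le_eqVlt; apply/orP; left; apply/eqP.
rewrite mulrACA -powRD; last by rewrite (gt_eqF s0) implybT.
by rewrite addrC subrKA subrr powRr0 mulr1.
Qed.

End powers_and_young.

Lemma le_poweR2r (R : realType) (a b : \bar R) (r : R) : 0 <= r -> (0 <= a)%E -> (a <= b)%E ->
  (a `^ r <= b `^ r)%E.
Proof.
by move=> r0 a0 ab; apply: gt0_ler_poweR => //; rewrite in_itv/= leey ?andbT// (le_trans a0).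
Qed.

Section embedding.
Context d (T : measurableType d) (R : realType) (mu : {measure set T -> \bar R}).

Lemma young_weightede p e : 1 < p -> 0 < e -> exists2 C : R, 0 < C &
  forall (f : \bar R) b s, (0 <= f)%E -> 0 <= b -> 0 < s ->
    (b%:E * f <= C%:E * (f `^ p * (s `^ (1 - p))%:E)
                 + e%:E * ((b `^ (p / (p - 1)))%:E * s%:E))%E.
Proof.
move=> p1 e0; have [C C0 H] := young_weighted p1 e0; exists C => //.
move=> [f| |]// b s f0 b0 s0.
  by rewrite poweR_EFin -!EFinM -EFinD lee_fin mulrC H.
have pn0 : p != 0 by rewrite gt_eqF//; lra.
rewrite poweRyr// gt0_mulye ?lte_fin ?powR_gt0// (@gt0_muley _ C%:E) ?lte_fin//.
rewrite addye ?leey//; rewrite -!EFinM; exact: ltNyr.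
Qed.

(** By Young's inequality with b = 1, f is at most a multiple of f^p s^(1-p)
    plus s. *)
Lemma weighted_integral_lty (p : R) (Q : set T) (s : T -> R) (f : T -> \bar R) :
  1 < p -> measurable Q -> measurable_fun [set: T] s -> (forall x, 0 < s x) ->
  (\int[mu]_(x in Q) (s x)%:E < +oo)%E ->
  measurable_fun [set: T] f -> (forall x, 0 <= f x)%E ->
  (\int[mu]_x (f x `^ p * (s x `^ (1 - p))%:E) < +oo)%E ->
  (\int[mu]_(x in Q) f x < +oo)%E.
Proof.
move=> p1 mQ ms s0 soo mf f0; have [C C0 young] := young_weightede p1 ltr01.
set F := (\int[mu]_x (f x `^ p * (s x `^ (1 - p))%:E))%E => Foo.
have msE : measurable_fun [set: T] (EFin \o s) by exact/measurable_EFinP.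
have m1 : measurable_fun [set: T] (fun x => f x `^ p * (s x `^ (1 - p))%:E)%E.
  apply: emeasurable_funM; first exact: (measurableT_comp (measurable_poweR _)).
  by apply/measurable_EFinP; exact: (measurableT_comp (measurable_powR _)).
have p10 x : (0 <= f x `^ p * (s x `^ (1 - p))%:E)%E.
  by rewrite mule_ge0// ?lee_fin ?poweR_ge0 ?powR_ge0.
apply: (@le_lt_trans _ _ (C%:E * F + \int[mu]_(x in Q) (s x)%:E)%E); last first.
  by rewrite lte_add_pinfty// lte_mul_pinfty// ?lee_fin ?(ltW C0)//.
apply: (@le_trans _ _ (\int[mu]_(x in Q) (C%:E * (f x `^ p * (s x `^ (1 - p))%:E) + (s x)%:E))%E).
  apply: ge0_le_integral => //.
  - exact: measurable_funS mf.
  - apply: measurable_funTS; apply: emeasurable_funD => //; exact: measurable_funeM.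
  - move=> x _; have := young (f x) 1 (s x) (f0 x) ler01 (s0 x).
    by rewrite mul1e powR1 !mul1e.
rewrite ge0_integralD//; last 4 first.
- by move=> x _; rewrite mule_ge0// lee_fin ltW.
- by apply: measurable_funTS; exact: measurable_funeM.
- by move=> x _; rewrite lee_fin ltW.
- exact: measurable_funTS.
rewrite leeD2r// ge0_integralZl_EFin//; last 2 first.
- exact: measurable_funTS.
- exact: ltW.
by rewrite lee_wpmul2l// ?lee_fin ?(ltW C0)//; exact: ge0_subset_integral.
Qed.

(** The dual use of the bound for sums of indicators: the averages with
    respect to a weight s over an s-sparse family satisfy a Carleson embedding.
    The sum to be bounded is the integral of f against a sum of indicators with
    coefficients c_i, whose conjugate power integrates to at most a multiple of
    the same sum, so that Young's inequality allows to absorb it. *)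
Lemma carleson_embedding (p eta : R) : 1 < p -> 0 < eta -> exists2 C : R, 0 < C &
  forall (m : nat) (Q : nat -> set T) (s : T -> R) (f : T -> \bar R),
  (forall i, measurable (Q i)) -> laminar m Q ->
  measurable_fun [set: T] s -> (forall x, 0 < s x) ->
  (forall i, (i < m)%N -> (\int[mu]_(x in Q i) (s x)%:E < +oo)%E) ->
  (forall i, (i < m)%N -> (eta%:E * \int[mu]_(x in Q i) (s x)%:E <=
                           \int[mu]_(x in Q i `\` later m Q i) (s x)%:E)%E) ->
  measurable_fun [set: T] f -> (forall x, 0 <= f x)%E ->
  (forall i, (i < m)%N -> (\int[mu]_(x in Q i) f x < +oo)%E) ->
  ((\sum_(i < m) (fine (\int[mu]_(x in Q i) f x) / fine (\int[mu]_(x in Q i) (s x)%:E))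
       `^ (p - 1) * fine (\int[mu]_(x in Q i) f x))%:E <=
   C%:E * \int[mu]_x (f x `^ p * (s x `^ (1 - p))%:E))%E.
Proof.
move=> p1 eta0; have q1 : 1 < p / (p - 1) by rewrite ltr_pdivlMr; lra.
have [CL CL0 carl] := carleson_sum_le mu q1 eta0.
have e0 : 0 < (2 * CL)^-1 by rewrite invr_gt0 mulr_gt0.
have [C C0 young] := young_weightede p1 e0.
exists (2 * C); first by rewrite mulr_gt0.
move=> m Q s f mQ lam ms s0 soo sparse mf f0 foo.
pose fi i := fine (\int[mu]_(x in Q i) f x).
pose si i := fine (\int[mu]_(x in Q i) (s x)%:E).
pose c i := (fi i / si i) `^ (p - 1).
rewrite -/(\sum_(i < m) c i * fi i).
have fi0 i : 0 <= fi i by rewrite fine_ge0// integral_ge0.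
have si0 i : 0 <= si i by rewrite fine_ge0// integral_ge0// => x _; rewrite lee_fin ltW.
have c0 i : 0 <= c i by exact: powR_ge0.
set X := \sum_(i < m) _; set F := (\int[mu]_x (_ * _))%E.
have F0 : (0 <= F)%E.
  by apply: integral_ge0 => x _; rewrite mule_ge0// ?lee_fin ?poweR_ge0 ?powR_ge0.
have msE : measurable_fun [set: T] (EFin \o s) by exact/measurable_EFinP.
pose B x := \sum_(i < m) c i * \1_(Q i) x.
have B0 x : 0 <= B x by exact: sum_indic_ge0.
have mB : measurable_fun [set: T] B by exact: measurable_sum_indic.
have XE : X%:E = (\int[mu]_x ((B x)%:E * f x))%E.
  rewrite integral_sum_indic// /X -sumEFin; apply: eq_bigr => i _.
  by rewrite EFinM fineK// ge0_fin_numE ?foo// integral_ge0.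
have H1 : (\int[mu]_x ((B x)%:E * f x) <= C%:E * F + ((2 * CL)^-1)%:E *
    \int[mu]_x ((B x `^ (p / (p - 1)))%:E * (s x)%:E))%E.
  have m1 : measurable_fun [set: T] (fun x => f x `^ p * (s x `^ (1 - p))%:E)%E.
    apply: emeasurable_funM; first exact: (measurableT_comp (measurable_poweR _)).
    by apply/measurable_EFinP; exact: (measurableT_comp (measurable_powR _)).
  have m2 : measurable_fun [set: T] (fun x => (B x `^ (p / (p - 1)))%:E * (s x)%:E)%E.
    apply: emeasurable_funM; last exact/measurable_EFinP.
    by apply/measurable_EFinP; exact: (measurableT_comp (measurable_powR _)).
  have p10 x : (0 <= f x `^ p * (s x `^ (1 - p))%:E)%E.
    by rewrite mule_ge0// ?lee_fin ?poweR_ge0 ?powR_ge0.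
  have p20 x : (0 <= (B x `^ (p / (p - 1)))%:E * (s x)%:E)%E.
    by rewrite -EFinM lee_fin mulr_ge0 ?powR_ge0// ltW.
  rewrite -(ge0_integralZl_EFin mu _ _ m1 (ltW C0))//.
  rewrite -(ge0_integralZl_EFin mu _ _ m2 (ltW e0))//.
  rewrite -ge0_integralD//; last 4 first.
  - by move=> x _; rewrite mule_ge0// lee_fin ltW.
  - exact: measurable_funeM.
  - by move=> x _; rewrite mule_ge0// lee_fin ltW.
  - exact: measurable_funeM.
  apply: ge0_le_integral => //.
  - by move=> x _; rewrite mule_ge0// lee_fin.
  - by apply: emeasurable_funM => //; exact/measurable_EFinP.
  - by apply: emeasurable_funD; exact: measurable_funeM.
  - by move=> x _; exact: young.
have H2 : (\int[mu]_x ((B x `^ (p / (p - 1)))%:E * (s x)%:E) <= CL%:E * X%:E)%E.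
  apply: le_trans (carl m Q c (EFin \o s) mQ lam c0 msE _ soo sparse) _.
    by move=> x; rewrite lee_fin ltW.
  rewrite lee_wpmul2l// ?lee_fin ?(ltW CL0)// /X -sumEFin.
  apply: lee_sum => i _; have := si0 i.
  rewrite -[(\int[mu]_(x in Q i) _)%E]fineK; last first.
    rewrite ge0_fin_numE ?soo// integral_ge0// => x _; rewrite lee_fin ltW//.
  rewrite -/(si i) -EFinM lee_fin /c -powRrM le_eqVlt => /orP[/eqP <-|sp].
    by rewrite mulr0 mulr_ge0// powR_ge0.
  have -> : (p - 1) * (p / (p - 1)) = p by field; rewrite gt_eqF//; lra.
  rewrite -(powR_mul_powRB1 p1) ?divr_ge0//.
  rewrite le_eqVlt; apply/orP; left; apply/eqP; field.
  by rewrite gt_eqF.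
have : (X%:E <= C%:E * F + (2^-1 * X)%:E)%E.
  rewrite XE; apply: le_trans H1 _; rewrite leeD2l//.
  apply: (@le_trans _ _ (((2 * CL)^-1)%:E * (CL%:E * X%:E))%E).
    by rewrite lee_wpmul2l// lee_fin ltW.
  rewrite -!EFinM lee_fin le_eqVlt; apply/orP; left; apply/eqP; field.
  by rewrite gt_eqF.
case: (F) F0 => [F'| |]// F0; last by rewrite !gt0_muley ?lte_fin ?leey ?mulr_gt0.
by rewrite -!EFinM -EFinD !lee_fin; lra.
Qed.

End embedding.

(** * The fractional operator of a finite laminar family *)

Section discrete_fractional.
Context d (T : measurableType d) (R : realType) (mu : {measure set T -> \bar R}).

(** The form of the A_infty condition that transfers sparseness from the
    underlying measure to a weight. *)
Definition halving (eta : R) (Q : set T) (w : T -> R) := forall B : set T,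
  measurable B -> B `<=` Q -> (mu Q <= 2%:E * mu B)%E ->
  (eta%:E * \int[mu]_(x in Q) (w x)%:E <= \int[mu]_(x in B) (w x)%:E)%E.

(** The selected sets inside Q_i have means more than twice the mean over Q_i, so
    they fill at most half of Q_i, and the remaining part fills at least half. *)
Lemma sparse_of_selection m (Q : nat -> set T) (f : T -> \bar R) (b : nat -> bool) i :
  (forall i, measurable (Q i)) -> laminar m Q ->
  (forall i, (i < m)%N -> (0 < mu (Q i) < +oo)%E) ->
  measurable_fun [set: T] f -> (forall x, 0 <= f x)%E ->
  (forall i, (i < m)%N -> (\int[mu]_(x in Q i) f x < +oo)%E) ->
  let A i := fine (\int[mu]_(x in Q i) f x) / fine (mu (Q i)) in
  (forall i j, (i < j)%N -> b i -> b j -> Q j `<=` Q i -> 2 * A i < A j) ->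
  let Q' i := if b i then Q i else set0 in
  (i < m)%N -> b i ->
  (mu (Q i) <= 2%:E * mu (Q' i `\` later m Q' i))%E.
Proof.
move=> mQ lam Qfin mf f0 foo A bsp Q' im bi.
have A0 j : 0 <= A j by rewrite divr_ge0// fine_ge0// integral_ge0.
pose Q2 j := if [&& (i < j)%N & b j] then Q j `&` Q i else set0.
have mQ2 j : measurable (Q2 j) by rewrite /Q2; case: ifP => // _; exact: measurableI.
have Q2E j : (j < m)%N -> Q2 j !=set0 -> Q2 j = Q j /\ [/\ Q j `<=` Q i, (i < j)%N & b j].
  move=> jm; rewrite /Q2; case: ifP => [/andP[ij bj]|_ [x []]//] [x [Qjx Qix]].
  have [|sub|dis] := lam i j; first by rewrite ij.
    by rewrite (setIidl sub).
  by exfalso; rewrite -[False]/(set0 x) -dis.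
have lam2 : laminar m Q2.
  move=> j k /andP[jk km].
  have [nz|z] := pselect (Q2 k !=set0); last first.
    by left => x Q2x; exfalso; apply: z; exists x.
  have [nz'|z'] := pselect (Q2 j !=set0); last first.
    by right; apply/nonemptyPn => -[x [Q2x _]]; apply: z'; exists x.
  have [-> _] := Q2E _ km nz; have [-> _] := Q2E _ (ltn_trans jk km) nz'.
  by apply: lam; rewrite jk.
have fin j : (j < m)%N -> mu (Q j) \is a fin_num.
  by move=> jm; have /andP[_ ?] := Qfin j jm; rewrite ge0_fin_numE.
have pos j : (j < m)%N -> 0 < fine (mu (Q j)).
  by move=> jm; apply: fine_gt0; exact: Qfin.
have ffin j : (j < m)%N -> (\int[mu]_(x in Q j) f x)%E \is a fin_num.
  by move=> jm; rewrite ge0_fin_numE ?foo// integral_ge0.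
set U := \big[setU/set0]_(j < m) Q2 j.
have mU : measurable U by exact: bigsetU_measurable.
have UQ : U `<=` Q i.
  by rewrite /U -bigcup_mkord => x [j _]; rewrite /Q2; case: ifP => // _ [].
have half : (2%:E * mu U <= mu (Q i))%E.
  have [Ai0|Ai0] := leP (A i) 0.
    have Ai : A i = 0 by apply/eqP; rewrite eq_le Ai0 A0.
    suff -> : U = set0 by rewrite measure0 mule0.
    rewrite /U -bigcup_mkord bigcup0// => j /= jm.
    apply/nonemptyPn => nz; have [_ [sub ij bj]] := Q2E _ jm nz.
    have := bsp _ _ ij bi bj sub; rewrite Ai mulr0 /A.
    rewrite pmulr_lgt0 ?invr_gt0 ?pos// => /gt_eqF/negbT/eqP; apply.
    have : (\int[mu]_(x in Q j) f x <= \int[mu]_(x in Q i) f x)%E.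
      by apply: ge0_subset_integral => //; exact: measurable_funS mf.
    rewrite -(fineK (ffin _ jm)) -(fineK (ffin _ im)) lee_fin => H.
    rewrite /=; apply/eqP; rewrite eq_le; apply/andP.
    split; last by apply/fine_ge0/integral_ge0.
    apply: le_trans H _; by move: Ai0; rewrite /A pmulr_lle0// invr_gt0 pos.
  have := @stopping_half _ _ _ mu m Q2 f (Q i) (2 * A i) mQ2 lam2.
  move=> /(_ _ (mQ i) mf f0)H.
  have {H} : ((2 * A i)%:E * mu U <= \int[mu]_(x in Q i) f x)%E.
    apply: H; last by rewrite mulr_ge0.
      by move=> j _; rewrite /Q2; case: ifP => // _ x [].
    move=> j jm; have [nz|z] := pselect (Q2 j !=set0); last first.
      have -> : Q2 j = set0 by apply/nonemptyPn.
      by rewrite measure0 mule0 integral_set0.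
    have [-> [sub ij bj]] := Q2E _ jm nz.
    rewrite -(fineK (ffin _ jm)) -(fineK (fin _ jm)) -EFinM lee_fin.
    by rewrite -ler_pdivlMr ?pos//; exact/ltW/(bsp _ _ ij bi bj sub).
  have Ufin : mu U \is a fin_num.
    by rewrite ge0_fin_numE// (le_lt_trans (le_measure mu _ _ UQ))// ?inE// ltey_eq fin.
  rewrite -(fineK (ffin _ im)) -(fineK (fin _ im)) -(fineK Ufin) -!EFinM !lee_fin.
  have -> : fine (\int[mu]_(x in Q i) f x) = A i * fine (mu (Q i)).
    by rewrite /A divfK// gt_eqF// pos.
  by rewrite mulrAC mulrC ler_pM2l// mulrC.
have -> : Q' i `\` later m Q' i = Q i `\` U.
  rewrite /Q' bi; apply/seteqP; split => x [Qix nx]; split=> //; apply: contra_not nx.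
    rewrite /U -bigcup_mkord => -[j /= jm]; rewrite /Q2; case: ifP => // /andP[ij bj] [Qjx _].
    by exists j; rewrite /= ?ij// bj.
  move=> [j /= /andP[ij jm]]; case: ifP => // bj Qjx.
  by rewrite /U -bigcup_mkord; exists j => //=; rewrite /Q2 ij bj.
have Ufin : mu U \is a fin_num.
  by rewrite ge0_fin_numE// (le_lt_trans (le_measure mu _ _ UQ))// ?inE// ltey_eq fin.
have -> : mu (Q i `\` U) = (mu (Q i) - mu U)%E.
  by rewrite measureD ?(setIidr UQ)// ltey_eq fin.
move: half; rewrite -(fineK (fin _ im)) -(fineK Ufin) -EFinB -!EFinM !lee_fin.
lra.
Qed.

(** Each set is charged to a selected ancestor with comparable mean; the packing
    hypothesis sums up the charges that one selected set receives at x. *)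
Lemma sparse_domination m (Q : nat -> set T) (A lam : nat -> R) (b : nat -> bool) (C1 : R) x :
  (forall i, 0 <= A i) -> (forall i, 0 <= lam i) ->
  (forall i, b i -> (i < m)%N) ->
  (forall j, (j < m)%N -> 0 < A j ->
        exists i, [/\ (i <= j)%N, b i, Q j `<=` Q i & A j <= 2 * A i]) ->
  (forall i, (i < m)%N -> Q i x ->
     \sum_(j < m | (i <= j)%N) lam j * \1_(Q j) x <= C1 * lam i) ->
  \sum_(j < m) (lam j * A j) * \1_(Q j) x <=
  2 * C1 * \sum_(i < m) (lam i * A i) * \1_(if b i then Q i else set0) x.
Proof.
move=> A0 l0 bm dom pack.
pose Q' i := if b i then Q i else set0.
have ind0 (S : set T) : 0 <= \1_S x :> R by rewrite indicE ler0n.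
apply: (@le_trans _ _ (\sum_(j < m) \sum_(i < m | (i <= j)%N)
    2 * (A i * \1_(Q' i) x) * (lam j * \1_(Q j) x))).
  apply: ler_sum => j _.
  have [Qjx|nQ] := pselect (Q j x); last first.
    by rewrite indicE memNset// !mulr0 sumr_ge0// => i _; rewrite mulr0.
  have [Aj|Aj] := leP (A j) 0.
    have -> : A j = 0 by apply/eqP; rewrite eq_le Aj A0.
    by rewrite mulr0 mul0r sumr_ge0// => i _; rewrite !mulr_ge0.
  have [i [ij bi sub Aji]] := dom _ (ltn_ord j) Aj.
  rewrite (bigD1 (Ordinal (bm _ bi)))//=.
  rewrite ler_wpDr//; first by rewrite sumr_ge0// => k _; rewrite !mulr_ge0.
  rewrite /Q' bi [\1_(Q i) x]indicE mem_set; last exact: sub.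
  rewrite mulr1; have -> : lam j * A j * \1_(Q j) x = A j * (lam j * \1_(Q j) x) by ring.
  by rewrite ler_wpM2r// mulr_ge0.
rewrite (exchange_big_dep xpredT)//= mulr_sumr; apply: ler_sum => i _.
rewrite -mulr_sumr -/(Q' i) /Q'.
case: ifP => bi; last by rewrite indic0 !mulr0 mul0r.
have [Qix|nQ] := pselect (Q i x); last by rewrite indicE memNset// !mulr0 mul0r.
rewrite indicE mem_set// !mulr1.
have := pack _ (ltn_ord i) Qix; have := A0 i.
set S := \sum_(_ < _ | _) _ => Ai H.
have -> : 2 * C1 * (lam i * A i) = 2 * A i * (C1 * lam i) by ring.
by rewrite ler_wpM2l// mulr_ge0.
Qed.

End discrete_fractional.

Section discrete_bound.
Context d (T : measurableType d) (R : realType) (mu : {measure set T -> \bar R}).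

(** The L^q norm of the sum is estimated on the selected subfamily by the sum of
    the (lam_i A_i)^q u(Q_i), each of which is at most K^q X_i^(q/p) by the
    two-weight condition, with X_i = (f(Q_i) / s(Q_i))^(p-1) f(Q_i); as p < q it
    suffices to bound the sum of the X_i, which is the Carleson embedding. The
    constant depends neither on the family nor on the number of its sets. *)
Lemma discrete_fractional_le (p q eta C1 K : R) : 1 < p -> p < q -> 0 < eta ->
  0 < C1 -> 0 < K -> exists2 C : R, 0 < C &
  forall (m : nat) (Q : nat -> set T) (lam : nat -> R) (u s : T -> R) (f : T -> \bar R),
  let f_ i := fine (\int[mu]_(x in Q i) f x) in
  let u_ i := fine (\int[mu]_(x in Q i) (u x)%:E) in
  let s_ i := fine (\int[mu]_(x in Q i) (s x)%:E) in
  (forall i, measurable (Q i)) -> laminar m Q ->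
  (forall i, (i < m)%N -> (0 < mu (Q i) < +oo)%E) ->
  measurable_fun [set: T] u -> (forall x, 0 < u x) ->
  measurable_fun [set: T] s -> (forall x, 0 < s x) ->
  (forall i, (i < m)%N -> (0 < \int[mu]_(x in Q i) (u x)%:E < +oo)%E) ->
  (forall i, (i < m)%N -> (0 < \int[mu]_(x in Q i) (s x)%:E < +oo)%E) ->
  (forall i, (i < m)%N -> halving mu eta (Q i) u) ->
  (forall i, (i < m)%N -> halving mu eta (Q i) s) ->
  (forall i, 0 <= lam i) ->
  (forall x i, (i < m)%N -> Q i x ->
     \sum_(j < m | (i <= j)%N) lam j * \1_(Q j) x <= C1 * lam i) ->
  (forall i, (i < m)%N ->
     lam i * (u_ i `^ q^-1 * s_ i `^ (1 - p^-1)) <= K * fine (mu (Q i))) ->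
  measurable_fun [set: T] f -> (forall x, 0 <= f x)%E ->
  (\int[mu]_x (f x `^ p * (s x `^ (1 - p))%:E) < +oo)%E ->
  (\int[mu]_x (((\sum_(i < m) lam i * (f_ i / fine (mu (Q i))) * \1_(Q i) x) `^ q)%:E
               * (u x)%:E) <=
   C%:E * (\int[mu]_x (f x `^ p * (s x `^ (1 - p))%:E)) `^ (q / p))%E.
Proof.
move=> p1 pq eta0 C10 K0; have q1 : 1 < q by exact: lt_trans pq.
have [CL CL0 carl] := carleson_sum_le mu q1 eta0.
have [CE CE0 emb] := carleson_embedding mu p1 eta0.
exists ((2 * C1) `^ q * (CL * (K `^ q * CE `^ (q / p)))).
  by rewrite !mulr_gt0 ?powR_gt0 ?mulr_gt0.
move=> m Q lam u s f f_ u_ s_ mQ lamQ Qfin mu_ u0 ms s0 ufin sfin hu hs l0 pack apq mf f0 Foo.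
set F := (\int[mu]_x (f x `^ p * (s x `^ (1 - p))%:E))%E in Foo *.
have msE : measurable_fun [set: T] (EFin \o s) by exact/measurable_EFinP.
have muE : measurable_fun [set: T] (EFin \o u) by exact/measurable_EFinP.
have p10 x : (0 <= f x `^ p * (s x `^ (1 - p))%:E)%E.
  by rewrite mule_ge0// ?lee_fin ?poweR_ge0 ?powR_ge0.
have F0 : (0 <= F)%E by exact: integral_ge0.
have foo i : (i < m)%N -> (\int[mu]_(x in Q i) f x < +oo)%E.
  by move=> im; apply: (weighted_integral_lty p1 (mQ i) ms) => //; have /andP[] := sfin _ im.
pose A i := f_ i / fine (mu (Q i)).
have f_0 i : 0 <= f_ i by apply/fine_ge0/integral_ge0.
have A0 i : 0 <= A i by rewrite divr_ge0// fine_ge0.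
have [b [bm bsp bdom]] := principal_selection m Q A.
pose Q' i := if b i then Q i else set0.
have mQ' i : measurable (Q' i) by rewrite /Q'; case: ifP.
have lamQ' : laminar m Q'.
  move=> i j ijm; rewrite /Q'; case: (b j); last by left => ? [].
  by case: (b i); [exact: lamQ|right; rewrite set0I].
have sparse_w (w : T -> R) : (forall i, (i < m)%N -> halving mu eta (Q i) w) ->
    forall i, (i < m)%N -> (eta%:E * \int[mu]_(x in Q' i) (w x)%:E <=
                           \int[mu]_(x in Q' i `\` later m Q' i) (w x)%:E)%E.
  move=> hw i im; rewrite {1 2}/Q'; case: ifPn => [bi|_]; last first.
    by rewrite set0D !integral_set0 mule0.
  apply: hw => //; first by apply: measurableD => //; exact: measurable_later.
  have := sparse_of_selection mQ lamQ Qfin mf f0 foo bsp im bi.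
  by rewrite {1}/Q' bi.
have fin_w (w : T -> R) : (forall i, (i < m)%N -> (0 < \int[mu]_(x in Q i) (w x)%:E < +oo)%E) ->
    forall i, (i < m)%N -> (\int[mu]_(x in Q' i) (w x)%:E < +oo)%E.
  move=> hw i im; rewrite /Q'; case: ifP => _; last by rewrite integral_set0.
  by have /andP[] := hw _ im.
pose c i := lam i * A i.
have c0 i : 0 <= c i by rewrite mulr_ge0.
pose X i := (fine (\int[mu]_(x in Q' i) f x) / fine (\int[mu]_(x in Q' i) (s x)%:E))
       `^ (p - 1) * fine (\int[mu]_(x in Q' i) f x).
have X0 i : 0 <= X i by rewrite mulr_ge0 ?powR_ge0//; apply/fine_ge0/integral_ge0.
have HX : ((\sum_(i < m) X i)%:E <= CE%:E * F)%E.
  apply: emb => //; [exact: fin_w|exact: sparse_w|].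
  by move=> i im; rewrite /Q'; case: ifP => _; [exact: foo|rewrite integral_set0].
have mS (Z : nat -> set T) : (forall i, measurable (Z i)) ->
    measurable_fun [set: T] (fun x => ((\sum_(i < m) c i * \1_(Z i) x) `^ q)%:E).
  move=> mZ; apply/measurable_EFinP; apply: (measurableT_comp (measurable_powR _)).
  exact: measurable_sum_indic.
apply: (@le_trans _ _ (((2 * C1) `^ q)%:E *
    \int[mu]_x (((\sum_(i < m) c i * \1_(Q' i) x) `^ q)%:E * (u x)%:E))%E).
  rewrite -ge0_integralZl_EFin//; last 3 first.
  - by move=> x _; rewrite -EFinM lee_fin mulr_ge0// ?powR_ge0// ltW.
  - by apply: emeasurable_funM => //; exact: mS.
  - exact: powR_ge0.
  apply: ge0_le_integral => //.
  - by move=> x _; rewrite -EFinM lee_fin mulr_ge0// ?powR_ge0// ltW.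
  - by apply: emeasurable_funM => //; exact: mS.
  - by apply: measurable_funeM; apply: emeasurable_funM => //; exact: mS.
  move=> x _; rewrite -!EFinM lee_fin mulrA -powRM//; last 2 first.
  - by rewrite mulr_ge0// ltW.
  - exact: sum_indic_ge0.
  rewrite ler_wpM2r ?(ltW (u0 x))//; apply: le_powR2r.
  - by lra.
  - exact: (@sum_indic_ge0 _ _ _ m c Q x c0).
  - by apply: (@sparse_domination _ _ _ m Q A lam b C1 x) => // i im; exact: pack.
rewrite EFinM -muleA lee_wpmul2l// ?lee_fin ?powR_ge0//.
apply: le_trans (carl m Q' c (EFin \o u) mQ' lamQ' c0 muE _ (fin_w _ ufin) (sparse_w _ hu)) _.
  by move=> x; rewrite lee_fin ltW.
rewrite EFinM -muleA lee_wpmul2l// ?lee_fin ?(ltW CL0)//.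
have step i : (i < m)%N -> ((c i `^ q)%:E * \int[mu]_(x in Q' i) (EFin \o u) x <=
    (K `^ q * X i `^ (q / p))%:E)%E.
  move=> im; rewrite /X /Q'; case: ifPn => bi; last first.
    rewrite integral_set0 mule0 lee_fin mulr_ge0 ?powR_ge0//.
  have [/andP[ui0 uioo] /andP[si0 sioo]] := (ufin _ im, sfin _ im).
  have u_0 : 0 < u_ i by rewrite fine_gt0// ui0.
  have s_0 : 0 < s_ i by rewrite fine_gt0// si0.
  have m_0 : 0 < fine (mu (Q i)) by rewrite fine_gt0// Qfin.
  have -> : (\int[mu]_(x in Q i) (EFin \o u) x = (u_ i)%:E)%E.
    by rewrite fineK// ge0_fin_numE// ltW.
  rewrite -/(f_ i) -/(s_ i) -EFinM lee_fin.
  have -> : u_ i = (u_ i `^ q^-1) `^ q.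
    by rewrite -powRrM mulVf ?powRr1 ?(ltW u_0)// gt_eqF//; lra.
  have -> : ((f_ i / s_ i) `^ (p - 1) * f_ i) `^ (q / p) = (f_ i / s_ i `^ (1 - p^-1)) `^ q.
    have -> : q / p = p^-1 * q by rewrite mulrC.
    rewrite powRrM; congr (_ `^ _).
    have E : (f_ i / s_ i) `^ (p - 1) * f_ i = (f_ i / s_ i) `^ p * s_ i.
      have fs : 0 <= f_ i / s_ i by rewrite divr_ge0// ltW.
      have ft : f_ i = f_ i / s_ i * s_ i by rewrite divfK// gt_eqF.
      rewrite -(powR_mul_powRB1 p1 fs) [X in _ * X = _]ft.
      by rewrite mulrCA mulrA.
    rewrite E powRM ?powR_ge0// ?(ltW s_0)// -powRrM divff ?powRr1 ?divr_ge0 ?(ltW s_0)//; last first.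
      by rewrite gt_eqF//; lra.
    rewrite powRB ?powRr1 ?(ltW s_0)//; last by rewrite (gt_eqF s_0) implybT.
    by field; rewrite !gt_eqF// powR_gt0.
  rewrite -!powRM ?powR_ge0 ?divr_ge0 ?(ltW K0)//; last exact: powR_ge0.
  apply: le_powR2r; rewrite ?mulr_ge0 ?powR_ge0//; first lra.
  rewrite /c /A.
  have sp : 0 < s_ i `^ (1 - p^-1) by rewrite powR_gt0.
  rewrite [leRHS]mulrA ler_pdivlMr//.
  have -> : lam i * (f_ i / fine (mu (Q i))) * u_ i `^ q^-1 * s_ i `^ (1 - p^-1) =
     (lam i * (u_ i `^ q^-1 * s_ i `^ (1 - p^-1))) * f_ i / fine (mu (Q i)).
    by field; rewrite gt_eqF.
  by rewrite ler_pdivrMr// [leRHS]mulrAC ler_wpM2r// apq.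
apply: (@le_trans _ _ (K `^ q * (\sum_(i < m) X i) `^ (q / p))%:E).
  apply: (@le_trans _ _ (\sum_(i < m) (K `^ q * X i `^ (q / p))%:E)%E).
    by apply: lee_sum => i _; exact: step.
  rewrite sumEFin lee_fin -mulr_sumr ler_wpM2l ?powR_ge0//.
  by apply: sum_powR_le => //; rewrite ltr_pdivlMr ?mul1r//; lra.
have qp0 : 0 <= q / p by rewrite divr_ge0; lra.
move: HX Foo F0; case: (F) => [F'| |]// HX _; rewrite !lee_fin => F0.
rewrite -mulrA ler_wpM2l ?powR_ge0//.
rewrite -powRM ?(ltW CE0)//; apply: le_powR2r => //; first exact: sumr_ge0.
Qed.

End discrete_bound.

(** * Lebesgue measure of boxes *)

Section boxes.
Context {R : realType}.

Definition box n (J : 'I_n -> set R) : set 'rV[R]_n :=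
  [set x | forall i, J i (x 0 i)].

Lemma measurable_box_borel n (J : 'I_n -> set R) : (forall i, measurable (J i)) ->
  measurable (box J).
Proof.
move=> mJ.
have -> : box J = \bigcap_(i in [set: 'I_n]) (@rV_coord R n i @^-1` J i).
  by apply/seteqP; split => [x H i _|x H i]; exact: H.
apply: fin_bigcap_measurable => // i _.
rewrite -[X in measurable X]setTI; apply: (@measurable_rV_coord R n i) => //.
exact: mJ.
Qed.

Lemma borel_lebesgue_box n (J : 'I_n -> set R) (l : R) :
  (forall i, measurable (J i)) -> (forall i, lebesgue_measure (J i) = l%:E) ->
  borel_lebesgue_rV n (box J) = (l ^+ n)%:E.
Proof.
elim: n J => [|n IH] J mJ lJ.
  by rewrite expr0 /= diracE mem_set// => -[k k0]; exfalso; rewrite ltn0 in k0.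
rewrite /= /lebesgue_rV_succ /pushforward.
have -> : @rV_cons R n @^-1` box J = J ord0 `*` box (fun i => J (lift ord0 i)).
  apply/seteqP; split => [[a v]|[a v] [/= Ja Jv] i].
    move=> H; split => [|i] /=.
      have := H ord0; rewrite /rV_cons.
      have -> : (ord0 : 'I_n.+1) = lshift n (0 : 'I_1) by apply: ord_inj.
      by rewrite (row_mxEl (const_mx a : 'rV_1) v) mxE.
    have := H (lift ord0 i); rewrite /rV_cons.
    have -> : lift ord0 i = rshift 1 i by apply: ord_inj.
    by rewrite (row_mxEr (const_mx a : 'rV_1) v).
  rewrite /rV_cons; have [k|k] := @split_ordP 1 n i => ik.
    rewrite ik /=.
    rewrite (row_mxEl (const_mx a : 'rV_1) v) mxE.
    suff -> : lshift n k = ord0 by [].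
    by apply: ord_inj; rewrite ord1.
  rewrite ik /= (row_mxEr (const_mx a : 'rV_1) v).
  by have -> : rshift 1 k = lift ord0 k by apply: ord_inj; [].
rewrite product_measure1E; [|exact: mJ|exact: measurable_box_borel].
by rewrite exprS EFinM; congr (_ * _)%E; [exact: lJ|exact: IH].
Qed.

Lemma measurable_box n (J : 'I_n -> set R) : (forall i, measurable (J i)) ->
  measurable (box J : set (Rn R n)).
Proof.
move=> mJ; apply: sub_caratheodory => //; apply: sub_sigma_algebra.
exact: measurable_box_borel.
Qed.

Lemma lebesgue_box n (J : 'I_n -> set R) (l : R) :
  (forall i, measurable (J i)) -> (forall i, lebesgue_measure (J i) = l%:E) ->
  (@lebesgue_rV R n : {measure set (Rn R n) -> \bar R}) (box J) = (l ^+ n)%:E.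
Proof.
move=> mJ lJ; rewrite -(borel_lebesgue_box mJ lJ) /=.
by rewrite /lebesgue_rV /completed_measure_extension measurable_mu_extE//;
  exact: measurable_box_borel.
Qed.

End boxes.

(** * Shifted triadic grids *)

Section triadic_line.
Context {R : realType}.
Implicit Types (j : int) (t : bool) (x y : R).

Definition side j : R := 3 `^ j%:~R.

Lemma side_gt0 j : 0 < side j.
Proof. by rewrite powR_gt0. Qed.

Lemma sideS j : side (j + 1) = 3 * side j.
Proof.
by rewrite /side intrD powRD ?pnatr_eq0 ?implybT// powRr1// mulrC.
Qed.

(** The index of the cell of side 3^j that contains y, in the grid with vertices
    3^j Z if t is false, and in the grid translated by 3^j / 2 if t is true. *)
Definition slot t j y : int := Num.floor (y / side j - t%:R / 2).

(** The shift by one half is compatible with tripling, as 3/2 and 1/2 differ by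
    an integer: this is what makes the shifted grid nested. *)
Lemma slotS t j y : slot t (j + 1) y = ((slot t j y - t%:Z) %/ 3)%Z.
Proof.
apply: floor_def; rewrite sideS.
have := floor_itv (y / side j - t%:R / 2); rewrite -/(slot t j y).
set m := slot t j y; have := divz_eq (m - t%:Z) 3.
have : (0 <= (m - t%:Z) %% 3)%Z /\ ((m - t%:Z) %% 3 < 3)%Z.
  by rewrite modz_ge0// ltz_pmod.
set k := ((m - t%:Z) %/ 3)%Z; set r := ((m - t%:Z) %% 3)%Z => -[r0 r3] E; clearbody k r m.
have -> : y / (3 * side j) = y / side j / 3.
  by field; rewrite gt_eqF// side_gt0.
have {}E : m = k * 3 + r + t%:Z by rewrite -E subrK.
rewrite E !intrD !intrM => /andP[].
have r0' : (0 : R) <= r%:~R by rewrite ler0z.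
have r3' : (r%:~R : R) <= 2 by rewrite (_ : 2 = 2%:~R)// ler_int -ltzD1.
have -> : (t%:Z%:~R : R) = t%:R by rewrite -pmulrn.
set w := y / side j.
have t0 : (0 : R) <= t%:R by [].
move=> H1 H2; apply/andP; split; lra.
Qed.

Lemma slot_mono t j j' x y : (j <= j')%R -> slot t j x = slot t j y ->
  slot t j' x = slot t j' y.
Proof.
move=> jj' E; have -> : j' = j + `|j' - j|%N%:Z.
  by rewrite gez0_abs ?subr_ge0// [RHS]addrC subrK.
elim: `|j' - j|%N => [|k IH]; first by rewrite addr0.
by rewrite intS [1 + _]addrC addrA !slotS IH.
Qed.

(** If a vertex of each of the two grids separates x from y then these vertices
    are closer than half the side, which the shift excludes. *)
Lemma slot_close j x y : `|x - y| < side j / 2 ->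
  exists t, slot t j x = slot t j y.
Proof.
have P (z w : R) : z <= w -> w - z < 1 / 2 -> exists t : bool,
    Num.floor (z - t%:R / 2) = Num.floor (w - t%:R / 2) :> int.
  move=> zw wz; have /andP[a1 a2] := floor_itv z.
  set a := Num.floor z in a1 a2; rewrite intrD in a2.
  have [wa|wa] := ltP w (a%:~R + 1).
    exists false; rewrite mul0r !subr0 -/a; apply/esym/floor_def.
    by rewrite intrD wa andbT; lra.
  have t1 : (true%:R : R) = 1 by [].
  exists true; transitivity a; [|apply/esym]; apply: floor_def;
    by rewrite intrD t1; apply/andP; split; lra.
have s0 := side_gt0 j => H.
have {}H : `|x / side j - y / side j| < 1 / 2.
  rewrite -mulrBl normrM (gtr0_norm (_ : 0 < (side j)^-1)) ?invr_gt0//.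
  by rewrite ltr_pdivrMr// mulrC mulrA mulr1.
have [xy|yx] := leP (x / side j) (y / side j).
  by apply: P => //; rewrite distrC ger0_norm ?subr_ge0// in H.
have [|t tE] := P _ _ (ltW yx); last by exists t; rewrite /slot tE.
by rewrite gtr0_norm ?subr_gt0// in H.
Qed.

Lemma slot_itv t j (k : int) : [set y | slot t j y = k] =
  `[side j * (k%:~R + t%:R / 2), side j * (k%:~R + t%:R / 2) + side j[%classic.
Proof.
have s0 := side_gt0 j.
apply/seteqP; split => y /=; rewrite in_itv/=.
  move=> <-; have /andP[] := floor_itv (y / side j - t%:R / 2).
  rewrite -/(slot t j y) intrD lerBrDr ltrBlDr ler_pdivlMr// ltr_pdivrMr//.
  by move=> H1 H2; apply/andP; split; lra.
move=> /andP[H1 H2]; apply: floor_def.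
rewrite intrD lerBrDr ltrBlDr ler_pdivlMr// ltr_pdivrMr//.
by apply/andP; split; lra.
Qed.

Lemma side_unbounded (e M : R) : 0 < e -> exists j, M <= side j `^ (- e).
Proof.
move=> e0; have M0 : 0 <= `|M| / (e * ln 3).
  by rewrite divr_ge0// mulr_ge0 ?ltW// ln_gt0//; lra.
have H := archi_boundP M0; set k := Num.Def.archi_bound _ in H.
exists (- k%:Z); rewrite /side -powRrM.
have l3 : 0 < e * ln (3 : R) by rewrite mulr_gt0// ln_gt0//; lra.
rewrite ltr_pdivrMr// in H.
have -> : 3 `^ ((- k%:Z)%:~R * - e) = expR (k%:R * (e * ln 3)) :> R.
  rewrite /powR pnatr_eq0/= mulrNz mulrNN -pmulrn; congr expR; ring.
apply: le_trans (expR_ge1Dx _); have := ler_norm M; lra.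
Qed.

Lemma side_approx (N : R) : 0 < N -> exists j, N < side j / 2 /\ side j <= 6 * N.
Proof.
move=> N0; pose z : R := ln (2 * N) / ln 3; pose j := Num.floor z.
have l3 : 0 < ln (3 : R) by rewrite ln_gt0//; lra.
have N2 : 0 < 2 * N by lra.
have NE : 2 * N = 3 `^ z.
  by rewrite /powR pnatr_eq0/= /z divfK ?gt_eqF// lnK.
have /andP[z1 z2] := floor_itv z; rewrite -/j in z1 z2.
exists (j + 1); split.
  rewrite ltr_pdivlMr// mulrC NE /side /powR pnatr_eq0/=.
  by rewrite ltr_expR ltr_pM2r.
rewrite sideS; have -> : 6 * N = 3 * (2 * N) by lra.
rewrite ler_pM2l// NE /side /powR pnatr_eq0/=.
by rewrite ler_expR ler_pM2r.
Qed.

End triadic_line.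

Lemma sum_injective_geometric (R : realType) m (P : pred 'I_m) (d : 'I_m -> nat) (th : R) :
  0 <= th < 1 -> {in P &, injective d} ->
  \sum_(j | P j) th ^+ d j <= (1 - th)^-1.
Proof.
move=> /andP[th0 th1] inj.
pose M := \max_j d j.
have dM j : (d j < M.+1)%N by rewrite ltnS leq_bigmax.
pose h (j : 'I_m) : 'I_M.+1 := Ordinal (dM j).
have injh : {in P &, injective h}.
  by move=> j k jP kP /(congr1 val)/= E; exact: inj.
rewrite -(big_imset (fun k : 'I_M.+1 => th ^+ k) injh)/=.
apply: (@le_trans _ _ (\sum_(k < M.+1) th ^+ k)).
  by rewrite [leRHS](bigID (mem [set h j | j in P]%SET))/= lerDl sumr_ge0// => k _; rewrite exprn_ge0.
rewrite -[leRHS]mul1r ler_pdivlMr; last lra.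
have := subrX1 th M.+1; have : 0 <= th ^+ M.+1 by rewrite exprn_ge0.
by set S := \sum_(_ < _) _; nra.
Qed.

Section cells.
Context {R : realType} {n : nat}.
Local Notation index := (int * {ffun 'I_n -> int})%type.
Implicit Types (t : {ffun 'I_n -> bool}) (c : index).
Local Notation mu := (@lebesgue_rV R n : {measure set (Rn R n) -> \bar R}).

Definition cell t c : set (Rn R n) :=
  box (fun i => [set y : R | slot (t i) c.1 y = c.2 i]).

Lemma measurable_cell t c : measurable (cell t c).
Proof. by apply: measurable_box => i; rewrite slot_itv; exact: measurable_itv. Qed.

Lemma lebesgue_cell t c : mu (cell t c) = (side c.1 ^+ n)%:E.
Proof.
apply: lebesgue_box => i; rewrite slot_itv; first exact: measurable_itv.
rewrite lebesgue_measure_itv/= lte_fin ltrDl side_gt0.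
by rewrite -EFinB addrAC subrr add0r.
Qed.

Lemma cubeE (a : 'rV[R]_n) l : [set x : 'rV[R]_n | forall i, a 0 i <= x 0 i <= a 0 i + l] =
  box (fun i => `[a 0 i, a 0 i + l]%classic).
Proof. by apply/seteqP; split => x H i; have := H i; rewrite /= in_itv. Qed.

Lemma measurable_cube (Q : set 'rV[R]_n) : cubes Q -> measurable (Q : set (Rn R n)).
Proof.
move=> [a [l l0 ->]]; rewrite cubeE; apply: measurable_box => i; exact: measurable_itv.
Qed.

Lemma lebesgue_cube (a : 'rV[R]_n) l : 0 < l ->
  mu [set x : 'rV[R]_n | forall i, a 0 i <= x 0 i <= a 0 i + l] = (l ^+ n)%:E.
Proof.
move=> l0; rewrite cubeE; apply: lebesgue_box => i; first exact: measurable_itv.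
rewrite lebesgue_measure_itv/= lte_fin ltrDl l0.
by rewrite -EFinB addrAC subrr add0r.
Qed.

Lemma compact_cube (Q : set 'rV[R]_n) : cubes Q -> compact Q.
Proof.
move=> [a [l l0 ->]]; rewrite cubeE.
exact: (@rV_compact R n (fun i => `[a 0 i, a 0 i + l]%classic) (fun i => @segment_compact _ _ _)).
Qed.

(** Cells are half-open, so that a grid is a partition, whereas the A_infty
    condition concerns closed cubes. *)
Lemma cell_sub_cube t c : exists Q : set 'rV[R]_n,
  [/\ cubes Q, cell t c `<=` Q & mu Q = mu (cell t c)].
Proof.
pose a : 'rV[R]_n := \row_i (side c.1 * ((c.2 i)%:~R + (t i)%:R / 2)).
exists [set x : 'rV[R]_n | forall i, a 0 i <= x 0 i <= a 0 i + side c.1]; split.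
- by exists a; exists (side c.1) => //; exact: side_gt0.
- move=> x H i; have := H i; rewrite slot_itv /= in_itv/= /a mxE => /andP[-> /ltW ->//].
- by rewrite lebesgue_cell lebesgue_cube// side_gt0.
Qed.

Lemma cell_nested t c c' x : c'.1 <= c.1 -> cell t c x -> cell t c' x ->
  cell t c' `<=` cell t c.
Proof.
move=> cc' cx c'x y c'y i; rewrite /= -(cx i); apply: (slot_mono cc').
by have := c'y i; have := c'x i => /= -> ->.
Qed.

Lemma cell_inj t c c' x : c.1 = c'.1 -> cell t c x -> cell t c' x -> c = c'.
Proof.
case: c c' => [j k] [j' k']/= <- cx c'x; congr pair; apply/ffunP => i.
by have /= <- := cx i; have /= <- := c'x i.
Qed.

Definition coarser c c' := c'.1 <= c.1.

Lemma coarser_trans : transitive coarser.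
Proof. by move=> c1 c2 c3; rewrite /coarser => H1 H2; exact: le_trans H2 H1. Qed.

Lemma coarser_total : total coarser.
Proof. by move=> c c'; rewrite /coarser le_total. Qed.

Section sorted_cells.
Variables (t : {ffun 'I_n -> bool}) (s : seq index).
Hypotheses (us : uniq s) (ss : sorted coarser s).
Let c i := nth (0, [ffun=> 0]) s i.

Lemma sorted_coarser i j : (i <= j < size s)%N -> (c j).1 <= (c i).1.
Proof.
move=> /andP[ij js]; apply: (sorted_leq_nth coarser_trans _ _ ss) => //.
- by move=> k; exact: lexx.
- by rewrite inE (leq_ltn_trans ij).
Qed.

Lemma laminar_cells : laminar (size s) (fun i => cell t (c i)).
Proof.
move=> i j /andP[ij js].
have [[x [ix jx]]|nx] := pselect (cell t (c i) `&` cell t (c j) !=set0).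
  by left; apply: cell_nested ix jx; rewrite sorted_coarser// (ltnW ij).
by right; apply/nonemptyPn.
Qed.

(** The cells of one grid that contain a given point have different sides, so
    the powers of their sides are dominated by a geometric series. *)
Lemma cells_packing (e : R) x i : 0 < e -> (i < size s)%N -> cell t (c i) x ->
  \sum_(j < size s | (i <= j)%N) side (c j).1 `^ e * \1_(cell t (c j)) x <=
  (1 - 3 `^ (- e))^-1 * side (c i).1 `^ e.
Proof.
move=> e0 is_ ix; rewrite mulrC.
have th : 0 <= (3 : R) `^ (- e) < 1.
  rewrite powR_ge0/= /powR pnatr_eq0/= -[ltRHS]expR0 ltr_expR mulNr oppr_lt0.
  by rewrite mulr_gt0// ln_gt0//; lra.
pose P (j : 'I_(size s)) := (i <= j)%N && `[< cell t (c j) x >].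
pose d (j : 'I_(size s)) := `|(c i).1 - (c j).1|%N.
have inj : {in P &, injective d}.
  move=> j k /andP[ij /asboolP jx] /andP[ik /asboolP kx].
  have cj : (c j).1 <= (c i).1 by rewrite sorted_coarser// ij/=.
  have ck : (c k).1 <= (c i).1 by rewrite sorted_coarser// ik/=.
  move=> /(congr1 Posz); rewrite /d !gez0_abs ?subr_ge0// => E.
  have {}E : (c j).1 = (c k).1 by apply: oppr_inj; exact: (addrI (c i).1).
  apply/val_inj/eqP; rewrite -(nth_uniq (0, [ffun=> 0]) (ltn_ord j) (ltn_ord k) us).
  by apply/eqP; exact: (cell_inj E jx kx).
apply: le_trans (ler_wpM2l (powR_ge0 _ _) (sum_injective_geometric th inj)).
rewrite mulr_sumr [leLHS](bigID (fun j : 'I__ => `[< cell t (c j) x >]))/=.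
rewrite [X in _ + X]big1 ?addr0; last first.
  by move=> j /andP[_ /asboolPn jx]; rewrite indicE memNset// mulr0.
apply: ler_sum => j /andP[ij /asboolP jx]; rewrite indicE mem_set// mulr1.
rewrite -powR_mulrn ?powR_ge0// -powRrM /side -!powRrM -powRD ?pnatr_eq0 ?implybT//.
have cj : (c j).1 <= (c i).1 by rewrite sorted_coarser// ij/=.
have -> : ((d j)%:R : R) = (c i).1%:~R - (c j).1%:~R.
  by rewrite pmulrn /d gez0_abs ?subr_ge0// intrB.
rewrite le_eqVlt; apply/orP; left; apply/eqP; congr powR; ring.
Qed.

End sorted_cells.
End cells.

(** * A_infty weights given by their logarithm *)

Section integrable_real.
Context d (T : measurableType d) (R : realType) (mu : {measure set T -> \bar R}).
Variables (D : set T) (mD : measurable D).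
Implicit Types f g : T -> R.

Lemma integrableD_EFin f g : mu.-integrable D (EFin \o f) ->
  mu.-integrable D (EFin \o g) -> mu.-integrable D (EFin \o (fun x => f x + g x)).
Proof. by move=> fi gi; apply: eq_integrable (integrableD mD fi gi). Qed.

Lemma integrableB_EFin f g : mu.-integrable D (EFin \o f) ->
  mu.-integrable D (EFin \o g) -> mu.-integrable D (EFin \o (fun x => f x - g x)).
Proof. by move=> fi gi; apply: eq_integrable (integrableB mD fi gi). Qed.

Lemma integrableZl_EFin (k : R) f : mu.-integrable D (EFin \o f) ->
  mu.-integrable D (EFin \o (fun x => k * f x)).
Proof. by move=> fi; apply: eq_integrable (integrableZl mD k fi). Qed.

End integrable_real.

Section log_weights.
Context {R : realType} {n : nat}.
Local Notation mu := (@lebesgue_rV R n : {measure set (Rn R n) -> \bar R}).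
Implicit Types (phi : Rn R n -> R) (Q : set 'rV[R]_n).

Definition vol Q : R := fine (mu Q).

(** The condition that e^phi is an A_infty weight, for a locally integrable phi:
    then the geometric mean is the exponential of a finite mean value. *)
Definition log_A_infty phi :=
  [/\ measurable_fun [set: Rn R n] phi,
      (forall Q, cubes Q -> mu.-integrable Q (EFin \o phi)),
      (forall Q, cubes Q -> mu.-integrable Q (EFin \o (expR \o phi))) &
      exists2 K : R, 0 < K & forall Q, cubes Q ->
        \int[mu]_(x in Q) expR (phi x) <=
        K * vol Q * expR ((vol Q)^-1 * \int[mu]_(x in Q) phi x)].

Lemma vol_cube Q : cubes Q -> 0 < vol Q /\ mu Q = (vol Q)%:E.
Proof.
by move=> [a [l l0 ->]]; rewrite /vol lebesgue_cube//= exprn_gt0.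
Qed.

Lemma integrable_cube_cst Q (k : R) : cubes Q -> mu.-integrable Q (EFin \o (fun=> k)).
Proof.
move=> cQ; have [_ VE] := vol_cube cQ.
apply/integrableP; split; first exact: measurable_cst.
under eq_integral do rewrite /=.
rewrite integral_cst; last exact: measurable_cube.
by rewrite VE -EFinM ltry.
Qed.

Lemma Rintegral_cube_cst Q (k : R) : cubes Q -> \int[mu]_(x in Q) (fun=> k) x = k * vol Q.
Proof. by move=> cQ; rewrite Rintegral_cst//; exact: measurable_cube. Qed.

Lemma expR_tangent (s t : R) : expR (- t) * (1 + s + t) <= expR s.
Proof.
have -> : s = - t + (s + t) by lra.
rewrite expRD ler_wpM2l ?expR_ge0//; have := expR_ge1Dx (s + t); lra.
Qed.

Lemma lt_id_expR (s : R) : s < expR s.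
Proof. have := expR_ge1Dx s; lra. Qed.

(** With the average of phi over Q normalised to zero, integrate the tangent
    line of the exponential at -2K over B, and estimate the integral of phi over
    B from below by minus the integral of e^phi over the complement of B. *)
Lemma log_A_infty_halving phi : log_A_infty phi -> exists2 eta : R, 0 < eta &
  forall Q, cubes Q -> halving mu eta (Q : set (Rn R n)) (expR \o phi).
Proof.
move=> [mphi iphi ie [K K0 HK]].
exists (expR (- (2 * K)) / (2 * K)); first by rewrite divr_gt0 ?expR_gt0// mulr_gt0.
move=> Q cQ B mB BQ half; have [V0 VE] := vol_cube cQ; have mQ := measurable_cube cQ.
set V := vol Q in V0 VE.
set I := \int[mu]_(x in Q) expR (phi x).
set m := V^-1 * \int[mu]_(x in Q) phi x.
have HKQ : I <= K * V * expR m := HK _ cQ.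
have iphiQ := iphi _ cQ; have ieQ := ie _ cQ.
have ieB : mu.-integrable B (EFin \o (expR \o phi)) by apply: integrableS ieQ.
have IE : (\int[mu]_(x in Q) ((expR \o phi) x)%:E)%E = I%:E.
  by rewrite fineK//; exact: integrable_fin_num.
have IBE : (\int[mu]_(x in B) ((expR \o phi) x)%:E)%E = (\int[mu]_(x in B) expR (phi x))%:E.
  by rewrite fineK//; exact: integrable_fin_num.
rewrite IE IBE -EFinM lee_fin.
pose g x : R := expR (phi x) * \1_B x.
have ig : mu.-integrable Q (EFin \o g).
  apply: (le_integrable mQ _ _ ieQ).
    apply/measurable_EFinP; apply: measurable_funTS; apply: measurable_funM => //.
    exact: measurableT_comp.
  move=> x _; rewrite /= lee_fin !ger0_norm ?mulr_ge0 ?expR_ge0//.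
  by rewrite ler_piMr ?expR_ge0// indicE; case: (x \in B).
have gE : \int[mu]_(x in B) expR (phi x) = \int[mu]_(x in Q) g x.
  rewrite Rintegral_mkcond [RHS]Rintegral_mkcond; apply: eq_Rintegral => x _.
  rewrite /g !patchE indicE; case: (boolP (x \in B)) => [xB|_].
    by rewrite mem_set ?mulr1//; apply: BQ; rewrite inE in xB.
  by rewrite mulr0; case: ifP.
have muBE : mu B = (fine (mu B))%:E.
  rewrite fineK// ge0_fin_numE// (le_lt_trans (le_measure mu _ _ BQ)) ?inE//.
  by apply: (_ : (mu Q < +oo)%E); rewrite VE ltry.
have half' : V <= 2 * fine (mu B) by rewrite -lee_fin EFinM -muBE -VE.
have i1 : mu.-integrable Q (EFin \o \1_B).
  apply: (le_integrable mQ _ _ (integrable_cube_cst 1 cQ)).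
    by apply/measurable_EFinP; apply: measurable_funTS; exact: measurable_indic.
  by move=> x _; rewrite /= lee_fin indicE normr1 ger0_norm//; case: (x \in B).
have i1E : \int[mu]_(x in Q) \1_B x = fine (mu B).
  by rewrite /Rintegral integral_indic// setIidl.
pose h x : R := (1 + 2 * K) * \1_B x + ((phi x - m) - expR (- m) * expR (phi x)).
have ihm : mu.-integrable Q (EFin \o (fun x => phi x - m)).
  exact: integrableB_EFin (integrable_cube_cst m cQ).
have ihe : mu.-integrable Q (EFin \o (fun x => expR (- m) * expR (phi x))).
  exact: integrableZl_EFin.
have ihB : mu.-integrable Q (EFin \o (fun x => (phi x - m) - expR (- m) * expR (phi x))).
  exact: integrableB_EFin.
have ih1 : mu.-integrable Q (EFin \o (fun x => (1 + 2 * K) * \1_B x)).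
  exact: integrableZl_EFin.
have ih : mu.-integrable Q (EFin \o h) by exact: integrableD_EFin.
have hE : \int[mu]_(x in Q) h x = (1 + 2 * K) * fine (mu B) - expR (- m) * I.
  rewrite /h RintegralD// RintegralZl// i1E RintegralB// RintegralB//; last first.
    exact: integrable_cube_cst.
  rewrite RintegralZl// Rintegral_cube_cst// -/I /m.
  by rewrite -/V mulrAC mulVf ?gt_eqF// mul1r subrr sub0r.
have le : expR m * expR (- (2 * K)) * \int[mu]_(x in Q) h x <= \int[mu]_(x in Q) g x.
  rewrite -RintegralZl//; apply: le_Rintegral => //; first exact: integrableZl_EFin.
  move=> x _; rewrite /h /g -expRD.
  have [s ->] : exists s, phi x = m + s by exists (phi x - m); lra.
  rewrite [m + s]addrC addrK !expRD.
  have em := expR_gt0 m; have ek := expR_gt0 (- (2 * K)).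
  have emV : expR (- m) * (expR s * expR m) = expR s.
    by rewrite mulrCA -expRD addNr expR0 mulr1.
  rewrite emV -mulrA [expR s * expR m]mulrC -[leRHS]mulrA ler_pM2l//.
  have T1 := expR_tangent s (2 * K).
  have T2 := lt_id_expR s.
  rewrite indicE; case: (x \in B); rewrite /= ?mulr1 ?mulr0.
    apply: le_trans T1; rewrite ler_pM2l//.
    have := expR_gt0 s; lra.
  by rewrite add0r pmulr_rle0// subr_le0 ltW.
rewrite gE; apply: le_trans le; rewrite hE.
have emI : expR (- m) * I <= K * V.
  apply: (@le_trans _ _ (expR (- m) * (K * V * expR m))).
    by rewrite ler_wpM2l ?expR_ge0.
  by rewrite mulrCA -expRD addNr expR0 mulr1.
apply: (@le_trans _ _ (expR m * expR (- (2 * K)) * (V / 2))); last first.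
  rewrite ler_wpM2l ?mulr_ge0 ?expR_ge0//.
  have : 0 <= K * (2 * fine (mu B) - V) by rewrite mulr_ge0 ?subr_ge0// ltW.
  lra.
apply: (@le_trans _ _ (expR (- (2 * K)) / (2 * K) * (K * V * expR m))).
  by rewrite ler_wpM2l// divr_ge0 ?expR_ge0// mulr_ge0// ltW.
rewrite le_eqVlt; apply/orP; left; apply/eqP; field.
by rewrite gt_eqF.
Qed.

Lemma jensen_expR phi Q : log_A_infty phi -> cubes Q ->
  vol Q * expR ((vol Q)^-1 * \int[mu]_(x in Q) phi x) <=
  \int[mu]_(x in Q) expR (phi x).
Proof.
move=> [mphi iphi ie _] cQ; have [V0 _] := vol_cube cQ; have mQ := measurable_cube cQ.
set m := (vol Q)^-1 * _.
have iphiQ := iphi _ cQ; have ieQ := ie _ cQ; have ic k := integrable_cube_cst k cQ.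
have i1 : mu.-integrable Q (EFin \o (fun x => phi x + (1 - m))) by exact: integrableD_EFin.
apply: (@le_trans _ _ (\int[mu]_(x in Q) (expR m * (phi x + (1 - m))))).
  rewrite RintegralZl// RintegralD// Rintegral_cube_cst//.
  have -> : \int[mu]_(x in Q) phi x = m * vol Q.
    by rewrite /m mulrAC mulVf ?mul1r// gt_eqF.
  by rewrite -mulrDl [m + _]addrC subrK mul1r mulrC.
apply: le_Rintegral => //; first exact: integrableZl_EFin.
move=> x _; apply: le_trans (expR_tangent (phi x) (- m)).
by rewrite opprK ler_wpM2l ?expR_ge0//; lra.
Qed.

Lemma Rintegral_expR_gt0 phi Q : log_A_infty phi -> cubes Q ->
  0 < \int[mu]_(x in Q) expR (phi x).
Proof.
move=> Aphi cQ; apply: lt_le_trans (jensen_expR Aphi cQ).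
by rewrite mulr_gt0 ?expR_gt0//; have [] := vol_cube cQ.
Qed.

Lemma powR_expR (s r : R) : expR s `^ r = expR (r * s).
Proof. by rewrite /powR gt_eqF ?expR_gt0// expRK. Qed.

(** Each of the two averages is controlled by the corresponding geometric mean,
    and the product of the geometric means is at most one. *)
Lemma two_weight_condition phi psi (a b : R) : 0 < a -> 0 < b ->
  log_A_infty phi -> log_A_infty psi -> (forall x, a * phi x + b * psi x <= 0) ->
  exists2 K : R, 0 < K & forall Q, cubes Q ->
    (\int[mu]_(x in Q) expR (phi x)) `^ a * (\int[mu]_(x in Q) expR (psi x)) `^ b <=
    K * vol Q `^ (a + b).
Proof.
move=> a0 b0 Aphi Apsi le0.
have [_ iphi _ [K1 K10 H1]] := Aphi; have [_ ipsi _ [K2 K20 H2]] := Apsi.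
exists (K1 `^ a * K2 `^ b); first by rewrite mulr_gt0// powR_gt0.
move=> Q cQ; have [V0 _] := vol_cube cQ; have mQ := measurable_cube cQ.
have {}H1 := H1 _ cQ; have {}H2 := H2 _ cQ.
set m1 := (vol Q)^-1 * _ in H1; set m2 := (vol Q)^-1 * _ in H2.
have neg : a * m1 + b * m2 <= 0.
  rewrite /m1 /m2 mulrCA [b * _]mulrCA -mulrDr pmulr_rle0 ?invr_gt0//.
  have ipQ := iphi _ cQ; have isQ := ipsi _ cQ.
  have j1 : mu.-integrable Q (EFin \o (fun x => a * phi x)) by exact: integrableZl_EFin.
  have j2 : mu.-integrable Q (EFin \o (fun x => b * psi x)) by exact: integrableZl_EFin.
  rewrite -RintegralZl// -(@RintegralZl _ _ _ _ _ psi)// -RintegralD//.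
  apply: (@le_trans _ _ (\int[mu]_(x in Q) (fun=> 0) x)).
    apply: le_Rintegral => //; [exact: integrableD_EFin|exact: integrable_cube_cst].
  by rewrite Rintegral_cube_cst// mul0r.
apply: (@le_trans _ _ ((K1 * vol Q * expR m1) `^ a * (K2 * vol Q * expR m2) `^ b)).
  have p1 := Rintegral_expR_gt0 Aphi cQ; have p2 := Rintegral_expR_gt0 Apsi cQ.
  have [p1' p2'] := (ltW p1, ltW p2); have [a0' b0'] := (ltW a0, ltW b0).
  by apply: ler_pM; rewrite ?powR_ge0//; apply: le_powR2r.
have K1' := ltW K10; have K2' := ltW K20; have V' := ltW V0.
have VE : vol Q `^ (a + b) = vol Q `^ a * vol Q `^ b.
  by rewrite powRD// (gt_eqF V0) implybT.
rewrite !powRM ?mulr_ge0 ?expR_ge0// !powR_expR VE.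
have -> : K1 `^ a * vol Q `^ a * expR (a * m1) * (K2 `^ b * vol Q `^ b * expR (b * m2)) =
  K1 `^ a * K2 `^ b * (vol Q `^ a * vol Q `^ b) * expR (a * m1 + b * m2).
  by rewrite expRD; ring.
by rewrite ler_piMr ?mulr_ge0 ?powR_ge0// -expR0 ler_expR.
Qed.

End log_weights.

(** * Joining two powers *)

Section glue.
Context {R : realType} {n : nat}.
Local Notation mu := (@lebesgue_rV R n : {measure set (Rn R n) -> \bar R}).
Implicit Types (Q : set 'rV[R]_n).

Lemma Rintegral_mul_indic_le (g : Rn R n -> R) (Q Q0 : set (Rn R n)) :
  measurable Q -> measurable Q0 -> measurable_fun [set: Rn R n] g ->
  (forall x, 0 <= g x) -> mu.-integrable Q0 (EFin \o g) ->
  \int[mu]_(x in Q) (g x * \1_Q0 x) <= \int[mu]_(x in Q0) g x.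
Proof.
move=> mQ mQ0 mg g0 ig.
have -> : \int[mu]_(x in Q) (g x * \1_Q0 x) = \int[mu]_(x in Q `&` Q0) g x.
  rewrite Rintegral_mkcondr; apply: eq_Rintegral => x _.
  by rewrite patchE indicE; case: ifP; rewrite ?mulr1 ?mulr0.
have mE : measurable_fun [set: Rn R n] (EFin \o g) by exact/measurable_EFinP.
apply: fine_le.
- apply: integrable_fin_num => //; first exact: measurableI.
  by apply: integrableS ig => //; exact: measurableI.
- exact: integrable_fin_num.
- apply: (ge0_subset_integral mu (measurableI _ _ mQ mQ0) mQ0 (measurable_funTS mE)).
    by move=> x _; rewrite lee_fin.
  exact: subIsetr.
Qed.

Lemma subcube Q (x : 'rV[R]_n) (a : 'rV[R]_n) (l l0 : R) :
  Q = [set x : 'rV[R]_n | forall i, a 0 i <= x 0 i <= a 0 i + l] ->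
  0 < l0 <= l -> Q x ->
  exists a' : 'rV[R]_n, let Q1 := [set x : 'rV[R]_n | forall i, a' 0 i <= x 0 i <= a' 0 i + l0] in
    Q1 x /\ Q1 `<=` Q.
Proof.
move=> -> /andP[l00 ll] Qx.
exists (\row_i Num.min (x 0 i) (a 0 i + l - l0)); split => [i|y Q1y i].
  rewrite mxE; have := Qx i; case: (leP (x 0 i) (a 0 i + l - l0)) => H /andP[? ?]; apply/andP; split; lra.
by have := Q1y i; have := Qx i; rewrite mxE; case: (leP (x 0 i) (a 0 i + l - l0)) => H /andP[? ?] /andP[? ?];
  apply/andP; split; lra.
Qed.

(** Joining two powers of a function rho that grows at most linearly and is
    less than one only in a bounded region. On a cube where rho does not exceed
    two the joined weight is comparable with the first power, on a cube where
    rho is at least one it is the second power. All the other cubes have a side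
    bounded from below, and there the joined weight differs from the second
    power only in the bounded region, which changes the mean of the logarithm by
    a bounded amount and the integral by a bounded amount. *)
Lemma log_A_infty_glue (rho : Rn R n -> R) (c a b : R) (Q0 : set 'rV[R]_n) :
  0 < c -> cubes Q0 -> measurable_fun [set: Rn R n] rho ->
  (forall x, 0 <= rho x) ->
  (forall (z x y : 'rV[R]_n) l, 0 < l -> (forall i, z 0 i <= x 0 i <= z 0 i + l) ->
     (forall i, z 0 i <= y 0 i <= z 0 i + l) -> rho x <= rho y + c * l) ->
  (forall x, rho x < 1 -> Q0 x) ->
  (forall Q, cubes Q -> mu.-integrable Q (EFin \o (fun x => ln (rho x)))) ->
  log_A_infty (fun x => a * ln (rho x)) -> log_A_infty (fun x => b * ln (rho x)) ->
  log_A_infty (fun x => (if rho x < 1 then a else b) * ln (rho x)).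
Proof.
move=> c0 cQ0 mrho rho0 lip far iL Aa Ab.
have [ma ia iea [Ka Ka0 HKa]] := Aa; have [mb ib ieb [Kb Kb0 HKb]] := Ab.
pose L x := ln (rho x).
pose phi x := (if rho x < 1 then a else b) * L x.
have mL : measurable_fun [set: Rn R n] L by exact: measurableT_comp.
have mphi : measurable_fun [set: Rn R n] phi.
  have -> : phi = (fun x => if rho x < 1 then a * L x else b * L x).
    by apply/funext => x; rewrite /phi; case: ifP.
  have mlt : measurable_fun [set: Rn R n] (fun x => rho x < 1) by exact: measurable_fun_ltr.
  exact: (measurable_fun_ifT mlt (measurable_funM _ _) (measurable_funM _ _)).
have mephi : measurable_fun [set: Rn R n] (expR \o phi) by exact: measurableT_comp.
have L_ge0 x : 1 <= rho x -> 0 <= L x by exact: ln_ge0.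
have L_le x M : 1 <= M -> rho x <= M -> L x <= ln M.
  move=> M1 xM; have [r0|r0] := leP (rho x) 0.
    by rewrite /L ln0// ln_ge0.
  by rewrite /L ler_ln// posrE; lra.
have iphi Q : cubes Q -> mu.-integrable Q (EFin \o phi).
  move=> cQ; have mQ := measurable_cube cQ.
  have i1 : mu.-integrable Q (EFin \o (fun x => (`|a| + `|b|) * `|L x|)).
    by apply: integrableZl_EFin => //; exact: integrable_norm (iL _ cQ).
  apply: (le_integrable mQ _ _ i1); first by apply/measurable_EFinP; exact: measurable_funTS.
  move=> x _; rewrite /= lee_fin /phi normrM [leRHS]ger0_norm ?mulr_ge0// ?addr_ge0//.
  by rewrite ler_wpM2r//; case: ifP => _; rewrite ?lerDl ?lerDr.
have iephi Q : cubes Q -> mu.-integrable Q (EFin \o (expR \o phi)).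
  move=> cQ; have mQ := measurable_cube cQ.
  have i1 := integrableD_EFin mQ (iea _ cQ) (ieb _ cQ).
  apply: (le_integrable mQ _ _ i1); first by apply/measurable_EFinP; exact: measurable_funTS.
  move=> x _; rewrite /= lee_fin !ger0_norm ?addr_ge0 ?expR_ge0//.
  by rewrite /phi; case: ifP => _; rewrite ?lerDl ?lerDr expR_ge0.
have mQ0 := measurable_cube cQ0.
(* A cube on which rho takes values below one and above two has a side at least
   1 / c, hence a volume at least V0. *)
pose l0 := c^-1; have l00 : 0 < l0 by rewrite invr_gt0.
pose V0 := l0 ^+ n; have V00 : 0 < V0 by rewrite exprn_gt0.
pose kap := `|b - a| * ln 2.
have kap0 : 0 <= kap by rewrite mulr_ge0// ln_ge0// ler1n.
have mJ : measurable_fun [set: Rn R n] (fun x => (`|a| + `|b|) * `|L x|).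
  exact: (measurable_funM (measurable_cst _) (measurableT_comp (@normr_measurable _ _) mL)).
have m1Q0 : measurable_fun [set: Rn R n] (\1_Q0 : Rn R n -> R) by exact: measurable_indic.
pose I1 := \int[mu]_(x in Q0) expR (a * L x).
pose J := (`|a| + `|b|) * \int[mu]_(x in Q0) `|L x|.
have iabsL Q : cubes Q -> mu.-integrable Q (EFin \o (fun x => `|L x|)).
  by move=> cQ; exact: integrable_norm (iL _ cQ).
have J0 : 0 <= J by rewrite mulr_ge0 ?addr_ge0// Rintegral_ge0.
have I10 : 0 <= I1 by rewrite Rintegral_ge0// => x _; exact: expR_ge0.
(* On a large cube Q, k3 bounds |Q| e^(mean of b ln rho) from below. If b >= 0
   then b ln rho is nonnegative off Q0. If b < 0 then the A_infty condition
   replaces this quantity by the integral of rho^b, which is at least its integral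
   over a subcube of side l0, on which rho is at most two. *)
pose k3 := Num.min (V0 * expR (- (J / V0))) (Kb^-1 * (expR (b * ln 2) * V0)).
have k30 : 0 < k3 by rewrite lt_min !mulr_gt0 ?expR_gt0 ?invr_gt0.
pose K := expR kap * Ka * expR kap + Kb + (Kb + I1 / k3) * expR (J / V0).
have P1 : 0 < expR kap * Ka * expR kap by rewrite !mulr_gt0 ?expR_gt0.
have P3 : 0 <= (Kb + I1 / k3) * expR (J / V0).
  by rewrite mulr_ge0 ?expR_ge0// addr_ge0 ?(ltW Kb0)// divr_ge0// ltW.
have [K1 [K2 K3]] : expR kap * Ka * expR kap <= K /\ Kb <= K /\
    (Kb + I1 / k3) * expR (J / V0) <= K.
  rewrite /K; move: P1 P3 (ltW Kb0); clear; move: (expR kap * Ka * expR kap) (_ * expR _).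
  by move=> u v u0 v0 Kb0; split; [|split]; lra.
split; [exact: mphi|exact: iphi|exact: iephi|exists K; first exact: lt_le_trans P1 K1].
move=> Q cQ; have [V_0 VE] := vol_cube cQ; have mQ := measurable_cube cQ.
rewrite -/(phi _).
set V := vol Q in V_0 VE *; set m := V^-1 * \int[mu]_(x in Q) phi x.
have weaken k : 0 <= k -> k <= K ->
    \int[mu]_(x in Q) expR (phi x) <= k * V * expR m ->
    \int[mu]_(x in Q) expR (phi x) <= K * V * expR m.
  move=> k0 kK H; apply: le_trans H _.
  by rewrite ler_wpM2r ?expR_ge0// ler_wpM2r// ltW.
have {}HKa := HKa _ cQ; have {}HKb := HKb _ cQ.
have {}iphi := iphi _ cQ; have {}iephi := iephi _ cQ.
have {}ia := ia _ cQ; have {}iea := iea _ cQ.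
have {}ib := ib _ cQ; have {}ieb := ieb _ cQ.
have [small|nsmall] := pselect (forall x, Q x -> rho x <= 2).
  (* The exponents differ only where rho lies between one and two. *)
  have cmp x : Q x -> `|phi x - a * L x| <= kap.
    move=> Qx; rewrite /phi; case: ltP => rx; first by rewrite subrr normr0.
    rewrite -mulrBl normrM ler_wpM2l// ger0_norm ?L_ge0//.
    by apply: L_le; [rewrite ler1n|exact: small].
  apply: (weaken (expR kap * Ka * expR kap)); [exact: ltW|exact: K1|].
  apply: (@le_trans _ _ (expR kap * \int[mu]_(x in Q) expR (a * L x))).
    rewrite -RintegralZl//; apply: le_Rintegral => //; first exact: integrableZl_EFin.
    move=> x Qx; rewrite -expRD ler_expR; have := cmp x Qx; rewrite ler_norml => /andP[_].
    by rewrite lerBlDr.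
  rewrite -!mulrA ler_wpM2l ?expR_ge0//; apply: le_trans HKa _.
  have KaV : 0 < Ka * V by exact: mulr_gt0.
  have -> : Ka * (expR kap * (V * expR m)) = Ka * V * expR (kap + m).
    by rewrite expRD -[RHS]mulrA; congr (_ * _); rewrite mulrCA.
  rewrite (ler_pM2l KaV) ler_expR.
  have -> : kap = V^-1 * (kap * V) by rewrite mulrCA mulVf ?mulr1// gt_eqF.
  rewrite /m -mulrDr ler_pM2l ?invr_gt0// -Rintegral_cube_cst// -RintegralD//; last exact: integrable_cube_cst.
  apply: le_Rintegral => //; first by apply: integrableD_EFin => //; exact: integrable_cube_cst.
  move=> x Qx; have := cmp x Qx; rewrite ler_norml => /andP[+ _].
  by rewrite lerBrDr addrC lerBlDl addrC.
have [large|nlarge] := pselect (forall x, Q x -> 1 <= rho x).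
  have eqb x : Q x -> phi x = b * L x.
    by move=> Qx; rewrite /phi ltNge large.
  apply: (weaken Kb); [exact: ltW|exact: K2|].
  have -> : \int[mu]_(x in Q) expR (phi x) = \int[mu]_(x in Q) expR (b * L x).
    by apply: eq_Rintegral => x; rewrite inE => Qx; rewrite eqb.
  rewrite /m; have -> // : \int[mu]_(x in Q) phi x = \int[mu]_(x in Q) (b * L x).
  by apply: eq_Rintegral => x; rewrite inE => Qx; rewrite eqb.
have [y [Qy ry]] : exists y, Q y /\ 2 < rho y.
  by move/existsNP: nsmall => [y /not_implyP[Qy /negP]]; rewrite -ltNge => ?; exists y.
have [x [Qx rx]] : exists x, Q x /\ rho x < 1.
  by move/existsNP: nlarge => [x /not_implyP[Qx /negP]]; rewrite -ltNge => ?; exists x.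
have [z [l l_0 QE]] := cQ.
have l0l : l0 <= l.
  have Qx' := Qx; have Qy' := Qy; rewrite QE in Qx' Qy'.
  have := lip z y x l l_0 Qy' Qx'; rewrite /l0 -div1r ler_pdivrMr// mulrC.
  by move: rx ry; clear; lra.
have V0V : V0 <= V.
  by rewrite /V /vol QE lebesgue_cube//= /V0; apply: lerXn2r; rewrite // nnegrE ltW.
set m2 := V^-1 * \int[mu]_(x in Q) (b * L x) in HKb.
(* The logarithms differ only on Q0, and the volume of Q is at least V0. *)
have iJQ : mu.-integrable Q (EFin \o (fun x => ((`|a| + `|b|) * `|L x|) * \1_Q0 x)).
  have i1 : mu.-integrable Q (EFin \o (fun x => (`|a| + `|b|) * `|L x|)).
    by apply: integrableZl_EFin => //; exact: iabsL.
  apply: (le_integrable mQ _ _ i1).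
    by apply/measurable_EFinP; exact: measurable_funTS (measurable_funM mJ m1Q0).
  move=> w _; rewrite /= lee_fin !normrM ler_piMr// indicE.
  by case: (w \in Q0); rewrite ?normr1// normr0.
have HJ : \int[mu]_(x in Q) (((`|a| + `|b|) * `|L x|) * \1_Q0 x) <= J.
  rewrite /J -RintegralZl//; last exact: iabsL.
  apply: (Rintegral_mul_indic_le mQ mQ0 mJ) => [w|].
    by rewrite mulr_ge0// addr_ge0.
  by apply: integrableZl_EFin => //; exact: iabsL.
have mm2 : m2 <= m + J / V0.
  apply: (@le_trans _ _ (m + V^-1 * J)); last first.
    by rewrite lerD2l mulrC ler_wpM2l// lef_pV2.
  rewrite /m2 /m -mulrDr ler_pM2l ?invr_gt0//.
  apply: le_trans (lerD (lexx _) HJ); rewrite -RintegralD//.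
  apply: le_Rintegral => //; first exact: integrableD_EFin.
  move=> w _; rewrite /phi; case: ifPn => [rw|_]; last first.
    by rewrite lerDl !mulr_ge0 ?addr_ge0// indicE.
  rewrite indicE mem_set ?mulr1; last exact: far.
  have := ler_norm (b * L w); have := ler_norm (- (a * L w)).
  rewrite normrN !normrM mulrDl; clear.
  by move: (`|a| * _) (`|b| * _) (a * _) (b * _) => u v u' v'; lra.
have lower : k3 <= V * expR m2.
  have [b0|b0] := leP 0 b.
    apply: (@le_trans _ _ (V0 * expR (- (J / V0)))); first by rewrite ge_min lexx.
    apply: (ler_pM _ _ V0V); [exact: ltW|exact: expR_ge0|rewrite ler_expR].
    apply: (@le_trans _ _ (V^-1 * - J)).
      by rewrite mulrN lerN2 mulrC ler_wpM2l// lef_pV2.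
    have Vi0 : 0 < V^-1 by rewrite invr_gt0.
    rewrite /m2 (ler_pM2l Vi0).
    have HJ' : - J <= (-1) * \int[mu]_(x in Q) (((`|a| + `|b|) * `|L x|) * \1_Q0 x).
      by rewrite mulN1r lerN2.
    apply: le_trans HJ' _; rewrite -RintegralZl//.
    apply: le_Rintegral => //; first exact: integrableZl_EFin.
    move=> w _; have [rw|rw] := ltP (rho w) 1; last first.
      apply: (@le_trans _ _ 0); last by rewrite mulr_ge0// L_ge0.
      by rewrite mulN1r oppr_le0 !mulr_ge0 ?addr_ge0// indicE.
    rewrite indicE mem_set ?mulr1; last exact: far.
    have := ler_norm (- (b * L w)); have : 0 <= `|a| * `|L w| by rewrite mulr_ge0.
    rewrite normrN !normrM mulrDl mulN1r; clear.
    by move: (`|a| * _) (`|b| * _) (b * _) => u v v'; lra.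
  apply: (@le_trans _ _ (Kb^-1 * (expR (b * ln 2) * V0))); first by rewrite ge_min lexx orbT.
  rewrite mulrC ler_pdivrMr// mulrAC [V * Kb]mulrC; apply: le_trans HKb.
  have [|a' [Q1x Q1Q]] := subcube (l0 := l0) QE _ Qx; first by rewrite l00.
  set Q1 := [set x | _] in Q1x Q1Q.
  have cQ1 : cubes Q1 by exists a'; exists l0.
  have mQ1 := measurable_cube cQ1.
  have vQ1 : vol Q1 = V0 by rewrite /vol lebesgue_cube.
  apply: (@le_trans _ _ (\int[mu]_(x in Q1) (fun=> expR (b * ln 2)) x)).
    by rewrite (Rintegral_cube_cst _ cQ1) vQ1.
  apply: (@le_trans _ _ (\int[mu]_(x in Q1) expR (b * L x))).
    apply: le_Rintegral => //; [exact: integrable_cube_cst|exact: integrableS ieb|].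
    move=> w Q1w; rewrite ler_expR ler_wnM2l ?(ltW b0)//; apply: L_le; first by rewrite ler1n.
    have := lip a' w x l0 l00 Q1w Q1x; rewrite /l0 divff ?gt_eqF//.
    by move: rx; clear; lra.
  apply: fine_le; [apply: integrable_fin_num => //; exact: integrableS ieb|exact: integrable_fin_num|].
  have meb : measurable_fun [set: Rn R n] (fun x => (expR (b * L x))%:E).
    by apply/measurable_EFinP; exact: measurableT_comp.
  apply: (ge0_subset_integral mu mQ1 mQ (measurable_funTS meb) _ Q1Q) => w _.
  by rewrite lee_fin expR_ge0.
have upper : \int[mu]_(x in Q) expR (phi x) <= \int[mu]_(x in Q) expR (b * L x) + I1.
  have mea : measurable_fun [set: Rn R n] (fun x => expR (a * L x)) by exact: measurableT_comp.
  have ie1 : mu.-integrable Q (EFin \o (fun x => expR (a * L x) * \1_Q0 x)).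
    apply: (le_integrable mQ _ _ iea).
      by apply/measurable_EFinP; exact: measurable_funTS (measurable_funM mea m1Q0).
    move=> w _; rewrite /= lee_fin normrM ler_piMr// indicE.
    by case: (w \in Q0); rewrite ?normr1// normr0.
  have := @Rintegral_mul_indic_le (fun x => expR (a * L x)) Q Q0 mQ mQ0.
  move=> /(_ mea (fun x => expR_ge0 _)) H.
  have {}H : \int[mu]_(x in Q) (expR (a * L x) * \1_Q0 x) <= I1.
    by apply: H; have [_ _ + _] := Aa; apply.
  apply: le_trans (lerD (lexx _) H); rewrite -RintegralD//.
  apply: le_Rintegral => //; first exact: integrableD_EFin.
  move=> w _; rewrite /phi; case: ifPn => [rw|_].
    by rewrite indicE mem_set ?mulr1 ?lerDr ?expR_ge0//; exact: far.
  by rewrite lerDl mulr_ge0 ?expR_ge0// indicE.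
apply: (weaken _ P3 K3).
apply: le_trans upper _.
apply: (@le_trans _ _ ((Kb + I1 / k3) * V * expR m2)).
  rewrite -mulrA mulrDl; apply: lerD; first by rewrite mulrA.
  by rewrite mulrAC ler_pdivlMr// ler_wpM2l.
have -> : (Kb + I1 / k3) * expR (J / V0) * V * expR m =
    (Kb + I1 / k3) * V * expR (m + J / V0) by rewrite expRD; ring.
rewrite ler_wpM2l ?ler_expR//; apply: mulr_ge0; last exact: ltW.
by rewrite addr_ge0 ?(ltW Kb0)// divr_ge0// ltW.
Qed.

End glue.

(** * The sums over one triadic grid *)

Section cell_weights.
Context {R : realType} {n : nat}.
Local Notation mu := (@lebesgue_rV R n : {measure set (Rn R n) -> \bar R}).
Local Notation index := (int * {ffun 'I_n -> int})%type.
Implicit Types (t : {ffun 'I_n -> bool}) (c : index) (phi psi : Rn R n -> R).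

Lemma cell_weight phi : log_A_infty phi -> exists2 eta : R, 0 < eta &
  forall t c, halving mu eta (cell t c) (expR \o phi) /\
    (0 < \int[mu]_(x in cell t c) ((expR \o phi) x)%:E < +oo)%E.
Proof.
move=> Aphi; have [eta eta0 H] := log_A_infty_halving Aphi; exists eta => // t c.
have [mphi _ ie _] := Aphi.
have mephi : measurable_fun [set: Rn R n] (EFin \o (expR \o phi)).
  by apply/measurable_EFinP; exact: measurableT_comp.
have [Q [cQ sub EQ]] := @cell_sub_cube R n t c.
have mQ := measurable_cube cQ; have mc := @measurable_cell R n t c.
have leQ : (\int[mu]_(x in cell t c) ((expR \o phi) x)%:E <=
    \int[mu]_(x in Q) ((expR \o phi) x)%:E)%E.
  apply: (ge0_subset_integral mu mc mQ (measurable_funTS mephi) _ sub) => x _.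
  by rewrite lee_fin expR_ge0.
have IE : (\int[mu]_(x in Q) ((expR \o phi) x)%:E)%E =
    (\int[mu]_(x in Q) expR (phi x))%:E.
  by rewrite fineK//; exact: integrable_fin_num (ie _ cQ).
have halfQ B : measurable B -> B `<=` cell t c -> (mu (cell t c) <= 2%:E * mu B)%E ->
    (eta%:E * \int[mu]_(x in Q) ((expR \o phi) x)%:E <= \int[mu]_(x in B) ((expR \o phi) x)%:E)%E.
  by move=> mB Bc half; apply: H => //; [exact: subset_trans sub|rewrite EQ].
split=> [B mB Bc half|].
  by apply: le_trans (halfQ B mB Bc half); rewrite lee_wpmul2l// lee_fin ltW.
apply/andP; split; last by rewrite (le_lt_trans leQ)// IE ltry.
apply: (@lt_le_trans _ _ (eta%:E * \int[mu]_(x in Q) ((expR \o phi) x)%:E)%E).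
  by rewrite IE -EFinM lte_fin mulr_gt0//; exact: Rintegral_expR_gt0.
apply: halfQ => //; rewrite lebesgue_cell -EFinM lee_fin.
by rewrite ler_peMl ?exprn_ge0 ?(ltW (side_gt0 _))//; lra.
Qed.

(** Since 1/q + 1/p' = 1 - alpha/n, multiplying the two-weight condition by
    side^alpha makes the two sides homogeneous. *)
Lemma cell_two_weight phi psi (alpha p q : R) : (0 < n)%N ->
  0 < q -> 1 < p -> q^-1 = p^-1 - alpha / n%:R ->
  log_A_infty phi -> log_A_infty psi ->
  (forall x, q^-1 * phi x + (1 - p^-1) * psi x <= 0) ->
  exists2 K : R, 0 < K & forall t c,
    side c.1 `^ alpha *
    (fine (\int[mu]_(x in cell t c) ((expR \o phi) x)%:E) `^ q^-1 *
     fine (\int[mu]_(x in cell t c) ((expR \o psi) x)%:E) `^ (1 - p^-1)) <=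
    K * fine (mu (cell t c)).
Proof.
move=> n0 q0 p1 qE Aphi Apsi le0.
have qi0 : 0 < q^-1 by rewrite invr_gt0.
have pi0 : 0 < 1 - p^-1 by rewrite subr_gt0 invf_lt1//; lra.
have [K K0 H] := two_weight_condition qi0 pi0 Aphi Apsi le0.
exists K => // t c; have [Q [cQ sub EQ]] := @cell_sub_cube R n t c.
have mQ := measurable_cube cQ; have mc := @measurable_cell R n t c.
have le chi : log_A_infty chi ->
    fine (\int[mu]_(x in cell t c) ((expR \o chi) x)%:E) <= \int[mu]_(x in Q) expR (chi x).
  move=> [mchi _ ie _]; apply: fine_le.
  - by apply: integrable_fin_num => //; exact: integrableS (ie _ cQ).
  - exact: integrable_fin_num (ie _ cQ).
  - have mechi : measurable_fun [set: Rn R n] (fun x => (expR (chi x))%:E).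
      by apply/measurable_EFinP; exact: measurableT_comp.
    apply: (ge0_subset_integral mu mc mQ (measurable_funTS mechi) _ sub) => x _.
    by rewrite lee_fin expR_ge0.
have ge0 chi : 0 <= fine (\int[mu]_(x in cell t c) ((expR \o chi) x)%:E).
  by apply/fine_ge0/integral_ge0 => x _; rewrite lee_fin expR_ge0.
have VE : vol Q = side c.1 ^+ n by rewrite /vol EQ lebesgue_cell.
have s0 : 0 < side c.1 :> R by exact: side_gt0.
rewrite lebesgue_cell/=.
apply: (@le_trans _ _ (side c.1 `^ alpha * (K * vol Q `^ (q^-1 + (1 - p^-1))))).
  rewrite ler_wpM2l ?powR_ge0//; apply: le_trans (H _ cQ).
  apply: ler_pM; [exact: powR_ge0|exact: powR_ge0| |].
    exact: le_powR2r (ltW qi0) (ge0 phi) (le phi Aphi).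
  exact: le_powR2r (ltW pi0) (ge0 psi) (le psi Apsi).
rewrite mulrCA ler_wpM2l ?(ltW K0)// VE -powR_mulrn ?(ltW s0)// -powRrM -powRD; last first.
  by rewrite (gt_eqF s0) implybT.
have -> : alpha + n%:R * (q^-1 + (1 - p^-1)) = n%:R; last by [].
by rewrite qE; move: (p^-1) => r; field; rewrite pnatr_eq0 -lt0n n0.
Qed.

End cell_weights.

Section triadic_sum.
Context {R : realType} {n : nat}.
Local Notation mu := (@lebesgue_rV R n : {measure set (Rn R n) -> \bar R}).
Local Notation index := (int * {ffun 'I_n -> int})%type.
Variables (alpha : R).
Implicit Types (t : {ffun 'I_n -> bool}) (c : index) (f : Rn R n -> \bar R).

Definition triadic_term t f c (x : Rn R n) : \bar R :=
  ((side c.1 `^ (alpha - n%:R) * \1_(cell t c) x)%:E * \int[mu]_(y in cell t c) f y)%E.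

(** The cells of one grid are enumerated through the countability of their
    indices; numbers that do not encode an index contribute zero. *)
Definition triadic_sum t f (x : Rn R n) : \bar R :=
  (\sum_(k <oo) oapp (fun c => triadic_term t f c x) 0 (pickle_inv k))%E.

Lemma triadic_term_ge0 t f c x : (forall x, 0 <= f x)%E -> (0 <= triadic_term t f c x)%E.
Proof.
move=> f0; rewrite mule_ge0 ?integral_ge0// lee_fin mulr_ge0 ?powR_ge0//.
Qed.

Lemma oterm_ge0 t f k x : (forall x, 0 <= f x)%E ->
  (0 <= oapp (fun c => triadic_term t f c x) 0 (pickle_inv k))%E.
Proof. by move=> f0; case: (pickle_inv k) => //= c; exact: triadic_term_ge0. Qed.

Lemma measurable_oterm t f k :
  measurable_fun [set: Rn R n]
    (fun x => oapp (fun c => triadic_term t f c x) 0 (pickle_inv k))%E.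
Proof.
case: (pickle_inv k) => [c|] /=; last exact: measurable_cst.
have m1 : measurable_fun [set: Rn R n] (\1_(cell t c) : Rn R n -> R).
  exact: measurable_indic (measurable_cell t c).
have m2 : measurable_fun [set: Rn R n]
    (fun x : Rn R n => (side c.1 `^ (alpha - n%:R) * \1_(cell t c) x)%:E).
  by apply/measurable_EFinP; exact: measurable_funM (measurable_cst _) m1.
exact: emeasurable_funM m2 (measurable_cst _).
Qed.

Lemma measurable_triadic_sum t f : (forall x, 0 <= f x)%E ->
  measurable_fun [set: Rn R n] (triadic_sum t f).
Proof.
move=> f0; apply: ge0_emeasurable_sum; first by move=> k x _ _; exact: oterm_ge0.
by move=> k _; exact: measurable_oterm.
Qed.

(** The finitely many cells enumerated so far become an ordered laminar family
    once they are sorted by decreasing side. *)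
Lemma triadic_finite_bound (phi psi : Rn R n -> R) (p q : R) : (0 < n)%N ->
  0 < alpha -> 1 < p -> p < q -> q^-1 = p^-1 - alpha / n%:R ->
  log_A_infty phi -> log_A_infty psi ->
  (forall x, q^-1 * phi x + (1 - p^-1) * psi x <= 0) ->
  exists2 C : R, 0 < C & forall t f (N : nat),
    measurable_fun [set: Rn R n] f -> (forall x, 0 <= f x)%E ->
    (\int[mu]_x (f x `^ p * ((expR (psi x)) `^ (1 - p))%:E) < +oo)%E ->
    (\int[mu]_x ((\sum_(0 <= k < N) oapp (fun c => triadic_term t f c x) 0 (pickle_inv k))
                  `^ q * (expR (phi x))%:E) <=
     C%:E * (\int[mu]_x (f x `^ p * ((expR (psi x)) `^ (1 - p))%:E)) `^ (q / p))%E.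
Proof.
move=> n0 alpha0 p1 pq qE Aphi Apsi le0; have q0 : 0 < q by lra.
have [eta1 eta10 H1] := cell_weight Aphi; have [eta2 eta20 H2] := cell_weight Apsi.
have [K K0 HK] := cell_two_weight n0 q0 p1 qE Aphi Apsi le0.
pose eta := Num.min eta1 eta2; have eta0 : 0 < eta by rewrite lt_min eta10.
pose C1 : R := (1 - 3 `^ (- alpha))^-1.
have C10 : 0 < C1.
  rewrite invr_gt0 subr_gt0 /powR pnatr_eq0/= -[ltRHS]expR0 ltr_expR mulNr oppr_lt0.
  by rewrite mulr_gt0// ln_gt0//; lra.
have [C C0 HC] := discrete_fractional_le mu p1 pq eta0 C10 K0.
exists C => // t f N mf f0 Foo.
pose s := sort coarser (pmap (@pickle_inv index) (iota 0 N)).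
have us : uniq s.
  rewrite sort_uniq (pmap_uniq (g := @pickle index))//; last exact: iota_uniq.
  exact: (@pickle_invK index).
have ss : sorted coarser s by apply: sort_sorted; exact: coarser_total.
pose c i := nth (0, [ffun=> 0]) s i.
have [mphi _ _ _] := Aphi; have [mpsi _ _ _] := Apsi.
have mu_ : measurable_fun [set: Rn R n] (expR \o phi) by exact: measurableT_comp.
have ms_ : measurable_fun [set: Rn R n] (expR \o psi) by exact: measurableT_comp.
have halv w (e : R) c' : eta <= e -> halving mu e (cell t c') w -> (forall x, 0 < w x) ->
    halving mu eta (cell t c') w.
  move=> ee hw w0 B mB Bc half; apply: le_trans (hw B mB Bc half).
  rewrite lee_wpmul2r ?lee_fin// integral_ge0// => x _.
  by rewrite lee_fin ltW.
have cfin c' : (\int[mu]_(x in cell t c') f x)%E \is a fin_num.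
  have [_ /andP[_ soo]] := H2 t c'.
  rewrite ge0_fin_numE ?integral_ge0//.
  exact: (weighted_integral_lty p1 (measurable_cell t c') ms_ (fun x => expR_gt0 _) soo mf f0 Foo).
have mQ i : measurable (cell t (c i) : set (Rn R n)) by exact: measurable_cell.
have lamQ : laminar (size s) (fun i => cell t (c i) : set (Rn R n)) by exact: laminar_cells.
have Qfin i : (i < size s)%N -> (0 < mu (cell t (c i)) < +oo)%E.
  by move=> _; rewrite lebesgue_cell lte_fin exprn_gt0 ?side_gt0// ltry.
have ufin i : (i < size s)%N -> (0 < \int[mu]_(x in cell t (c i)) ((expR \o phi) x)%:E < +oo)%E.
  by move=> _; have [] := H1 t (c i).
have sfin i : (i < size s)%N -> (0 < \int[mu]_(x in cell t (c i)) ((expR \o psi) x)%:E < +oo)%E.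
  by move=> _; have [] := H2 t (c i).
have hu i : (i < size s)%N -> halving mu eta (cell t (c i)) (expR \o phi).
  move=> _; have [h _] := H1 t (c i); apply: halv h _; first by rewrite ge_min lexx.
  by move=> x; exact: expR_gt0.
have hs i : (i < size s)%N -> halving mu eta (cell t (c i)) (expR \o psi).
  move=> _; have [h _] := H2 t (c i); apply: halv h _; first by rewrite ge_min lexx orbT.
  by move=> x; exact: expR_gt0.
have pack (x : Rn R n) i : (i < size s)%N -> cell t (c i) x ->
    \sum_(j < size s | (i <= j)%N) side (c j).1 `^ alpha * \1_(cell t (c j)) x <=
    C1 * side (c i).1 `^ alpha.
  exact: cells_packing.
have := HC (size s) _ (fun i => side (c i).1 `^ alpha) _ _ f mQ lamQ Qfin mu_
  (fun x => expR_gt0 _) ms_ (fun x => expR_gt0 _) ufin sfin hu hs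
  (fun i => powR_ge0 _ _) pack (fun i _ => HK t (c i)) mf f0 Foo.
apply: le_trans.
rewrite le_eqVlt; apply/orP; left; apply/eqP; apply: eq_integral => x _; congr (_ * _)%E.
rewrite -poweR_EFin; congr (_ `^ _)%E.
rewrite /index_iota subn0.
transitivity (\sum_(c' <- s) triadic_term t f c' x)%E.
  rewrite (perm_big (pmap (@pickle_inv index) (iota 0 N))); last by rewrite perm_sort.
  by rewrite big_pmap.
rewrite (big_nth (0, [ffun=> 0])) big_mkord -sumEFin; apply: eq_bigr => i _.
rewrite /triadic_term -/(c i) -[X in (_ * X)%E](fineK (cfin _)) -EFinM lebesgue_cell/=.
have s0 : 0 < side (c i).1 :> R by exact: side_gt0.
congr EFin; rewrite powRB ?powR_mulrn ?(ltW s0)//; last by rewrite (gt_eqF s0) implybT.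
by field; rewrite gt_eqF// exprn_gt0.
Qed.

Lemma triadic_bound (phi psi : Rn R n -> R) (p q : R) : (0 < n)%N ->
  0 < alpha -> 1 < p -> p < q -> q^-1 = p^-1 - alpha / n%:R ->
  log_A_infty phi -> log_A_infty psi ->
  (forall x, q^-1 * phi x + (1 - p^-1) * psi x <= 0) ->
  exists2 C : R, 0 < C & forall t f,
    measurable_fun [set: Rn R n] f -> (forall x, 0 <= f x)%E ->
    (\int[mu]_x (f x `^ p * ((expR (psi x)) `^ (1 - p))%:E) < +oo)%E ->
    (\int[mu]_x (triadic_sum t f x `^ q * (expR (phi x))%:E) <=
     C%:E * (\int[mu]_x (f x `^ p * ((expR (psi x)) `^ (1 - p))%:E)) `^ (q / p))%E.
Proof.
move=> n0 alpha0 p1 pq qE Aphi Apsi le0; have q0 : 0 < q by lra.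
have [C C0 HC] := triadic_finite_bound n0 alpha0 p1 pq qE Aphi Apsi le0.
exists C => // t f mf f0 Foo.
have [mphi _ _ _] := Aphi.
pose S N x := (\sum_(0 <= k < N) oapp (fun c => triadic_term t f c x) 0 (pickle_inv k))%E.
pose g N x := (S N x `^ q * (expR (phi x))%:E)%E.
have S0 N x : (0 <= S N x)%E by apply: sume_ge0 => k _; exact: oterm_ge0.
have Snd x : {homo (S^~ x) : a b / (a <= b)%N >-> (a <= b)%E}.
  by apply: ereal_nondecreasing_series => k _ _; exact: oterm_ge0.
have mS N : measurable_fun [set: Rn R n] (S N).
  by apply: emeasurable_sum => k; exact: measurable_oterm.
have me : measurable_fun [set: Rn R n] (fun x => (expR (phi x))%:E).
  by apply/measurable_EFinP; exact: measurableT_comp.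
have mg N : measurable_fun [set: Rn R n] (g N).
  exact: (emeasurable_funM (measurableT_comp (measurable_poweR _) (mS N)) me).
have g0 N x : (0 <= g N x)%E by rewrite mule_ge0 ?poweR_ge0// lee_fin expR_ge0.
have gnd x : {homo (g^~ x) : a b / (a <= b)%N >-> (a <= b)%E}.
  move=> a b ab; rewrite /g lee_wpmul2r ?lee_fin ?expR_ge0//.
  by apply: le_poweR2r => //; [exact: ltW|exact: Snd].
apply: (@le_trans _ _ (\int[mu]_x limn (g^~ x))%E).
  have m1 : measurable_fun [set: Rn R n] (fun x => triadic_sum t f x `^ q * (expR (phi x))%:E)%E.
    exact: (emeasurable_funM (measurableT_comp (measurable_poweR _) (measurable_triadic_sum t f0)) me).
  have m2 : measurable_fun [set: Rn R n] (fun x => limn (g^~ x)).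
    apply: (@emeasurable_fun_cvg _ _ _ _ g (fun x => limn (g^~ x)) mg) => x _.
    by apply: ereal_nondecreasing_is_cvgn; exact: gnd.
  apply: (ge0_le_integral mu measurableT _ m1 m2).
    by move=> x _; rewrite mule_ge0 ?poweR_ge0// lee_fin expR_ge0.
  move=> x _; set l := limn (g^~ x).
  have gl N : (g N x <= l)%E.
    rewrite /l (cvg_lim _ (ereal_nondecreasing_cvgn (gnd x)))//.
    by apply: ereal_sup_ubound; exists N.
  have e0 := expR_gt0 (phi x).
  have l0 : (0 <= l * (expR (phi x))^-1%:E)%E.
    apply: mule_ge0; first exact: le_trans (g0 0%N x) (gl 0%N).
    by rewrite lee_fin invr_ge0 ltW.
  (* The q-th power is removed before taking the limit of the partial sums, so
     that only its monotonicity is used. *)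
  rewrite -lee_pdivlMr//.
  have -> : (l * (expR (phi x))^-1%:E = ((l * (expR (phi x))^-1%:E) `^ q^-1) `^ q)%E.
    by rewrite -poweRrM mulVf ?gt_eqF// poweRe1.
  apply: le_poweR2r; [exact: ltW|by apply: nneseries_ge0 => k _ _; exact: oterm_ge0|].
  rewrite /triadic_sum (cvg_lim _ (ereal_nondecreasing_cvgn (Snd x)))//.
  apply: ge_ereal_sup => _ [N _ <-].
  have -> : S N x = ((S N x `^ q) `^ q^-1)%E.
    by rewrite -poweRrM divff ?gt_eqF// poweRe1.
  apply: le_poweR2r; [by rewrite invr_ge0 ltW|exact: poweR_ge0|].
  by rewrite lee_pdivlMr//; exact: gl.
rewrite (monotone_convergence mu measurableT mg (fun k x _ => g0 k x) (fun x _ => gnd x)).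
have Ind : {homo (fun N => \int[mu]_x g N x)%E : a b / (a <= b)%N >-> (a <= b)%E}.
  move=> a b ab.
  by apply: (ge0_le_integral mu measurableT _ (mg a) (mg b)) => x _; [exact: g0|exact: gnd].
rewrite (cvg_lim _ (ereal_nondecreasing_cvgn Ind))//.
by apply: ge_ereal_sup => _ [N _ <-]; exact: HC.
Qed.

End triadic_sum.

(** * From the Riesz kernel to triadic sums *)

Section nonmeasurable_monotony.
Context d (T : measurableType d) (R : realType) (mu : {measure set T -> \bar R}).

(** The integral of a nonnegative function being a supremum over the simple
    functions below it, no measurability is involved. *)
Lemma ge0_le_integral_sup (D : set T) (f g : T -> \bar R) :
  (forall x, D x -> 0 <= f x)%E -> (forall x, D x -> f x <= g x)%E ->
  (\int[mu]_(x in D) f x <= \int[mu]_(x in D) g x)%E.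
Proof.
move=> f0 fg; rewrite !ge0_integralE//; last first.
  by move=> x Dx; apply: le_trans (fg x Dx); exact: f0.
apply: ereal_sup_le => _ [h hf <-]; exists h => // x.
apply: le_trans (hf x) _; rewrite !patchE; case: ifPn => // xD.
by apply: fg; rewrite inE in xD.
Qed.

(** Both the positive and the negative part are below h, which covers also the
    case in which the integral of g is an indeterminate difference. *)
Lemma abse_integral_le_dom (g h : T -> \bar R) :
  (forall x, `|g x| <= h x)%E -> (`|\int[mu]_x g x| <= \int[mu]_x h x)%E.
Proof.
move=> gh.
have Hp : (\int[mu]_x g^\+ x <= \int[mu]_x h x)%E.
  apply: ge0_le_integral_sup => x _; first exact: funepos_ge0.
  by apply: le_trans (gh x); rewrite funeposE ge_max lee_abs abse_ge0.
have Hn : (\int[mu]_x g^\- x <= \int[mu]_x h x)%E.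
  apply: ge0_le_integral_sup => x _; first exact: funeneg_ge0.
  by apply: le_trans (gh x); rewrite funenegE ge_max -abseN lee_abs abse_ge0.
have p0 : (0 <= \int[mu]_x g^\+ x)%E by apply: integral_ge0 => x _; exact: funepos_ge0.
have n0 : (0 <= \int[mu]_x g^\- x)%E by apply: integral_ge0 => x _; exact: funeneg_ge0.
rewrite integralE; move: Hp Hn p0 n0.
case: (\int[mu]_x h x)%E (\int[mu]_x g^\+ x)%E (\int[mu]_x g^\- x)%E => [c| |] [a| |] [b| |]//;
  rewrite ?leey// !lee_fin => ac bc a0 b0.
by rewrite ler_norml; apply/andP; split; lra.
Qed.

End nonmeasurable_monotony.

(** The factor may be infinite, and a vanishing series must then be set apart. *)
Lemma nneseries_mulr_le (R : realType) (u : nat -> \bar R) (a : \bar R) :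
  (forall k, 0 <= u k)%E -> (0 <= a)%E ->
  ((\sum_(k <oo) u k) * a <= \sum_(k <oo) (u k * a))%E.
Proof.
move=> u0; case: a => [a| |]// a0.
  rewrite muleC -nneseriesZl; last by move=> k _; exact: u0.
  by rewrite le_eqVlt; apply/orP; left; apply/eqP/eq_eseriesr => k _; rewrite muleC.
have ua0 k : (0 <= u k * +oo)%E by rewrite mule_ge0.
have [allz|/existsNP[k uk]] := pselect (forall k, u k = 0%E).
  rewrite eseries0; last by move=> k _ _.
  by rewrite mul0e nneseries_ge0.
have ukp : (0 < u k)%E by rewrite lt_neqAle u0 andbT eq_sym; apply/eqP.
apply: (@le_trans _ _ +oo%E); first exact: leey.
have := @nneseries_lim_ge R (fun k => u k * +oo)%E xpredT 0 k.+1 (fun k _ _ => ua0 k).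
apply: le_trans; rewrite big_nat_recr//= gt0_muley// addey// -ltNye.
by apply: lt_le_trans (_ : 0 <= _)%E => //; apply: sume_ge0.
Qed.

Section euclidean_norm.
Context {R : realType} {n : nat}.
Implicit Types x y z : 'rV[R]_n.

Lemma enorm_ge0 x : 0 <= enorm x.
Proof. exact: sqrtr_ge0. Qed.

Lemma sqr_enorm x : enorm x ^+ 2 = \sum_(i < n) x 0 i ^+ 2.
Proof. by rewrite sqr_sqrtr// sumr_ge0// => i _; rewrite sqr_ge0. Qed.

Lemma norm_coord_le_enorm x i : `|x 0 i| <= enorm x.
Proof.
rewrite -ler_sqr ?nnegrE ?enorm_ge0// sqr_enorm real_normK ?num_real//.
by rewrite (bigD1 i)//= lerDl sumr_ge0// => j _; rewrite sqr_ge0.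
Qed.

Lemma enorm_eq0 x : enorm x = 0 -> x = 0.
Proof.
move=> x0; apply/rowP => i; rewrite mxE; apply/eqP.
by rewrite -normr_le0 -x0; exact: norm_coord_le_enorm.
Qed.

Lemma enorm_le_coord x (l : R) : 0 <= l -> (forall i, `|x 0 i| <= l) -> enorm x <= n%:R * l.
Proof.
move=> l0 xl; have nl0 : 0 <= n%:R * l by rewrite mulr_ge0.
rewrite -ler_sqr ?nnegrE ?enorm_ge0// sqr_enorm.
apply: (@le_trans _ _ (\sum_(i < n) l ^+ 2)).
  apply: ler_sum => i _; rewrite -[X in X ^+ 2 <= _]/(x 0 i).
  by rewrite -real_normK ?num_real// ler_sqr ?nnegrE.
rewrite sumr_const card_ord -[leLHS]mulr_natl exprMn ler_wpM2r ?sqr_ge0//.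
have [->|n0] := posnP n; first by rewrite expr0n.
by rewrite expr2 ler_peMl// ler1n.
Qed.

(** Cauchy-Schwarz, from a b <= (t/s a^2 + s/t b^2) / 2 for the norms s, t. *)
Lemma dot_le_enorm x y : \sum_(i < n) x 0 i * y 0 i <= enorm x * enorm y.
Proof.
have [x0|xn0] := eqVneq (enorm x) 0.
  by rewrite x0 mul0r (enorm_eq0 x0) big1// => i _; rewrite mxE mul0r.
have [y0|yn0] := eqVneq (enorm y) 0.
  by rewrite y0 mulr0 (enorm_eq0 y0) big1// => i _; rewrite mxE mulr0.
have sp : 0 < enorm x by rewrite lt_neqAle eq_sym xn0 enorm_ge0.
have tp : 0 < enorm y by rewrite lt_neqAle eq_sym yn0 enorm_ge0.
set s := enorm x in sp xn0 *; set t := enorm y in tp yn0 *.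
apply: (@le_trans _ _ (\sum_(i < n) ((t / s) / 2 * x 0 i ^+ 2 + (s / t) / 2 * y 0 i ^+ 2))).
  apply: ler_sum => i _; rewrite -subr_ge0.
  have -> : t / s / 2 * x 0 i ^+ 2 + s / t / 2 * y 0 i ^+ 2 - x 0 i * y 0 i =
    (t * x 0 i - s * y 0 i) ^+ 2 / (2 * s * t) by field; rewrite xn0 yn0.
  by rewrite divr_ge0 ?sqr_ge0// !mulr_ge0// ltW.
rewrite big_split/= -!mulr_sumr -!sqr_enorm -/s -/t le_eqVlt; apply/orP; left; apply/eqP.
by field; rewrite xn0 yn0.
Qed.

Lemma enormD x y : enorm (x + y) <= enorm x + enorm y.
Proof.
rewrite -ler_sqr ?nnegrE ?addr_ge0 ?enorm_ge0// sqr_enorm sqrrD.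
have -> : \sum_(i < n) (x + y) 0 i ^+ 2 =
    enorm x ^+ 2 + (\sum_(i < n) x 0 i * y 0 i) *+ 2 + enorm y ^+ 2.
  rewrite !sqr_enorm -sumrMnl -!big_split/=; apply: eq_bigr => i _.
  by rewrite mxE sqrrD.
by rewrite lerD2r lerD2l lerMn2r/= dot_le_enorm.
Qed.

End euclidean_norm.

Section kernel.
Context {R : realType} {n : nat}.
Local Notation mu := (@lebesgue_rV R n : {measure set (Rn R n) -> \bar R}).
Local Notation index := (int * {ffun 'I_n -> int})%type.
Variables (alpha : R).
Hypothesis alphan : alpha < n%:R.
Implicit Types (t : {ffun 'I_n -> bool}) (c : index) (x y : Rn R n).

Definition kernel_term t c x y : \bar R :=
  ((side c.1 `^ (alpha - n%:R) * \1_(cell t c) x)%:E * (\1_(cell t c) y)%:E)%E.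

Definition triadic_kernel t x y : \bar R :=
  (\sum_(k <oo) oapp (fun c => kernel_term t c x y) 0 (pickle_inv k))%E.

Lemma kernel_term_ge0 t c x y : (0 <= kernel_term t c x y)%E.
Proof. by rewrite mule_ge0// lee_fin ?mulr_ge0 ?powR_ge0// indicE. Qed.

Lemma okernel_ge0 t k x y :
  (0 <= oapp (fun c => kernel_term t c x y) 0 (pickle_inv k))%E.
Proof. by case: (pickle_inv k) => //= c; exact: kernel_term_ge0. Qed.

Lemma triadic_kernel_ge0 t x y : (0 <= triadic_kernel t x y)%E.
Proof. by apply: nneseries_ge0 => k _ _; exact: okernel_ge0. Qed.

Lemma triadic_kernel_ge t j x y :
  (forall i, slot (t i) j (x 0 i) = slot (t i) j (y 0 i)) ->
  ((side j `^ (alpha - n%:R))%:E <= triadic_kernel t x y)%E.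
Proof.
move=> H; pose c : index := (j, [ffun i => slot (t i) j (x 0 i)]).
have cx : cell t c x by move=> i /=; rewrite ffunE.
have cy : cell t c y by move=> i /=; rewrite ffunE H.
have := @nneseries_lim_ge R (fun k => oapp (fun c => kernel_term t c x y) 0 (pickle_inv k))%E
  xpredT 0 (pickle c).+1 (fun k _ _ => okernel_ge0 t k x y).
apply: le_trans; rewrite big_nat_recr//= pickleK_inv/=.
rewrite /kernel_term/= !indicE !mem_set// mulr1 mule1 leeDr// sume_ge0// => k _.
exact: okernel_ge0.
Qed.

(** The grid is chosen separately in each coordinate. *)
Lemma common_cell j x y : (forall i, `|x 0 i - y 0 i| < side j / 2) ->
  exists t, forall i, slot (t i) j (x 0 i) = slot (t i) j (y 0 i).
Proof.
move=> H; exists [ffun i => slot false j (x 0 i) != slot false j (y 0 i)] => i.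
rewrite ffunE; case: eqP => //= ne.
by have [[]] := slot_close (H i).
Qed.

(** For x <> y there is a power of three comparable with |x - y| and a cell of
    that side that contains both points; its term is comparable with the kernel.
    For x = y the kernel is infinite, and so is the sum over the arbitrarily
    small cells that contain x. *)
Lemma riesz_kernel_le x y :
  ((enorm (x - y) `^ (n%:R - alpha))%:E^-1 <=
   (6 `^ (n%:R - alpha))%:E * \sum_(t : {ffun 'I_n -> bool}) triadic_kernel t x y)%E.
Proof.
have na : 0 < n%:R - alpha by rewrite subr_gt0.
have nan : n%:R - alpha != 0 by rewrite gt_eqF.
have kge t : (triadic_kernel t x y <= \sum_(t : {ffun 'I_n -> bool}) triadic_kernel t x y)%E.
  by rewrite (bigD1 t)//= leeDl// sume_ge0// => t' _; exact: triadic_kernel_ge0.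
have [N0|N0] := eqVneq (enorm (x - y)) 0.
  have xy : x = y by apply/eqP; rewrite -subr_eq0; apply/eqP/enorm_eq0.
  suff -> : (\sum_(t : {ffun 'I_n -> bool}) triadic_kernel t x y = +oo)%E.
    by rewrite gt0_muley ?lte_fin ?powR_gt0// leey.
  apply/eqyP => A A0; apply: le_trans (kge [ffun=> false]).
  have [j Aj] := side_unbounded A na.
  rewrite opprB in Aj; apply: (@le_trans _ _ (side j `^ (alpha - n%:R))%:E); first by rewrite lee_fin.
  by apply: triadic_kernel_ge => i; rewrite xy.
have Np : 0 < enorm (x - y) by rewrite lt_neqAle eq_sym N0 enorm_ge0.
have [j [Nj jN]] := side_approx Np.
have [|t tE] := @common_cell j x y.
  move=> i; apply: le_lt_trans Nj; have := norm_coord_le_enorm (x - y) i.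
  by rewrite !mxE.
apply: (@le_trans _ _ ((6 `^ (n%:R - alpha))%:E * (side j `^ (alpha - n%:R))%:E)%E); last first.
  rewrite lee_wpmul2l ?lee_fin ?powR_ge0//; apply: le_trans (kge t).
  exact: triadic_kernel_ge.
have e0 : enorm (x - y) `^ (n%:R - alpha) != 0 by rewrite gt_eqF// powR_gt0.
rewrite inver (negbTE e0) -EFinM lee_fin.
have -> : alpha - n%:R = - (n%:R - alpha) by rewrite opprB.
rewrite powRN ler_pdivlMr ?powR_gt0 ?side_gt0// ler_pdivrMl ?powR_gt0//.
rewrite mulrC -powRM ?enorm_ge0//.
exact: le_powR2r (ltW na) (ltW (side_gt0 j)) jN.
Qed.

Lemma abse_fractional_integral_le (f : Rn R n -> \bar R) x :
  measurable_fun [set: Rn R n] f ->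
  (`|fractional_integral alpha f x| <= (6 `^ (n%:R - alpha))%:E *
     \sum_(t : {ffun 'I_n -> bool}) triadic_sum alpha t (fun y => `|f y|) x)%E.
Proof.
move=> mf.
have C0 : 0 <= (6 : R) `^ (n%:R - alpha) by exact: powR_ge0.
have mf' : measurable_fun [set: Rn R n] (fun y => `|f y|)%E by exact: measurableT_comp.
have f0 y : (0 <= `|f y|)%E by exact: abse_ge0.
pose kf t k y := (oapp (fun c => kernel_term t c x y) 0 (pickle_inv k) * `|f y|)%E.
have kf0 t k y : (0 <= kf t k y)%E by apply: mule_ge0 => //; exact: okernel_ge0.
have mkf t k : measurable_fun [set: Rn R n] (kf t k).
  apply: (emeasurable_funM _ mf'); case: (pickle_inv k) => [c|] /=; last exact: measurable_cst.
  apply: (emeasurable_funM (measurable_cst _)); apply/measurable_EFinP.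
  exact: measurable_indic (measurable_cell t c).
have mskf t : measurable_fun [set: Rn R n] (fun y => \sum_(k <oo) kf t k y)%E.
  by apply: ge0_emeasurable_sum => [k y _ _|k _]; [exact: kf0|exact: mkf].
have s0 t y : (0 <= \sum_(k <oo) kf t k y)%E by apply: nneseries_ge0 => k _ _; exact: kf0.
have -> : ((6 `^ (n%:R - alpha))%:E * \sum_(t : {ffun 'I_n -> bool})
      triadic_sum alpha t (fun y => `|f y|) x =
    \int[mu]_y ((6 `^ (n%:R - alpha))%:E *
      \sum_(t : {ffun 'I_n -> bool}) \sum_(k <oo) kf t k y))%E.
  have mS : measurable_fun [set: Rn R n]
      (fun y => \sum_(t : {ffun 'I_n -> bool}) \sum_(k <oo) kf t k y)%E.
    by apply: emeasurable_sum => t; exact: mskf.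
  rewrite (ge0_integralZl_EFin mu measurableT _ mS C0); last first.
    by move=> y _; apply: sume_ge0 => t _; exact: s0.
  congr (_ * _)%E; rewrite (ge0_integral_sum mu measurableT mskf); last by move=> t y _; exact: s0.
  apply: eq_bigr => t _.
  rewrite (integral_nneseries mu measurableT (mkf t)); last by move=> k y _; exact: kf0.
  apply: eq_eseriesr => k _; rewrite /kf; case: (pickle_inv k) => [c|] /=; last first.
    by apply: esym; under eq_integral do rewrite mul0e; rewrite integral0.
  rewrite /triadic_term.
  have mI : measurable_fun [set: Rn R n] (fun y => (\1_(cell t c) y)%:E * `|f y|)%E.
    apply: emeasurable_funM mf'; apply/measurable_EFinP.
    exact: measurable_indic (measurable_cell t c).
  have r0 : 0 <= side c.1 `^ (alpha - n%:R) * \1_(cell t c) x.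
    by rewrite mulr_ge0 ?powR_ge0// indicE.
  apply: esym; transitivity (\int[mu]_y ((side c.1 `^ (alpha - n%:R) * \1_(cell t c) x)%:E *
      ((\1_(cell t c) y)%:E * `|f y|)))%E.
    by apply: eq_integral => y _; rewrite /kernel_term muleA.
  rewrite (ge0_integralZl_EFin mu measurableT _ mI r0); last first.
    by move=> y _; rewrite mule_ge0// lee_fin indicE.
  congr (_ * _)%E; rewrite [RHS]integral_mkcond; apply: eq_integral => y _.
  by rewrite patchE indicE; case: (y \in cell t c); rewrite ?mul1e ?mul0e.
apply: abse_integral_le_dom => y.
have le1 : ((\sum_(t : {ffun 'I_n -> bool}) triadic_kernel t x y) * `|f y| <=
    \sum_(t : {ffun 'I_n -> bool}) \sum_(k <oo) kf t k y)%E.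
  rewrite ge0_sume_distrl; last by move=> t _; exact: triadic_kernel_ge0.
  apply: lee_sum => t _; apply: nneseries_mulr_le => // k.
  exact: okernel_ge0.
have C0' : (0 <= (6 `^ (n%:R - alpha))%:E :> \bar R)%E by rewrite lee_fin.
apply: le_trans (lee_wpmul2l C0' le1).
rewrite abseM muleA [leLHS]muleC; apply: lee_wpmul2r => //.
rewrite gee0_abs; first exact: riesz_kernel_le.
by rewrite inve_ge0 lee_fin powR_ge0.
Qed.

End kernel.

(** The sum is at most the number of terms times the largest term. *)
Lemma poweR_sum_le (R : realType) (I : finType) (i0 : I) (a : I -> \bar R) (r : R) :
  0 <= r -> (forall i, 0 <= a i)%E ->
  ((\sum_i a i) `^ r <= (#|I|%:R `^ r)%:E * \sum_i (a i `^ r))%E.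
Proof.
move=> r0 a0; have [j _ amax] := arg_maxP (P := xpredT) a (isT : xpredT i0).
apply: (@le_trans _ _ ((#|I|%:R%:E * a j) `^ r)%E).
  apply: le_poweR2r => //; first exact: sume_ge0.
  apply: (@le_trans _ _ (\sum_(i : I) a j)%E).
    by apply: lee_sum => i _; exact: amax.
  by rewrite sumr_const mule_natl.
rewrite poweRM ?lee_fin// poweR_EFin lee_wpmul2l ?lee_fin ?powR_ge0//.
by rewrite (bigD1 j)//= leeDl// sume_ge0// => i _; exact: poweR_ge0.
Qed.

(** * The two-weight inequality *)

Section weighted_bound.
Context {R : realType} {n : nat}.
Local Notation mu := (@lebesgue_rV R n : {measure set (Rn R n) -> \bar R}).

(** The fractional integral is first replaced by its measurable majorant, and
    only then w by e^phi: integrals of functions that agree almost everywhere are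
    compared for measurable functions. *)
Lemma fractional_integral_le (phi psi : Rn R n -> R) (w : Rn R n -> \bar R) (alpha p q : R) :
  (0 < n)%N -> 0 < alpha < n%:R -> 1 < p -> p < q -> q^-1 = p^-1 - alpha / n%:R ->
  log_A_infty phi -> log_A_infty psi ->
  (forall x, q^-1 * phi x + (1 - p^-1) * psi x <= 0) ->
  measurable_fun [set: Rn R n] w -> (forall x, 0 <= w x)%E ->
  {ae mu, forall x, w x = (expR (phi x))%:E} ->
  exists2 C : R, 0 < C & forall f : Rn R n -> \bar R,
    measurable_fun [set: Rn R n] f ->
    (\int[mu]_x (`|f x| `^ p * ((expR (psi x)) `^ (1 - p))%:E) < +oo)%E ->
    (\int[mu]_x (`|fractional_integral alpha f x| `^ q * w x) <=
     C%:E * (\int[mu]_x (`|f x| `^ p * ((expR (psi x)) `^ (1 - p))%:E)) `^ (q / p))%E.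
Proof.
move=> n0 /andP[alpha0 alphan] p1 pq qE Aphi Apsi le0 mw w0 aew.
have q0 : 0 < q by lra.
have [C1 C10 HC] := triadic_bound n0 alpha0 p1 pq qE Aphi Apsi le0.
have [mphi _ _ _] := Aphi.
pose T : finType := {ffun 'I_n -> bool}.
pose C6 : R := 6 `^ (n%:R - alpha).
have C60 : 0 <= C6 by exact: powR_ge0.
pose N : R := #|T|%:R.
have N0 : 0 < N by rewrite ltr0n; apply/card_gt0P; exists [ffun=> false].
have CN0 : 0 < C6 `^ q * N `^ q by rewrite mulr_gt0// powR_gt0// powR_gt0.
exists (C6 `^ q * N `^ q * (N * C1)); first by rewrite !(mulr_gt0 CN0, mulr_gt0 N0).
move=> f mf; set F := (\int[mu]_x (_ * _))%E => Foo.
pose g x := (`|f x|)%E.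
have mg : measurable_fun [set: Rn R n] g by exact: measurableT_comp.
have g0 x : (0 <= g x)%E by exact: abse_ge0.
pose G (t : T) x := triadic_sum alpha t g x.
have mG t : measurable_fun [set: Rn R n] (G t) by exact: measurable_triadic_sum.
have G0 t x : (0 <= G t x)%E by apply: nneseries_ge0 => k _ _; exact: oterm_ge0.
pose H x := (C6%:E * \sum_(t : T) G t x)%E.
have mH : measurable_fun [set: Rn R n] H.
  by apply: measurable_funeM; apply: emeasurable_sum => t; exact: mG.
have H0 x : (0 <= H x)%E by rewrite mule_ge0 ?lee_fin// sume_ge0.
have me : measurable_fun [set: Rn R n] (fun x => (expR (phi x))%:E).
  by apply/measurable_EFinP; exact: measurableT_comp.
have mHq : measurable_fun [set: Rn R n] (fun x => H x `^ q)%E.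
  exact: (measurableT_comp (measurable_poweR q) mH).
have mGq t : measurable_fun [set: Rn R n] (fun x => G t x `^ q * (expR (phi x))%:E)%E.
  exact: (emeasurable_funM (measurableT_comp (measurable_poweR q) (mG t)) me).
have Gq0 t x : (0 <= G t x `^ q * (expR (phi x))%:E)%E.
  by rewrite mule_ge0 ?poweR_ge0// lee_fin expR_ge0.
apply: (@le_trans _ _ (\int[mu]_x (H x `^ q * w x))%E).
  apply: ge0_le_integral_sup => x _; first by rewrite mule_ge0// poweR_ge0.
  rewrite lee_wpmul2r//; apply: le_poweR2r; [exact: ltW|exact: abse_ge0|].
  exact: abse_fractional_integral_le.
have -> : (\int[mu]_x (H x `^ q * w x) = \int[mu]_x (H x `^ q * (expR (phi x))%:E))%E.
  apply: (ge0_ae_eq_integral measurableT (emeasurable_funM mHq mw) (emeasurable_funM mHq me)).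
  - by move=> x _; rewrite mule_ge0// poweR_ge0.
  - by move=> x _; rewrite mule_ge0 ?poweR_ge0// lee_fin expR_ge0.
  - by apply: filterS aew => x /= -> _.
have mS : measurable_fun [set: Rn R n] (fun x => \sum_(t : T) (G t x `^ q * (expR (phi x))%:E))%E.
  by apply: emeasurable_sum => t; exact: mGq.
apply: (@le_trans _ _ (\int[mu]_x ((C6 `^ q * N `^ q)%:E *
    \sum_(t : T) (G t x `^ q * (expR (phi x))%:E)))%E).
  apply: ge0_le_integral_sup => x _; first by rewrite mule_ge0 ?poweR_ge0// lee_fin expR_ge0.
  rewrite -ge0_sume_distrl; last by move=> t _; exact: poweR_ge0.
  rewrite muleA lee_wpmul2r ?lee_fin ?expR_ge0// /H poweRM ?lee_fin ?sume_ge0//.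
  rewrite poweR_EFin EFinM -muleA lee_wpmul2l ?lee_fin ?powR_ge0//.
  by apply: (poweR_sum_le [ffun=> false]) => //; exact: ltW.
rewrite (ge0_integralZl_EFin mu measurableT _ mS (ltW CN0)); last first.
  by move=> x _; apply: sume_ge0 => t _; exact: Gq0.
rewrite [in leRHS]EFinM -muleA lee_wpmul2l ?lee_fin ?(ltW CN0)//.
rewrite (ge0_integral_sum mu measurableT mGq); last by move=> t x _; exact: Gq0.
apply: (@le_trans _ _ (\sum_(t : T) (C1%:E * F `^ (q / p)))%E).
  by apply: lee_sum => t _; exact: HC.
by rewrite sumr_const EFinM -muleA mule_natl.
Qed.

End weighted_bound.

(** * Weights that are almost everywhere exponentials *)

Section transfer.
Context {R : realType} {n : nat}.
Local Notation mu := (@lebesgue_rV R n : {measure set (Rn R n) -> \bar R}).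
Implicit Types (w : Rn R n -> \bar R) (phi : Rn R n -> R) (Q K : set 'rV[R]_n).

Lemma lebesgue_rV_complete : measure_is_complete mu.
Proof. exact: measure_is_complete_caratheodory. Qed.

Lemma norm_coord_le_norm (x : 'rV[R]_n) i : `|x 0 i| <= `|x|.
Proof.
rewrite [leRHS]/Num.norm/= mx_normrE.
exact: (le_bigmax _ (fun ij : 'I_1 * 'I_n => `|x ij.1 ij.2|) (0, i)).
Qed.

Lemma compact_sub_cube K : compact K -> exists2 Q, cubes Q & K `<=` Q.
Proof.
move=> /compact_bounded [M [_ HM]].
have M0 : 0 < `|M| + 1 by rewrite ltr_wpDl.
have MM : M < `|M| + 1 by rewrite (le_lt_trans (ler_norm M))// ltrDl.
have {}HM := HM (`|M| + 1) MM.
pose a : 'rV[R]_n := \row_i (- (`|M| + 1)).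
exists [set x : 'rV[R]_n | forall i, a 0 i <= x 0 i <= a 0 i + 2 * (`|M| + 1)].
  by exists a; exists (2 * (`|M| + 1)) => //; rewrite mulr_gt0.
move=> x Kx i; rewrite mxE.
have := le_trans (norm_coord_le_norm x i) (HM x Kx); rewrite ler_norml => /andP[H1 H2].
by apply/andP; split => //; lra.
Qed.

(** The constant kap allows to divide the distance by the diameter: a power of
    the distance is a constant e^kap times the power of the quotient. *)
Section ae_exponential.
Variables (w : Rn R n -> \bar R) (phi : Rn R n -> R) (kap : R).
Hypothesis mphi : measurable_fun [set: Rn R n] phi.
Hypothesis aew : {ae mu, forall x, w x = (expR (kap + phi x))%:E}.

Let mexp : measurable_fun [set: Rn R n] (fun x => (expR (kap + phi x))%:E).
Proof.
apply/measurable_EFinP; apply: (measurableT_comp (@measurable_expR R)).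
exact: measurable_funD (measurable_cst _) mphi.
Qed.

(** By completeness of Lebesgue measure. *)
Lemma measurable_of_ae_exp : measurable_fun [set: Rn R n] w.
Proof.
apply: (ae_measurable_fun lebesgue_rV_complete _ mexp).
by apply: filterS aew => x /= -> _.
Qed.

Let aeQ (D : set (Rn R n)) (f : \bar R -> \bar R) :
  ae_eq mu D (fun x => f (w x)) (fun x => f (expR (kap + phi x))%:E).
Proof. by apply: filterS aew => x /= -> _. Qed.

Lemma integrable_of_ae_exp : weight w ->
  forall Q, cubes Q -> mu.-integrable Q (EFin \o (expR \o phi)).
Proof.
move=> [mw lw _] Q cQ; have mQ := measurable_cube cQ.
have i1 : mu.-integrable Q (EFin \o (fun x => expR (kap + phi x))).
  apply/integrableP; split; first exact: measurable_funTS mexp.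
  apply: le_lt_trans (lw Q (compact_cube cQ)).
  rewrite le_eqVlt; apply/orP; left; apply/eqP/esym.
  have mw' : measurable_fun [set: Rn R n] (fun x => `|w x|)%E by exact: measurableT_comp mw.
  have me' : measurable_fun [set: Rn R n] (fun x => `|(expR (kap + phi x))%:E|)%E.
    exact: measurableT_comp mexp.
  apply: (ge0_ae_eq_integral mQ (measurable_funTS mw') (measurable_funTS me')) => [x _|x _|].
  - exact: abse_ge0.
  - exact: abse_ge0.
  - exact: (aeQ Q abse).
apply: eq_integrable (integrableZl_EFin mQ (expR (- kap)) i1) => //.
by move=> x _ /=; rewrite -expRD addKr.
Qed.

(** As phi is integrable, the mean of ln w over a cube is finite and equals kap
    plus the mean of phi, so that the factors e^kap and e^(-kap) cancel. *)
Lemma log_A_infty_of_ae_exp : A_infty w ->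
  (forall Q, cubes Q -> mu.-integrable Q (EFin \o phi)) -> log_A_infty phi.
Proof.
move=> [ww]; set S := ereal_sup _ => Soo iphi.
have ie := integrable_of_ae_exp ww.
have [mw _ _] := ww.
split => //.
exists (`|fine S| + 1); first by rewrite ltr_wpDl.
move=> Q cQ; have [V0 VE] := vol_cube cQ; have mQ := measurable_cube cQ.
have iphiQ := iphi _ cQ; have ieQ := ie _ cQ.
set V := vol Q in V0 VE *; set I := \int[mu]_(x in Q) expR (phi x).
set m := V^-1 * \int[mu]_(x in Q) phi x.
have VE' : lebesgue_rV Q = V%:E by exact: VE.
have iE : avg Q w = (V^-1 * (expR kap * I))%:E.
  rewrite /avg VE' inver gt_eqF// EFinM; congr (_ * _)%E.
  transitivity (\int[mu]_(x in Q) (expR (kap + phi x))%:E)%E.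
    apply: (ae_eq_integral _ _ mQ (measurable_funTS mw) (measurable_funTS mexp)).
    exact: (aeQ Q id).
  transitivity (\int[mu]_(x in Q) ((expR kap)%:E * (expR (phi x))%:E))%E.
    by apply: eq_integral => x _; rewrite expRD EFinM.
  rewrite integralZl// EFinM /I /Rintegral fineK//.
  exact: integrable_fin_num.
have lE : avg Q (fun x => lne (w x)) = (kap + m)%:E.
  have mlw : measurable_fun [set: Rn R n] (fun x => lne (w x)).
    apply: (ae_measurable_fun lebesgue_rV_complete (f := fun x => (kap + phi x)%:E)).
      by apply: filterS aew => x /= -> _; rewrite lne_EFin ?expR_gt0// expRK.
    by apply/measurable_EFinP; exact: measurable_funD (measurable_cst _) mphi.
  rewrite /avg VE' inver gt_eqF//.
  have -> : (\int[mu]_(x in Q) lne (w x) = \int[mu]_(x in Q) (kap + phi x)%:E)%E.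
    apply: (ae_eq_integral _ _ mQ (measurable_funTS mlw)).
      by apply: measurable_funTS; apply/measurable_EFinP; exact: measurable_funD (measurable_cst _) mphi.
    by apply: filterS aew => x /= -> _; rewrite lne_EFin ?expR_gt0// expRK.
  have -> : (\int[mu]_(x in Q) (kap + phi x)%:E = (\int[mu]_(x in Q) (kap + phi x))%:E)%E.
    rewrite /Rintegral fineK//; apply: integrable_fin_num => //.
    exact: integrableD_EFin (integrable_cube_cst kap cQ) iphiQ.
  rewrite RintegralD//; last exact: integrable_cube_cst.
  rewrite Rintegral_cube_cst// -EFinM mulrDr -/m; congr ((_ + _)%:E).
  by rewrite mulrCA mulVf ?mulr1// gt_eqF.
have HS : ((V^-1 * I * expR (- m))%:E <= S)%E.
  apply: ereal_sup_ubound; exists Q => //.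
  rewrite iE lE /= -EFinM; congr EFin.
  rewrite opprD expRD expRN.
  by field; rewrite !gt_eqF ?expR_gt0.
have Sfin : S = (fine S)%:E.
  rewrite fineK// fin_numE; apply/andP; split; last by rewrite lt_eqF.
  by rewrite gt_eqF// (lt_le_trans _ HS)// ltNyr.
rewrite Sfin lee_fin in HS.
have {}HS : V^-1 * I * expR (- m) <= `|fine S| + 1.
  by apply: le_trans HS _; rewrite (le_trans (ler_norm _))// lerDl.
move: HS; rewrite expRN ler_pdivrMr ?expR_gt0// mulrC ler_pdivrMr//.
by rewrite mulrAC.
Qed.

End ae_exponential.

Lemma A_infty_of_ae_exp w phi : (forall x, 0 <= w x)%E ->
  {ae mu, forall x, w x = (expR (phi x))%:E} -> log_A_infty phi -> A_infty w.
Proof.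
move=> w0 aew [mphi iphi ie [K K0 HK]].
have mexp : measurable_fun [set: Rn R n] (fun x => (expR (phi x))%:E).
  by apply/measurable_EFinP; exact: measurableT_comp.
have aew' : {ae mu, forall x, w x = (expR (0 + phi x))%:E}.
  by apply: filterS aew => x; rewrite add0r.
have mw := measurable_of_ae_exp mphi aew'.
have mlw : measurable_fun [set: Rn R n] (fun x => lne (w x)).
  apply: (ae_measurable_fun lebesgue_rV_complete (f := EFin \o phi)).
    by apply: filterS aew => x /= -> _; rewrite lne_EFin ?expR_gt0// expRK.
  exact/measurable_EFinP.
have IQ Q : cubes Q -> (\int[mu]_(x in Q) w x = (\int[mu]_(x in Q) expR (phi x))%:E)%E.
  move=> cQ; have mQ := measurable_cube cQ.
  transitivity (\int[mu]_(x in Q) (expR (phi x))%:E)%E.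
    apply: (ae_eq_integral _ _ mQ (measurable_funTS mw) (measurable_funTS mexp)).
    by apply: filterS aew => x /= -> _.
  rewrite /Rintegral fineK//; apply: integrable_fin_num => //; exact: ie.
have ww : weight w.
  split => //; last exact: aeW.
  move=> C cC; have [Q cQ CQ] := compact_sub_cube cC.
  apply: (@le_lt_trans _ _ (\int[mu]_(x in Q) w x)%E); last by rewrite IQ// ltry.
  rewrite integral_mkcond [leRHS]integral_mkcond.
  apply: ge0_le_integral_sup => x _; first by rewrite patchE; case: ifP.
  rewrite !patchE; case: ifPn => [xC|_]; last by case: ifP.
  by rewrite gee0_abs// mem_set//; apply: CQ; rewrite inE in xC.
split => //; apply: (@le_lt_trans _ _ K%:E); last exact: ltry.
apply: ge_ereal_sup => _ [Q cQ <-].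
have [V0 VE] := vol_cube cQ; have mQ := measurable_cube cQ.
have VE' : lebesgue_rV Q = (vol Q)%:E by exact: VE.
have iphiQ := iphi _ cQ.
have lE : (\int[mu]_(x in Q) lne (w x) = (\int[mu]_(x in Q) phi x)%:E)%E.
  transitivity (\int[mu]_(x in Q) (phi x)%:E)%E.
    apply: (ae_eq_integral _ _ mQ (measurable_funTS mlw)).
      by apply: measurable_funTS; exact/measurable_EFinP.
    by apply: filterS aew => x /= -> _; rewrite lne_EFin ?expR_gt0// expRK.
  by rewrite /Rintegral fineK//; apply: integrable_fin_num.
rewrite /avg VE' inver gt_eqF// IQ// lE /= -EFinM lee_fin expRN.
by rewrite ler_pdivrMr ?expR_gt0// mulrC ler_pdivrMr// mulrAC; exact: HK.
Qed.

End transfer.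

Lemma epow_expR (R : realType) (s r : R) : epow (expR s)%:E r = (expR (r * s))%:E.
Proof.
rewrite /epow; case: ifPn => r0; rewrite poweR_EFin powR_expR//.
by rewrite inver gt_eqF ?expR_gt0// -expRN mulNr opprK.
Qed.

Lemma epow_ge0 (R : realType) (t : \bar R) (r : R) : (0 <= epow t r)%E.
Proof. by rewrite /epow; case: ifP => _; rewrite ?inve_ge0 poweR_ge0. Qed.

Lemma ae_imply d (T : measurableType d) (R : realType) (mu : {measure set T -> \bar R})
    (P Q : T -> Prop) : (forall x, P x -> Q x) ->
  {ae mu, forall x, P x} -> {ae mu, forall x, Q x}.
Proof. exact: (@filterS _ _ (ae_filter_ringOfSetsType mu)). Qed.

(** * The distance to a median porous set *)

Section distance.
Context {R : realType} {n : nat}.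
Implicit Types (x y z : 'rV[R]_n) (E : set 'rV[R]_n).

Lemma dist_to_le E x z : E z -> dist_to x E <= enorm (x - z).
Proof.
move=> Ez; apply: ge_inf; last by exists z.
by exists 0 => _ [y _ <-]; exact: enorm_ge0.
Qed.

Lemma dist_to_ge0 E x : E !=set0 -> 0 <= dist_to x E.
Proof.
move=> [z Ez]; apply: lb_le_inf; first by exists (enorm (x - z)); exists z.
by move=> _ [y _ <-]; exact: enorm_ge0.
Qed.

Lemma dist_to_lipschitz E x y : E !=set0 ->
  dist_to x E <= dist_to y E + enorm (x - y).
Proof.
move=> [z0 Ez0]; rewrite -lerBlDr; apply: lb_le_inf.
  by exists (enorm (y - z0)); exists z0.
move=> _ [z Ez <-]; rewrite lerBlDr; apply: le_trans (dist_to_le x Ez) _.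
have -> : x - z = (y - z) + (x - y) by rewrite [RHS]addrC addrA subrK.
exact: enormD.
Qed.

Lemma enorm_le_ediam E x y : E x -> E y -> ((enorm (x - y))%:E <= ediam E)%E.
Proof. by move=> Ex Ey; apply: ereal_sup_ubound; exists (x, y). Qed.

(** A point closer to E than the diameter of E is within twice the diameter of
    every point of E. *)
Lemma near_sub_cube E (D : R) : E !=set0 -> 0 < D -> ediam E = D%:E ->
  exists2 Q, cubes Q & forall x, dist_to x E < D -> Q x.
Proof.
move=> [z0 Ez0] D0 ED; pose a : 'rV[R]_n := \row_i (z0 0 i - 2 * D).
exists [set x : 'rV[R]_n | forall i, a 0 i <= x 0 i <= a 0 i + 4 * D].
  by exists a; exists (4 * D) => //; rewrite mulr_gt0.
move=> x xD i; rewrite mxE.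
have [_ [y Ey <-] xy] : exists2 r, [set enorm (x - y) | y in E] r & r < D.
  by apply: inf_lt xD; exists (enorm (x - z0)); exists z0.
have yz : enorm (y - z0) <= D by rewrite -lee_fin -ED; exact: enorm_le_ediam.
have := norm_coord_le_enorm (x - y) i; have := norm_coord_le_enorm (y - z0) i.
rewrite !mxE => H1 H2.
have {}H1 := le_trans H1 yz; have {}H2 := le_lt_trans H2 xy.
move: H1 H2; rewrite ler_norml ltr_norml => /andP[? ?] /andP[? ?].
by apply/andP; split; lra.
Qed.

End distance.

Section median_porous_sets.
Context {R : realType} {n : nat}.
Local Notation mu := (@lebesgue_rV R n : {measure set (Rn R n) -> \bar R}).
Variables (E : set 'rV[R]_n) (b : R).
Hypotheses (E0 : E !=set0) (b0 : 0 < b) (Eb : I_infty E b).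
Local Notation delta := (fun x : Rn R n => dist_to x E).

(** The distance is recovered from the measurable weight d(x,E)^-b by taking a
    power. *)
Lemma measurable_dist_to : measurable_fun [set: Rn R n] delta.
Proof.
have [[mw _ _] _] := Eb.
pose w (x : Rn R n) := epow (dist_to x E)%:E (- b).
have bn0 : b != 0 by rewrite gt_eqF.
have -> : delta = (fun x => fine (w x) `^ (- b^-1)).
  apply/funext => x; rewrite /w /epow oppr_lt0 b0 opprK poweR_EFin inver.
  (* Where the distance vanishes the weight is infinite, its finite part is zero
     by convention, and zero to a negative power is zero. *)
  have [->|dn0] := eqVneq (dist_to x E) 0.
    by rewrite powR0// eqxx /= powR0// oppr_eq0 invr_eq0.
  rewrite powR_eq0 (negbTE dn0)/= -powRN -powRrM mulrNN mulfV// powRr1//.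
  exact: dist_to_ge0.
apply: (measurableT_comp (measurable_powR _)).
exact: (measurableT_comp (fine_measurable measurableT) mw).
Qed.

(** The weight d(x,E)^-b being infinite on the closure of E, local
    integrability forces this closure to be a null set. *)
Lemma ae_dist_to_gt0 : {ae mu, forall x : Rn R n, 0 < dist_to x E}.
Proof.
have [[mw lw _] _] := Eb.
pose w (x : Rn R n) := epow (dist_to x E)%:E (- b).
pose a (N : nat) : 'rV[R]_n := \row_i (- N.+1%:R).
pose Q (N : nat) := [set x : 'rV[R]_n | forall i, a N 0 i <= x 0 i <= a N 0 i + 2 * N.+1%:R].
have cQ N : cubes (Q N).
  by exists (a N); exists (2 * N.+1%:R) => //; rewrite mulr_gt0.
have H : {ae mu, forall x N, Q N x -> w x \is a fin_num}.
  apply/ae_foralln => N; apply: integrable_ae; first exact: measurable_cube.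
  apply/integrableP; split; first exact: measurable_funTS mw.
  exact: lw (compact_cube (cQ N)).
apply: ae_imply H => x Hx.
rewrite lt_neqAle dist_to_ge0// andbT eq_sym; apply/eqP => d0.
have := archi_boundP (normr_ge0 (x : 'rV[R]_n)); set N := Num.Def.archi_bound _ => xN.
have : Q N x.
  move=> i; rewrite mxE; have := norm_coord_le_norm x i => xi.
  have {xi} := le_lt_trans xi xN; rewrite ltr_norml => /andP[H1 H2].
  by rewrite -natr1; apply/andP; split; lra.
move/(Hx N); rewrite /w d0 /epow oppr_lt0 b0 opprK poweR_EFin powR0; last by rewrite gt_eqF.
by rewrite inver eqxx.
Qed.

Variable D : R.
Hypotheses (D0 : 0 < D) (ED : ediam E = D%:E).
Local Notation rho := (fun x : Rn R n => dist_to x E / D).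

Lemma measurable_rho : measurable_fun [set: Rn R n] rho.
Proof. exact: measurable_funM measurable_dist_to (measurable_cst _). Qed.

Lemma rho_ge0 x : 0 <= rho x.
Proof. by rewrite divr_ge0 ?dist_to_ge0// ltW. Qed.

Lemma rho_growth (z x y : 'rV[R]_n) l : 0 < l ->
  (forall i, z 0 i <= x 0 i <= z 0 i + l) -> (forall i, z 0 i <= y 0 i <= z 0 i + l) ->
  rho x <= rho y + n%:R / D * l.
Proof.
move=> l0 zx zy; have -> : n%:R / D * l = n%:R * l / D by rewrite mulrAC.
rewrite -mulrDl ler_pM2r ?invr_gt0//.
apply: le_trans (dist_to_lipschitz x y E0) _; rewrite lerD2l.
apply: enorm_le_coord => [|i]; first exact: ltW.
have /andP[? ?] := zx i; have /andP[? ?] := zy i.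
by rewrite !mxE ler_norml; apply/andP; split; lra.
Qed.

Lemma epow_dist_to (g : R) : {ae mu, forall x : Rn R n,
  epow (dist_to x E)%:E g = (expR (g * ln D + g * ln (rho x)))%:E}.
Proof.
apply: ae_imply ae_dist_to_gt0 => x d0.
rewrite -mulrDr -lnM ?posrE ?divr_gt0// [D * _]mulrC divfK ?gt_eqF//.
by rewrite -epow_expR lnK ?posrE.
Qed.

Lemma measurable_ln_rho (g : R) : measurable_fun [set: Rn R n] (fun x => g * ln (rho x)).
Proof.
apply: measurable_funM; first exact: measurable_cst.
exact: measurableT_comp (@measurable_ln R) measurable_rho.
Qed.

(** Where the logarithm is negative it is controlled by the locally integrable
    weight rho^-b, and where it is positive by rho, which is locally bounded. *)
Lemma integrable_ln_rho (Q : set 'rV[R]_n) : cubes Q ->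
  mu.-integrable Q (EFin \o (fun x => ln (rho x))).
Proof.
move=> cQ; have mQ := measurable_cube cQ.
have [wb _] := Eb.
have ie := integrable_of_ae_exp (measurable_ln_rho (- b)) (epow_dist_to (- b)) wb cQ.
have [z [l l0 QE]] := cQ.
pose M := rho z + n%:R / D * l.
have zQ i : z 0 i <= z 0 i <= z 0 i + l by rewrite lexx lerDl ltW.
have rM x : Q x -> rho x <= M by rewrite QE => Qx; exact: (rho_growth l0).
have M0 : 0 <= M by rewrite addr_ge0 ?rho_ge0// mulr_ge0 ?(ltW l0)// divr_ge0// ltW.
have i1 := integrableD_EFin mQ (integrableZl_EFin mQ b^-1 ie) (integrable_cube_cst M cQ).
apply: (le_integrable mQ _ _ i1).
  apply/measurable_EFinP; apply: measurable_funTS.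
  exact: measurableT_comp (@measurable_ln R) measurable_rho.
move=> x Qx; rewrite /= lee_fin [leRHS]ger0_norm; last first.
  by rewrite addr_ge0// mulr_ge0 ?expR_ge0// invr_ge0 ltW.
have r0 := rho_ge0 x; have rx := rM x Qx; set r := rho x in r0 rx *.
have e0 : 0 <= b^-1 * expR (- b * ln r) by rewrite mulr_ge0 ?expR_ge0// invr_ge0 ltW.
move: r0; rewrite le_eqVlt => /orP[/eqP r0|r0].
  have lr : ln r = 0 by rewrite ln0// -r0.
  rewrite lr in e0 *; by rewrite normr0 addr_ge0.
have [l0'|l0'] := leP 0 (ln r).
  rewrite ger0_norm//; apply: (@le_trans _ _ r); first exact/ltW/ln_sublinear.
  by apply: le_trans rx _; rewrite lerDr.
rewrite ltr0_norm//; apply: (@le_trans _ _ (b^-1 * expR (- b * ln r))); last by rewrite lerDl.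
rewrite ler_pdivlMl// mulrN -mulNr.
exact/ltW/lt_id_expR.
Qed.

Lemma log_A_infty_ln_rho (g : R) : I_infty E (- g) ->
  log_A_infty (fun x : Rn R n => g * ln (rho x)).
Proof.
rewrite /I_infty /= opprK => Ag.
apply: (log_A_infty_of_ae_exp (measurable_ln_rho g) (epow_dist_to g) Ag) => Q cQ.
exact: (integrableZl_EFin (measurable_cube cQ) g (integrable_ln_rho cQ)).
Qed.

Lemma log_A_infty_two_power (g1 g2 : R) : (0 < n)%N ->
  I_infty E (- g1) -> I_infty E (- g2) ->
  log_A_infty (fun x : Rn R n => (if rho x < 1 then g1 else g2) * ln (rho x)).
Proof.
move=> n0 I1 I2; have [Q0 cQ0 near0] := near_sub_cube E0 D0 ED.
have c0 : 0 < n%:R / D by rewrite divr_gt0// ltr0n.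
apply: (log_A_infty_glue c0 cQ0 measurable_rho rho_ge0 rho_growth _ integrable_ln_rho).
- by move=> x; rewrite ltr_pdivrMr// mul1r => /near0.
- exact: log_A_infty_ln_rho.
- exact: log_A_infty_ln_rho.
Qed.

Lemma two_power_weightE (g1 g2 : R) : {ae mu, forall x : Rn R n,
  two_power_weight E g1 g2 x =
  (expR ((if rho x < 1 then g1 else g2) * ln (rho x)))%:E}.
Proof.
apply: ae_imply ae_dist_to_gt0 => x d0.
rewrite /two_power_weight ED /= lte_fin ltr_pdivrMr// mul1r.
have r0 : 0 < dist_to x E / D by rewrite divr_gt0.
by case: ifP => _; rewrite -epow_expR lnK ?posrE.
Qed.

End median_porous_sets.

Theorem theorem1p7 (R : realType) (n : nat) (alpha p : R)
    (halpha : 0 < alpha < n%:R) (hp : 1 < p < n%:R / alpha)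
    (E : set 'rV[R]_n) (hE : median_porous E)
    (hdiam : (0 < ediam E < +oo)%E) :
  let q := n%:R * p / (n%:R - alpha * p) in
  let p' := p / (p - 1) in
  forall g1 g2 d1 d2 : R,
    I_infty E (- g1) -> I_infty E (- g2) ->
    I_infty E (d1 * (p' / p)) -> I_infty E (d2 * (p' / p)) ->
    q / p * d1 <= g1 -> g2 <= q / p * d2 ->
    [/\ A_infty (two_power_weight E g1 g2),
        A_infty (fun x => epow (two_power_weight E d1 d2 x) (- (p' / p))) &
        exists2 C : R, 0 < C &
          forall f : Rn R n -> \bar R, measurable_fun [set: Rn R n] f ->
            ((\int[@lebesgue_rV R n]_x
                (`|fractional_integral alpha f x| `^ q
                 * two_power_weight E g1 g2 x)) `^ q^-1
             <= C%:E *
                (\int[@lebesgue_rV R n]_x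
                   (`|f x| `^ p * two_power_weight E d1 d2 x)) `^ p^-1)%E].
Proof.
move=> q p' g1 g2 d1 d2 Ig1 Ig2 Id1 Id2 dg1 gd2.
have [E0 [b b0 Eb]] := hE.
have /andP[alpha0 alphan] := halpha; have /andP[p1 pna] := hp.
have nR : 0 < n%:R :> R by lra.
have n0 : (0 < n)%N by rewrite -(ltr0n R).
have p0 : 0 < p by lra.
have ap : 0 < n%:R - alpha * p by rewrite subr_gt0 mulrC -ltr_pdivlMr.
have q0 : 0 < q by rewrite divr_gt0// mulr_gt0.
have pq : p < q.
  rewrite /q ltr_pdivlMr// mulrC ltr_pM2r// ltrBlDr ltrDl.
  exact: mulr_gt0.
have qE : q^-1 = p^-1 - alpha / n%:R.
  by rewrite /q; field; rewrite !gt_eqF.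
pose D := fine (ediam E).
have ED : ediam E = D%:E.
  by have /andP[h1 h2] := hdiam; rewrite fineK// ge0_fin_numE// ltW.
have D0 : 0 < D by have /andP[h1 _] := hdiam; rewrite -lte_fin -ED.
have rE : p' / p = (p - 1)^-1.
  by rewrite /p'; field; rewrite !gt_eqF//; lra.
set r := p' / p in rE Id1 Id2 *.
have p10 : 0 < p - 1 by lra.
pose rho x := dist_to x E / D.
pose pow (a1 a2 : R) (x : Rn R n) := (if rho x < 1 then a1 else a2) * ln (rho x).
have Apow a1 a2 : I_infty E (- a1) -> I_infty E (- a2) -> log_A_infty (pow a1 a2).
  exact: (log_A_infty_two_power E0 b0 Eb D0 ED n0).
have aepow a1 a2 := two_power_weightE E0 b0 Eb D0 ED a1 a2.
have Aphi : log_A_infty (pow g1 g2) by exact: Apow.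
have Apsi : log_A_infty (pow (- (d1 * r)) (- (d2 * r))) by apply: Apow; rewrite opprK.
have aephi := aepow g1 g2.
have u0 x : (0 <= two_power_weight E g1 g2 x)%E.
  by rewrite /two_power_weight; case: ifP => _; exact: epow_ge0.
have mphi a1 a2 : measurable_fun [set: Rn R n] (two_power_weight E a1 a2).
  apply: (measurable_of_ae_exp (phi := pow a1 a2) (kap := 0)).
    have -> : pow a1 a2 = (fun x => if rho x < 1 then a1 * ln (rho x) else a2 * ln (rho x)).
      by apply/funext => x; rewrite /pow; case: ifP.
    have mr : measurable_fun [set: Rn R n] rho := measurable_rho E0 b0 Eb D.
    have mlt : measurable_fun [set: Rn R n] (fun x => rho x < 1).
      exact: measurable_fun_ltr mr (measurable_cst _).
    exact: (measurable_fun_ifT mlt (measurable_ln_rho E0 b0 Eb D a1) (measurable_ln_rho E0 b0 Eb D a2)).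
  by apply: ae_imply (aepow a1 a2) => x; rewrite add0r.
split.
- exact: A_infty_of_ae_exp u0 aephi Aphi.
- apply: (A_infty_of_ae_exp _ _ Apsi) => [x|]; first exact: epow_ge0.
  apply: ae_imply (aepow d1 d2) => x ->; rewrite epow_expR.
  rewrite /pow -/(rho x); congr (expR _)%:E; case: ifP => _; ring.
(* The two terms add up to (g - (q/p) d) / q times ln rho, where both factors
   change sign together by the hypotheses on the exponents. *)
have le0 x : q^-1 * pow g1 g2 x + (1 - p^-1) * pow (- (d1 * r)) (- (d2 * r)) x <= 0.
  have pr : (1 - p^-1) * r = p^-1 by rewrite rE; field; rewrite !gt_eqF.
  have Er g d' : q^-1 * (g * ln (rho x)) + (1 - p^-1) * (- (d' * r) * ln (rho x)) =
      q^-1 * (g - q / p * d') * ln (rho x).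
    have -> : (1 - p^-1) * (- (d' * r) * ln (rho x)) =
       - (((1 - p^-1) * r) * d' * ln (rho x)) by ring.
    by rewrite pr; field; rewrite !gt_eqF.
  have qi0 : 0 <= q^-1 by rewrite invr_ge0 ltW.
  rewrite /pow; case: ltP => rx; rewrite Er.
    apply: mulr_ge0_le0; first by rewrite mulr_ge0// subr_ge0.
    exact/ln_le0/ltW.
  apply: mulr_le0_ge0; first by rewrite mulr_ge0_le0// subr_le0.
  exact: ln_ge0.
have [C C0 HC] := fractional_integral_le n0 halpha p1 pq qE Aphi Apsi le0 (mphi g1 g2) u0 aephi.
exists (C `^ q^-1); first by rewrite powR_gt0.
move=> f mf.
have FE : (\int[@lebesgue_rV R n]_x (`|f x| `^ p * two_power_weight E d1 d2 x) =
  \int[@lebesgue_rV R n]_x (`|f x| `^ p *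
    (expR (pow (- (d1 * r)) (- (d2 * r)) x) `^ (1 - p))%:E))%E.
  have mfp : measurable_fun [set: Rn R n] (fun x => `|f x| `^ p)%E.
    by apply: (measurableT_comp (measurable_poweR p)); exact: measurableT_comp mf.
  have [mpsi _ _ _] := Apsi.
  have me : measurable_fun [set: Rn R n]
      (fun x => (expR (pow (- (d1 * r)) (- (d2 * r)) x) `^ (1 - p))%:E).
    apply/measurable_EFinP; apply: (measurableT_comp (measurable_powR _)).
    exact: measurableT_comp mpsi.
  apply: (ae_eq_integral _ _ measurableT (emeasurable_funM mfp (mphi d1 d2)) (emeasurable_funM mfp me)).
  apply: ae_imply (aepow d1 d2) => x -> _.
  rewrite powR_expR /pow -/(rho x); congr (_ * (expR _)%:E)%E.
  have r1 : (1 - p) * r = - 1 by rewrite rE; field; rewrite gt_eqF.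
  have rr d' : (1 - p) * (- (d' * r) * ln (rho x)) = d' * ln (rho x).
    have -> : (1 - p) * (- (d' * r) * ln (rho x)) = - ((1 - p) * r) * d' * ln (rho x) by ring.
    by rewrite r1 opprK mul1r.
  by case: ifP => _; rewrite rr.
rewrite FE; clear FE; set F := (\int[_]_x (`|f x| `^ p * _))%E.
have F0 : (0 <= F)%E.
  apply: integral_ge0 => x _; apply: mule_ge0; first exact: poweR_ge0.
  by rewrite lee_fin powR_ge0.
have pi0 : p^-1 != 0 by rewrite gt_eqF// invr_gt0.
have [Foo|] := ltP F +oo%E; last first.
  rewrite leye_eq => /eqP ->; rewrite poweRyr// gt0_muley ?lte_fin ?powR_gt0//.
  exact: leey.
apply: le_trans (le_poweR2r _ _ (HC f mf Foo)) _.
- by rewrite invr_ge0 ltW.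
- by apply: integral_ge0 => x _; rewrite mule_ge0 ?poweR_ge0.
rewrite poweRM ?lee_fin ?(ltW C0) ?poweR_ge0// poweR_EFin -poweRrM.
have -> // : q / p * q^-1 = p^-1.
by field; rewrite !gt_eqF.
Qed.
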